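(* Let $V$ be a vector superspace over a field $\mathbb F$ of characteristic $0$ (parity $p$) with an even endomorphism $\partial$, let $\Pi V$ be $V$ with reversed parity, and let $W^{\mathrm{cl}}(\Pi V)=\bigoplus_{k\ge-1}W^{\mathrm{cl}}_k(\Pi V)$ be the $\mathbb Z$-graded Lie superalgebra associated to the classical operad $P^{\mathrm{cl}}(\Pi V)$. There is a bijective correspondence between the odd elements $X\in W_1^{\mathrm{cl}}(\Pi V)$ such that $X\Box X=0$ and the Poisson vertex superalgebra structures on $V$ (with the given $\partial$), under which the commutative associative product and the $\lambda$-bracket corresponding to $X$ are $$ab=(-1)^{p(a)}X^{\bullet\to\bullet}(a\otimes b),\qquad [a_\lambda b]=(-1)^{p(a)}X^{\bullet\ \bullet}_{\lambda,-\lambda-\partial}(a\otimes b).$$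
   Context: **Poisson vertex superalgebra** (PVA): a commutative associative superalgebra $V$ (not necessarily unital) with an even derivation $\partial$ and a parity preserving bilinear $\lambda$-bracket $V\times V\to V[\lambda]$ with $[\partial a_\lambda b]=-\lambda[a_\lambda b]$, $[a_\lambda\partial b]=(\lambda+\partial)[a_\lambda b]$, $[a_\lambda b]=-(-1)^{p(a)p(b)}[b_{-\lambda-\partial}a]$, $[a_\lambda[b_\mu c]]-(-1)^{p(a)p(b)}[b_\mu[a_\lambda c]]=[[a_\lambda b]_{\lambda+\mu}c]$, and $[a_\lambda bc]=[a_\lambda b]c+(-1)^{p(b)p(c)}[a_\lambda c]b$. **Graphs.** An $n$-graph has vertices $1,\dots,n$ and a (finite) collection of oriented edges $E(\Gamma)$ (multiple edges allowed). $\mathcal G(n)$ is the set of $n$-graphs without tadpoles; $\mathcal G_0(n)$ the acyclic ones (no unoriented cycles, in particular no multiple edges). An oriented cycle is a set of edges $\{i_1\to i_2,\dots,i_s\to i_1\}\subset E(\Gamma)$. $\sigma(\Gamma)$ is $\Gamma$ with vertex $i$ relabeled $\sigma(i)$. $\bullet\to\bullet$ is the 2-graph with the single edge $1\to2$; $\bullet\ \bullet$ is the 2-graph without edges. **Operad $P^{\mathrm{cl}}(U)$** ($U$ a superspace with even endomorphism $\partial$; $\langle\Phi\rangle$ = image of $\Phi$). $P^{\mathrm{cl}}(n)$ is the superspace of maps $f:\mathcal G(n)\times U^{\otimes n}\to U[\lambda_1,\dots,\lambda_n]/\langle\partial+\lambda_1+\dots+\lambda_n\rangle$, $(\Gamma,v)\mapsto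 f^\Gamma_{\lambda_1,\dots,\lambda_n}(v)$, linear in $v$, with: $f^\Gamma=0$ unless $\Gamma\in\mathcal G_0(n)$; $\sum_{e\in C}f^{\Gamma\setminus e}=0$ for every oriented cycle $C$ of $\Gamma$; and for the vertex set $I$ of every connected component of $\Gamma$, $\partial_{\lambda_i}f^\Gamma(v)$ is the same for all $i\in I$, and $f^\Gamma(\sum_{i\in I}\partial_iv)=-(\sum_{i\in I}\lambda_i)f^\Gamma(v)$ ($\partial_i$ = $\partial$ on the $i$-th factor). Hence $X^{\bullet\to\bullet}_{\lambda_1,\lambda_2}$ depends only on $\lambda_1+\lambda_2\equiv-\partial$ and has values in $U$; and $U[\lambda_1,\lambda_2]/\langle\partial+\lambda_1+\lambda_2\rangle\simeq U[\lambda]$ via $\lambda_1=\lambda$, $\lambda_2=-\lambda-\partial$. Action: $(f^\sigma)^\Gamma_{\lambda_1,\dots,\lambda_n}(v_1\otimes\dots\otimes v_n)=\epsilon_v(\sigma)f^{\sigma(\Gamma)}_{\lambda_{\sigma^{-1}(1)},\dots,\lambda_{\sigma^{-1}(n)}}(v_{\sigma^{-1}(1)}\otimes\dots\otimes v_{\sigma^{-1}(n)})$, $\epsilon_v(\sigma)=\prod_{i<j,\sigma(i)>\sigma(j)}(-1)^{\mathrm{par}(v_i)\mathrm{par}(v_j)}$ ($\mathrm{par}$ = parity of $U$). Composition: for $m_1,\dots,m_n\ge0$, $M_i=m_1+\dots+m_i$, $\Gamma\in\mathcal G(M_n)$, let $\Delta_i(\Gamma)$ ($1\le i\le n$) be the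 full subgraph on $M_{i-1}+1,\dots,M_i$ (relabeled $1,\dots,m_i$), and $\Delta_0(\Gamma)\in\mathcal G(n)$ the graph obtained by collapsing each such block (with its inner edges) to the vertex $i$. For $k$ in the $i$-th block let $\mathcal E(k)$ be the set of $j\in\{1,\dots,n\}$ joined to $i$ by an unoriented path in $\Delta_0(\Gamma)$ without repeated edges, whose edge at $i$ comes from an edge of $\Gamma$ with an endpoint at $k$; $X(k)=\sum_{j\in\mathcal E(k)}x_j$; $\Lambda_i=\sum_{k=M_{i-1}+1}^{M_i}\lambda_k$. Then $(f(g_1\otimes\dots\otimes g_n))^\Gamma=0$ if $\Delta_0(\Gamma)$ is not acyclic, and otherwise $(f(g_1\otimes\dots\otimes g_n))^\Gamma_{\lambda_1,\dots,\lambda_{M_n}}(v_1\otimes\dots\otimes v_{M_n})=\pm f^{\Delta_0(\Gamma)}_{\Lambda_1,\dots,\Lambda_n}\big(\bigotimes_i(g_i)^{\Delta_i(\Gamma)}_{\lambda_{M_{i-1}+1}+X(M_{i-1}+1),\dots,\lambda_{M_i}+X(M_i)}(v_{M_{i-1}+1}\otimes\dots\otimes v_{M_i})\big)$, where after expansion each $x_j$ is replaced by $\Lambda_j+\partial$, $\partial$ acting on the $j$-th tensor factor, and $\pm=(-1)^{\sum_{i<j}\mathrm{par}(g_j)(\mathrm{par}(v_{M_{i-1}+1})+\dots+\mathrm{par}(v_{M_i}))}$. **Lie superalgebra.** $W_k^{\mathrm{cl}}(U)=P^{\mathrm{cl}}(U)(k+1)^{S_{k+1}}$; for $f\in W_n,g\in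 W_m$, $f\Box g=\sum_{\sigma\in S_{m+1,n}}(f\circ_1g)^{\sigma^{-1}}$, $f\circ_1g=f(g\otimes1\otimes\dots\otimes1)$, with $S_{m+1,n}$ the permutations of $\{1,\dots,m+n+1\}$ increasing on $\{1,\dots,m+1\}$ and on $\{m+2,\dots,m+n+1\}$; $[f,g]=f\Box g-(-1)^{\mathrm{par}(f)\mathrm{par}(g)}g\Box f$. *)

(* Defs.v *)
From HB Require Import structures.
From mathcomp Require Import all_boot all_order all_algebra all_fingroup.
From mathcomp Require Import finmap boolp.
From mathcomp.multinomials Require Import monalg.

Set Implicit Arguments.
Unset Strict Implicit.
Unset Printing Implicit Defensive.

Import GRing.Theory.
Import tagnat.

Local Open Scope fset_scope.
Local Open Scope quotient_scope.
Local Open Scope ring_scope.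

(* [scomp V b] is the projection of V = V_0 (+) V_1 onto its component of
   parity [b], with [true] the odd parity. *)
Record superspace (F : fieldType) := Superspace {
  svec :> lmodType F;
  scomp : bool -> {linear svec -> svec};
  scompK : forall b c v, scomp b (scomp c v) = if b == c then scomp b v else 0;
  scompD : forall v, scomp false v + scomp true v = v }.

Definition homog (F : fieldType) (V : superspace F) (b : bool) (v : V) : Prop :=
  scomp V b v = v.

Definition even_map (F : fieldType) (V : superspace F) (h : V -> V) : Prop :=
  forall b v, homog b v -> homog b (h v).

Section ParityReversal.
Variables (F : fieldType) (V : superspace F).

Fact parity_rev_compK b c (v : V) :
  scomp V (~~ b) (scomp V (~~ c) v) = if b == c then scomp V (~~ b) v else 0.
Proof. by rewrite scompK (inj_eq negb_inj). Qed.

Fact parity_rev_compD (v : V) : scomp V (~~ false) v + scomp V (~~ true) v = v.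
Proof. by rewrite addrC scompD. Qed.

(* The superspace Pi V. *)
Definition parity_rev : superspace F := Superspace parity_rev_compK parity_rev_compD.

End ParityReversal.

(* V[lambda_1,...,lambda_n]; multinomials only gives the module structure on
   {malg R[K]} for a ring R. *)
Definition lpoly (F : fieldType) (V : lmodType F) (n : nat) : Type :=
  {malg V['X_{1..n}]}.

HB.instance Definition _ (F : fieldType) (V : lmodType F) n :=
  GRing.Zmodule.on (lpoly V n).

(* The coefficient of lambda^m in p, and the monomial v lambda^m; locked to
   avoid costly unfoldings. *)
HB.lock Definition lpcoef (F : fieldType) (V : lmodType F) (n : nat)
  (m : 'X_{1..n}) (p : lpoly V n) : V := mcoeff m p.
HB.lock Definition lpmono (F : fieldType) (V : lmodType F) (n : nat)
  (m : 'X_{1..n}) (v : V) : lpoly V n := mkmalgU m v.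

Section LPolyBasics.
Variables (F : fieldType) (V : lmodType F) (n : nat).
Local Notation lpcoef := (@lpcoef F V n).
Local Notation lpmono := (@lpmono F V n).

Definition lpsupp (p : lpoly V n) : {fset 'X_{1..n}} := msupp p.

Lemma lpolyP (p q : lpoly V n) : (forall m, lpcoef m p = lpcoef m q) <-> p = q.
Proof. by rewrite lpcoef.unlock; exact: malgP. Qed.

Fact lpcoef_additive m : zmod_morphism (lpcoef m).
Proof. by rewrite lpcoef.unlock; exact: mcoeffB. Qed.
HB.instance Definition _ m :=
  GRing.isZmodMorphism.Build (lpoly V n) V (lpcoef m) (lpcoef_additive m).

Fact lpmono_additive m : zmod_morphism (lpmono m).
Proof. by rewrite lpmono.unlock; exact: monalgUB. Qed.
HB.instance Definition _ m :=
  GRing.isZmodMorphism.Build V (lpoly V n) (lpmono m) (lpmono_additive m).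

Lemma lpcoef_mono m v m' : lpcoef m' (lpmono m v) = v *+ (m == m').
Proof. by rewrite lpcoef.unlock lpmono.unlock; exact: mcoeffU. Qed.

Lemma lpsuppB_le (p q : lpoly V n) : lpsupp (p - q) `<=` lpsupp p `|` lpsupp q.
Proof. exact: msuppB_le. Qed.

Lemma lpcoef_outdom m p : m \notin lpsupp p -> lpcoef m p = 0.
Proof. by rewrite lpcoef.unlock; exact: mcoeff_outdom. Qed.

Lemma lpcoef_neq0 m p : (lpcoef m p != 0) = (m \in lpsupp p).
Proof. by rewrite lpcoef.unlock; exact: mcoeff_neq0. Qed.

End LPolyBasics.

Section LPolyExtension.
Variables (F : fieldType) (V : lmodType F) (n : nat).

Definition lpC (v : V) : lpoly V n := lpmono mone v.

(* The additive extension of a map given on the monomials v lambda^m. *)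
Definition lpext (A : zmodType) (h : 'X_{1..n} -> V -> A) (p : lpoly V n) : A :=
  \sum_(m <- lpsupp p) h m (lpcoef m p).

Lemma lpextEw (A : zmodType) (h : 'X_{1..n} -> {additive V -> A})
    (p : lpoly V n) (E : {fset 'X_{1..n}}) :
  lpsupp p `<=` E -> lpext h p = \sum_(m <- E) h m (lpcoef m p).
Proof.
move=> sub; rewrite /lpext (big_fset_incl _ sub) // => m _ hm.
by rewrite (lpcoef_outdom hm) raddf0.
Qed.

Lemma lpext_additive (A : zmodType) (h : 'X_{1..n} -> {additive V -> A}) :
  zmod_morphism (lpext h).
Proof.
move=> p q; set E := lpsupp p `|` lpsupp q.
rewrite (@lpextEw _ _ (p - q) E); last exact: lpsuppB_le.
rewrite (@lpextEw _ _ p E) ?fsubsetUl // (@lpextEw _ _ q E) ?fsubsetUr //.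
by rewrite -sumrB; apply: eq_bigr => m _; rewrite !raddfB.
Qed.

End LPolyExtension.

Arguments lpC {F V} n v.

Definition lpmap (F : fieldType) (V W : lmodType F) n (h : V -> W)
    (p : lpoly V n) : lpoly W n :=
  lpext (fun m v => lpmono m (h v)) p.

Lemma lpmapE (F : fieldType) (V W : lmodType F) n (h : {additive V -> W})
    (p : lpoly V n) m :
  lpcoef m (lpmap h p) = h (lpcoef m p).
Proof.
rewrite /lpmap /lpext raddf_sum /=.
have [hm|hm] := boolP (m \in lpsupp p).
  rewrite (big_fsetD1 m) //= lpcoef_mono eqxx big1_fset ?addr0 // => m' + _.
  by rewrite in_fsetD1 lpcoef_mono => /andP[/negbTE-> _].
rewrite (lpcoef_outdom hm) raddf0 big1_fset // => m' hm' _.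
by rewrite lpcoef_mono; case: eqP hm => // <-; rewrite hm'.
Qed.

Section LPolyModule.
Variables (F : fieldType) (V : lmodType F).
Implicit Types n : nat.

Definition lpscale n (c : F) (p : lpoly V n) : lpoly V n :=
  lpmap ( *:%R c) p.

Lemma lpscaleE n c (p : lpoly V n) m :
  lpcoef m (lpscale c p) = c *: lpcoef m p.
Proof. exact: (lpmapE ( *:%R c)). Qed.

Fact lpscaleA n a b (p : lpoly V n) :
  lpscale a (lpscale b p) = lpscale (a * b) p.
Proof. by apply/lpolyP => m; rewrite !lpscaleE scalerA. Qed.

Fact lpscale1 n : left_id 1 (@lpscale n).
Proof. by move=> p; apply/lpolyP => m; rewrite lpscaleE scale1r. Qed.

Fact lpscaleDr n : right_distributive (@lpscale n) +%R.
Proof.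
by move=> a p q; apply/lpolyP => m; rewrite !(lpscaleE, raddfD) /= !lpscaleE.
Qed.

Fact lpscaleDl n (p : lpoly V n) : {morph (@lpscale n)^~ p : a b / a + b}.
Proof.
move=> a b; apply/lpolyP => m.
by rewrite lpscaleE raddfD /= !lpscaleE scalerDl.
Qed.

HB.instance Definition _ n := GRing.Zmodule_isLmodule.Build F (lpoly V n)
  (@lpscaleA n) (@lpscale1 n) (@lpscaleDr n) (@lpscaleDl n).

Lemma lpcoefZ n c (p : lpoly V n) m : lpcoef m (c *: p) = c *: lpcoef m p.
Proof. exact: lpscaleE. Qed.

(* Multiplication by lambda_i, and partial derivative in lambda_i. *)
Definition lpvar n (i : 'I_n) (p : lpoly V n) : lpoly V n :=
  lpext (fun m v => lpmono (mmul (ucm i) m) v) p.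

Definition lpdiff n (i : 'I_n) (p : lpoly V n) : lpoly V n :=
  lpext (fun m v => lpmono (divcm m (ucm i)) (v *+ m i)) p.

(* The operator T_0^{m_0} o ... o T_{n-1}^{m_{n-1}}; it is only used with
   pairwise commuting T_i. *)
Definition monop n (A : Type) (T : 'I_n -> A -> A) (m : 'X_{1..n}) : A -> A :=
  \big[comp/id]_(i < n) iter (m i) (T i).

(* The result of substituting, in p, the operator T_i for lambda_i, where the
   coefficients of p are put to the right of the operators; e.g. [T_i] can be
   - lambda - partial. *)
Definition lpsubst n k (T : 'I_n -> lpoly V k -> lpoly V k) (p : lpoly V n) :
  lpoly V k := lpext (fun m v => monop T m (lpC k v)) p.

End LPolyModule.

Section LQuot.
Variables (F : fieldType) (V : lmodType F) (d : {linear V -> V}) (n : nat).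

Definition ltot (p : lpoly V n) : lpoly V n :=
  lpmap d p + \sum_(i < n) lpvar i p.

Definition ltot_im : {pred lpoly V n} := fun p => `[< exists q, p = ltot q >].

Lemma lpvar_additive i : zmod_morphism (@lpvar F V n i).
Proof. exact: (lpext_additive (fun m => @lpmono F V n (mmul (ucm i) m))). Qed.

Lemma lpvarZ i c (p : lpoly V n) : lpvar i (c *: p) = c *: lpvar i p.
Proof.
have sub : lpsupp (c *: p) `<=` lpsupp p.
  apply/fsubsetP => m; rewrite -!lpcoef_neq0.
  by apply: contra_neq => hm; rewrite lpcoefZ hm scaler0.
rewrite /lpvar (lpextEw (fun m => @lpmono F V n (mmul (ucm i) m)) sub).
rewrite /lpext scaler_sumr; apply: eq_bigr => l _ /=.
by apply/lpolyP => m; rewrite !(lpcoefZ, lpcoef_mono) scalerMnr.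
Qed.

Lemma ltot_additive : zmod_morphism ltot.
Proof.
move=> p q; rewrite /ltot opprD addrACA; congr (_ + _).
  by apply/lpolyP => m; rewrite raddfB /= !lpmapE !raddfB.
by rewrite -sumrB; apply: eq_bigr => i _; rewrite lpvar_additive.
Qed.

Lemma ltotZ c p : ltot (c *: p) = c *: ltot p.
Proof.
rewrite /ltot scalerDr; congr (_ + _).
  by apply/lpolyP => m; rewrite lpcoefZ !(lpmapE d) lpcoefZ /= linearZ.
by rewrite scaler_sumr; apply: eq_bigr => i _; rewrite lpvarZ.
Qed.

Fact ltot_im_zmod : zmod_closed ltot_im.
Proof.
split=> [|p q /asboolP[p' ->] /asboolP[q' ->]].
  by apply/asboolP; exists 0; rewrite -[0 in RHS](subrr 0) ltot_additive subrr.
by apply/asboolP; exists (p' - q'); rewrite ltot_additive.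
Qed.

HB.instance Definition _ := GRing.isZmodClosed.Build _ ltot_im ltot_im_zmod.

(* V[lambda_1,...,lambda_n]/<partial + lambda_1 + ... + lambda_n>. *)
Definition lquot : Type := {ideal_quot ltot_im}.

HB.instance Definition _ := Choice.on lquot.
HB.instance Definition _ := GRing.Zmodule.on lquot.

Definition qpi (p : lpoly V n) : lquot := \pi_({ideal_quot ltot_im}) p.
Definition qrepr (x : lquot) : lpoly V n :=
  generic_quotient.repr (x : {ideal_quot ltot_im}).

Lemma qreprK : cancel qrepr qpi.
Proof. exact: reprK. Qed.

Lemma qpi_eq p q : qpi p = qpi q <-> p - q \in ltot_im.
Proof. by rewrite Quotient.idealrBE; split=> [/eqP|/eqP]. Qed.

Lemma qpiD p q : qpi (p + q) = qpi p + qpi q.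
Proof. by rewrite /qpi pi_addr. Qed.

Definition qscale (c : F) (x : lquot) : lquot := qpi (c *: qrepr x).

Lemma qpiZ c p : qpi (c *: p) = qscale c (qpi p).
Proof.
have /qpi_eq/asboolP[q Hq] : qpi p = qpi (qrepr (qpi p)) by rewrite qreprK.
apply/qpi_eq/asboolP; exists (c *: q).
by rewrite -scalerBr Hq ltotZ.
Qed.

Fact qscaleA a b x : qscale a (qscale b x) = qscale (a * b) x.
Proof. by rewrite -[x]qreprK -!qpiZ scalerA. Qed.

Fact qscale1 : left_id 1 qscale.
Proof. by move=> x; rewrite -[x]qreprK -qpiZ scale1r. Qed.

Fact qscaleDr : right_distributive qscale +%R.
Proof.
by move=> a x y; rewrite -[x]qreprK -[y]qreprK -qpiD -!qpiZ scalerDr qpiD.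
Qed.

Fact qscaleDl x : {morph qscale^~ x : a b / a + b}.
Proof. by move=> a b; rewrite -[x]qreprK -!qpiZ scalerDl qpiD. Qed.

HB.instance Definition _ := GRing.Zmodule_isLmodule.Build F lquot
  qscaleA qscale1 qscaleDr qscaleDl.

End LQuot.

(* The map between quotients induced by a map T of polynomials. It is computed
   on a chosen representative, and is only used when the resulting class does
   not depend on the choice. *)
Definition qmap (F : fieldType) (V : lmodType F) (d : {linear V -> V}) n k
    (T : lpoly V n -> lpoly V k) (x : lquot d n) : lquot d k :=
  qpi d (T (qrepr x)).

(* Multigraphs without tadpoles, given by the multiplicity of each oriented
   edge i -> j, i.e. of each pair (i, j). *)
Record graph (n : nat) := Graph {
  mult : {ffun 'I_n * 'I_n -> nat};
  mult_diag : forall i, mult (i, i) = 0%N }.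

Section Graphs.
Variable n : nat.
Implicit Types (G : graph n) (i j : 'I_n).

Fact mkgraph_subproof (c : 'I_n -> 'I_n -> nat) i :
  [ffun e => if e.1 == e.2 then 0 else c e.1 e.2]%N (i, i) = 0%N.
Proof. by rewrite ffunE eqxx. Qed.

(* The graph with [c i j] edges i -> j for i != j (loops are discarded). *)
Definition mkgraph (c : 'I_n -> 'I_n -> nat) : graph n :=
  Graph (mkgraph_subproof c).

Definition relabel (s : 'S_n) G : graph n :=
  mkgraph (fun i j => mult G ((s^-1)%g i, (s^-1)%g j)).

Definition del_edge G (e : 'I_n * 'I_n) : graph n :=
  mkgraph (fun i j => mult G (i, j) - ((i, j) == e))%N.

(* A step along the edge [a.1], from its tail to its head if [a.2] is false and
   from its head to its tail if [a.2] is true. *)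
Definition step : Type := (('I_n * 'I_n) * bool)%type.
Definition step_src (a : step) := if a.2 then a.1.2 else a.1.1.
Definition step_tgt (a : step) := if a.2 then a.1.1 else a.1.2.

Fixpoint walk i (s : seq step) j : bool :=
  if s is a :: s' then (step_src a == i) && walk (step_tgt a) s' j else i == j.

(* An unoriented path from i to j without repeated edges; parallel edges of G
   are considered as different edges. *)
Definition trail G i (s : seq step) j : bool :=
  walk i s j && [forall e, count_mem e (map fst s) <= mult G e]%N.

Definition acyclic G : Prop := forall i s, trail G i s i -> s = [::].

Definition oriented_cycle G (s : seq step) : Prop :=
  [/\ s != [::], all (fun a => ~~ a.2) s & exists i, trail G i s i].

Definition adjacent G : rel 'I_n :=
  [rel i j | (0 < mult G (i, j)) || (0 < mult G (j, i))]%N.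

Definition component G i : {set 'I_n} := [set j | connect (adjacent G) i j].

End Graphs.

Definition empty_graph n : graph n := mkgraph (fun _ _ => 0%N).
Definition arrow_graph : graph 2 :=
  mkgraph (fun i j => ((i == ord0) && (j == ord_max)) : nat).

(* Maps G(n) x U^n -> U[lambda_1,...,lambda_n]/<partial + lambda_1 + ...>; a
   linear map on the n-th tensor power of U is represented by the corresponding
   multilinear map on U^n. *)
Definition cochain (F : fieldType) (U : superspace F) (d : {linear U -> U})
  (n : nat) : Type := graph n -> ('I_n -> U) -> lquot d n.

Section Operad.
Variables (F : fieldType) (U : superspace F) (d : {linear U -> U}).
Implicit Types n : nat.

Definition multilinear n (f : cochain d n) : Prop :=
  forall G (v : 'I_n -> U) i (c : F) (x y : U),
    f G [eta v with i |-> c *: x + y] =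
      c *: f G [eta v with i |-> x] + f G [eta v with i |-> y].

Record in_Pcl n (f : cochain d n) : Prop := InPcl {
  Pcl_lin : multilinear f;
  Pcl_acyclic : forall G v, ~ acyclic G -> f G v = 0;
  Pcl_cycle : forall G v (s : seq (step n)), oriented_cycle G s ->
    \sum_(a <- s) f (del_edge G a.1) v = 0;
  (* lpdiff i - lpdiff j preserves the image of partial + lambda_1 + ... *)
  Pcl_diff : forall G v i j, j \in component G i ->
    qmap (fun p => lpdiff i p - lpdiff j p) (f G v) = 0;
  Pcl_sesqui : forall G v i0,
    \sum_(i in component G i0) f G [eta v with i |-> d (v i)] =
    - qmap (fun p => \sum_(i in component G i0) lpvar i p) (f G v) }.

Definition qhomog n (b : bool) (x : lquot d n) : Prop :=
  exists2 p, x = qpi d p & forall m, homog b (lpcoef m p).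

Definition qcomp n (b : bool) : lquot d n -> lquot d n :=
  qmap (lpmap (scomp U b)).

Definition has_parity n (q : bool) (f : cochain d n) : Prop :=
  forall G (b : 'I_n -> bool) v, (forall i, homog (b i) (v i)) ->
    qhomog (q (+) \big[addb/false]_(i < n) b i) (f G v).

(* The component of parity q of f. *)
Definition parity_comp n (q : bool) (f : cochain d n) : cochain d n :=
  fun G v => \sum_(b : {ffun 'I_n -> bool})
    qcomp (q (+) \big[addb/false]_(i < n) b i)
          (f G (fun i => scomp U (b i) (v i))).

(* The action f^s of the symmetric group. The sum over b extends to all v the
   formula for homogeneous v. *)
Definition perm_sign n (s : 'S_n) (b : 'I_n -> bool) : nat :=
  \sum_(i < n) \sum_(j < n | (i < j) && (s j < s i)) (b i && b j).

Definition Pcl_act n (f : cochain d n) (s : 'S_n) : cochain d n :=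
  fun G v => \sum_(b : {ffun 'I_n -> bool})
    (-1) ^+ perm_sign s b *:
      qmap (lpsubst (fun i => lpvar ((s^-1)%g i)))
        (f (relabel s G)
           (fun i => scomp U (b ((s^-1)%g i)) (v ((s^-1)%g i)))).

Section Composition.
Variables (n : nat) (m : 'I_n -> nat) (N : nat) (eN : N = (\sum_(i < n) m i)%N).

(* The block of k, the position of k in its block, and the a-th vertex of the
   i-th block. *)
Definition blk (k : 'I_N) : 'I_n := sig1 (cast_ord eN k).
Definition blkpos (k : 'I_N) : 'I_(m (blk k)) := sig2 (cast_ord eN k).
Definition vtx (i : 'I_n) (a : 'I_(m i)) : 'I_N := cast_ord (esym eN) (Rank i a).

Definition inner_graph (G : graph N) (i : 'I_n) : graph (m i) :=
  mkgraph (fun a b => mult G (vtx a, vtx b)).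

Definition outer_graph (G : graph N) : graph n :=
  mkgraph (fun i j => \sum_(a < m i) \sum_(b < m j) mult G (vtx a, vtx b))%N.

(* The set E(k). *)
Definition ext_set (G : graph N) (k : 'I_N) : {set 'I_n} :=
  [set j | `[< exists (a : step n) (s : seq (step n)) (k' : 'I_N),
      [/\ trail (outer_graph G) (blk k) (a :: s) j,
          (0 < mult G (if a.2 then (k', k) else (k, k')))%N
        & a.1 = if a.2 then (blk k', blk k) else (blk k, blk k')] >]].

(* Multiplication by Lambda_i. *)
Definition lpLambda (i : 'I_n) (p : lpoly U N) : lpoly U N :=
  \sum_(a < m i) lpvar (vtx a) p.

(* The operators Lambda_j + partial_j and lambda_k + X(k) on functions of the
   arguments u_1, ..., u_n of f. *)
Definition op_x (j : 'I_n) (h : ('I_n -> U) -> lquot d N) :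
    ('I_n -> U) -> lquot d N :=
  fun u => qmap (lpLambda j) (h u) + h [eta u with j |-> d (u j)].

Definition op_shift (G : graph N) (k : 'I_N) (h : ('I_n -> U) -> lquot d N) :
    ('I_n -> U) -> lquot d N :=
  fun u => qmap (lpvar k) (h u) + \sum_(j in ext_set G k) op_x j h u.

(* The composition without its sign. The sum runs over the choices of a monomial
   in each of the polynomials g_i: the operators lambda_k + X(k) are raised to
   the exponents, and the coefficients are the arguments of f. *)
Definition comp_nosign (f : cochain d n) (g : forall i, cochain d (m i)) :
    cochain d N := fun G v =>
  let gp i : lpoly U (m i) :=
    qrepr (g i (inner_graph G i) (fun a => v (vtx a))) in
  let h u := qmap (lpsubst lpLambda) (f (outer_graph G) u) in
  if `[< acyclic (outer_graph G) >] then
    \sum_(e : {dffun forall i, lpsupp (gp i)})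
      (\big[comp/id]_(k < N) iter (val (e (blk k)) (blkpos k)) (op_shift G k)) h
        (fun i => lpcoef (val (e i)) (gp i))
  else 0.

Definition comp_sign (q : 'I_n -> bool) (b : 'I_N -> bool) : nat :=
  \sum_(j < n) \sum_(i < n | (i < j)%N) \sum_(k < N | blk k == i) (q j && b k).

(* q and b run over the possible parities of the g_i and of the v_k. *)
Definition Pcl_comp (f : cochain d n) (g : forall i, cochain d (m i)) :
    cochain d N := fun G v =>
  \sum_(q : {ffun 'I_n -> bool}) \sum_(b : {ffun 'I_N -> bool})
    (-1) ^+ comp_sign q b *:
      comp_nosign f (fun i => parity_comp (q i) (g i)) G
                  (fun k => scomp U (b k) (v k)).

End Composition.

Definition Pcl_unit : cochain d 1 := fun _ v => qpi d (lpC 1 (v ord0)).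

(* f o_1 g = f(g (x) 1 (x) ... (x) 1) for f of arity n + 1 and g of arity m. *)
Definition circ1_arity m n (i : 'I_n.+1) : nat := if i == ord0 then m else 1.

Fact circ1_arityE m n : (m + n = \sum_(i < n.+1) circ1_arity m i)%N.
Proof.
rewrite big_ord_recl /circ1_arity eqxx (eq_bigr (fun=> 1%N)) //.
by rewrite sum1_card card_ord.
Qed.

Definition circ1_family m n (g : cochain d m) (i : 'I_n.+1) :
    cochain d (circ1_arity m i) :=
  if i == ord0 as b return cochain d (if b then m else 1) then g else Pcl_unit.

Definition circ1 m n (f : cochain d n.+1) (g : cochain d m) : cochain d (m + n) :=
  Pcl_comp (circ1_arityE m n) f (circ1_family g).

(* f of arity n belongs to W_{n-1}. *)
Definition in_Wcl n (f : cochain d n) : Prop :=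
  in_Pcl f /\ forall (s : 'S_n) G v, Pcl_act f s G v = f G v.

(* Permutations increasing on the first m and on the last n indices. *)
Definition shuffle m n (s : 'S_(m + n)) : bool :=
  [forall i : 'I_(m + n), forall j : 'I_(m + n),
     ((i < j) && ((j < m) || (m <= i))) ==> (s i < s j)]%N.

(* f Box g for f of arity n + 1 (in W_n) and g of arity m (in W_{m-1}). *)
Definition box m n (f : cochain d n.+1) (g : cochain d m) : cochain d (m + n) :=
  fun G v => \sum_(s : 'S_(m + n) | shuffle s) Pcl_act (circ1 f g) (s^-1)%g G v.

(* Odd elements X of W_1 such that X Box X = 0. *)
Record odd_MC := OddMC {
  MC_val : cochain d 2;
  MC_W : in_Wcl MC_val;
  MC_odd : has_parity true MC_val;
  MC_eq : forall G v, box MC_val MC_val G v = 0 }.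

(* The isomorphism U[lambda_1,lambda_2]/<partial + lambda_1 + lambda_2> -> U[lambda]
   given by lambda_1 = lambda, lambda_2 = - lambda - partial. *)
Definition q2_eval (x : lquot d 2) : lpoly U 1 :=
  lpsubst (fun i p => if i == ord0 then lpvar ord0 p
                      else - lpvar ord0 p - lpmap d p) (qrepr x).

Definition pair_fun (a b : U) : 'I_2 -> U := fun i => if i == ord0 then a else b.

End Operad.

Section PVA.
Variables (F : fieldType) (V : superspace F) (d : {linear V -> V}).

(* For [br c] a lambda-bracket with one argument left free and x, y operators of
   multiplication by linear forms: the sum of x^m (br c_m)_{lambda = y} over the
   terms c_m lambda^m of p. *)
Definition lbr_nest (x y : lpoly V 2 -> lpoly V 2) (br : V -> lpoly V 1)
    (p : lpoly V 1) : lpoly V 2 :=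
  lpext (fun m c => iter (m ord0) x (lpsubst (fun=> y) (br c))) p.

Let lam1 : lpoly V 1 -> lpoly V 1 := @lpvar F V 1 ord0.
Let lam : lpoly V 2 -> lpoly V 2 := @lpvar F V 2 ord0.
Let mu : lpoly V 2 -> lpoly V 2 := @lpvar F V 2 ord_max.

Record is_PVA (mul : V -> V -> V) (br : V -> V -> lpoly V 1) : Prop := IsPVA {
  mul_linl : forall b, linear (mul^~ b);
  mul_linr : forall a, linear (mul a);
  mul_parity : forall p q a b, homog p a -> homog q b -> homog (p (+) q) (mul a b);
  mul_comm : forall p q a b, homog p a -> homog q b ->
    mul a b = (-1) ^+ (p && q) *: mul b a;
  mul_assoc : associative mul;
  mul_der : forall a b, d (mul a b) = mul (d a) b + mul a (d b);
  br_linl : forall b, linear (br^~ b);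
  br_linr : forall a, linear (br a);
  br_parity : forall p q a b, homog p a -> homog q b ->
    forall m, homog (p (+) q) (lpcoef m (br a b));
  br_sesquil : forall a b, br (d a) b = - lam1 (br a b);
  br_sesquir : forall a b, br a (d b) = lam1 (br a b) + lpmap d (br a b);
  br_skew : forall p q a b, homog p a -> homog q b ->
    br a b = - ((-1) ^+ (p && q) *:
      lpsubst (fun _ f => - lam1 f - lpmap d f) (br b a));
  br_jacobi : forall p q a b c, homog p a -> homog q b ->
    lbr_nest mu lam (br a) (br b c)
      - (-1) ^+ (p && q) *: lbr_nest lam mu (br b) (br a c)
    = lbr_nest lam (fun f => lam f + mu f) (br^~ c) (br a b);
  br_leibniz : forall q r a b c, homog q b -> homog r c ->
    br a (mul b c) = lpmap (mul^~ c) (br a b)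
      + (-1) ^+ (q && r) *: lpmap (mul^~ b) (br a c) }.

Record PVA := MkPVA {
  pva_mul : V -> V -> V;
  pva_br : V -> V -> lpoly V 1;
  pva_ax : is_PVA pva_mul pva_br }.

End PVA.

(* Main.v *)
(* Evaluating lambda_i at T_i(partial), with T_i : {poly F} and
   T_1 + ... + T_n = - partial, embeds V[lambda_1,...,lambda_n]/<partial +
   lambda_1 + ... + lambda_n> into functions of the points T; by Dedekind's
   independence of characters, points with all coordinates but one scalar
   suffice. After evaluation the operators lambda_k + X(k) of the operadic
   composition act as polynomials in partial on single arguments, and X o_1 X
   becomes an honest composite of bilinear maps. An odd element X of W_1 amounts
   to a product (the graph with one edge) and a bracket (the graph without
   edges); X Box X is a sum over the three (2,1)-shuffles, which is the Jacobi
   identity on the empty 3-graph, the Leibniz rule on a graph with one edge,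
   associativity on a path, and zero on all other graphs. *)
Require Import Defs.
From HB Require Import structures.
From mathcomp Require Import all_boot all_order all_algebra all_fingroup.
From mathcomp Require Import finmap boolp zify.
From mathcomp.multinomials Require Import monalg.
From mathcomp Require Import ring.

Set Implicit Arguments.
Unset Strict Implicit.
Unset Printing Implicit Defensive.

Import GRing.Theory.

Local Open Scope fset_scope.
Local Open Scope ring_scope.

(** * Evaluation of polynomials and of their classes *)

(** The obstacle is that [qmap], and with it the operadic composition, works on an arbitrary
    representative of a class. Evaluation at coordinates of sum -'X removes this dependence for the
    outer operation, but a composition needs such a point for the inner operation too. Take a block
    of two vertices and a third vertex. If the outer graph is acyclic, at most one edge joins them,
    so some vertex of the block is free, that is, not joined to the third. When the coordinate of a
    free vertex is a scalar x, the two shifted variables act on the argument formed by the block as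
    x and - 'X - x, which is again a point of sum -'X. The nonscalar coordinate therefore has to
    avoid the free vertex chosen in each of the three blocks, and it is placed graph by graph. Signs
    are treated in two stages. The identities for X are first written in the reversed parity
    ([is_shifted_PVA]); the passage to V is then the twist of the first argument by the involution
    [psign], so the two directions of the correspondence use the same twist and bijectivity reduces
    to the untwisted case. *)

Section LinearFunctions.
Variables (F : fieldType) (V W : lmodType F) (h : V -> W) (hl : linear h).

Lemma lin0 : h 0 = 0.
Proof. by move: (hl (-1) 0 0); rewrite scaler0 addr0 scaleN1r addNr. Qed.
Lemma linD v w : h (v + w) = h v + h w.
Proof. by rewrite -[v in LHS]scale1r hl scale1r. Qed.
Lemma linZ c v : h (c *: v) = c *: h v.
Proof. by rewrite -[c *: v in LHS]addr0 hl lin0 addr0. Qed.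
Lemma linN v : h (- v) = - h v.
Proof. by rewrite -scaleN1r linZ scaleN1r. Qed.
Lemma linB v w : h (v - w) = h v - h w.
Proof. by rewrite linD linN. Qed.
End LinearFunctions.

Section PolynomialAction.
Variables (F : fieldType) (U : lmodType F) (d : {linear U -> U}).
Implicit Types (P Q : {poly F}) (u v : U).

(** The module structure of U over [{poly F}] with 'X acting as [d]. Evaluated operators commute
    because [{poly F}] is commutative. *)
Definition pact P u : U := \sum_(k < size P) P`_k *: iter k d u.

Lemma pact_widen N P u : (size P <= N)%N ->
  pact P u = \sum_(k < N) P`_k *: iter k d u.
Proof.
move=> le; rewrite /pact (big_ord_widen N (fun k => P`_k *: iter k d u)) //.
rewrite big_mkcond; apply: eq_bigr => k _; case: ltnP => // hk.
by rewrite nth_default ?scale0r.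
Qed.

Fact iter_linear k : linear (iter k d).
Proof. by elim: k => [|k IH] c u v //=; rewrite IH linearP. Qed.

Fact pact_linear P : linear (pact P).
Proof.
move=> c u v; rewrite /pact scaler_sumr -big_split; apply: eq_bigr => k _ /=.
by rewrite iter_linear scalerDr !scalerA mulrC.
Qed.
HB.instance Definition _ P :=
  GRing.isLinear.Build F U U _ (pact P) (pact_linear P).

Lemma pactD P Q u : pact (P + Q) u = pact P u + pact Q u.
Proof.
set N := maxn (size P) (size Q).
rewrite (@pact_widen N) ?(leq_trans (size_polyD _ _)) //.
rewrite (@pact_widen N P) ?leq_maxl // (@pact_widen N Q) ?leq_maxr //.
by rewrite -big_split; apply: eq_bigr => k _; rewrite coefD scalerDl.
Qed.

Lemma pactZ c P u : pact (c *: P) u = c *: pact P u.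
Proof.
rewrite (@pact_widen (size P)) ?size_scale_leq // /pact scaler_sumr.
by apply: eq_bigr => k _; rewrite coefZ scalerA.
Qed.

Lemma pact0 u : pact 0 u = 0.
Proof. by rewrite /pact size_poly0 big_ord0. Qed.

Lemma pactN P u : pact (- P) u = - pact P u.
Proof. by rewrite -[- P]scaleN1r pactZ scaleN1r. Qed.

Lemma pactC c u : pact c%:P u = c *: u.
Proof.
by rewrite (@pact_widen 1) ?size_polyC_leq1 // big_ord1 coefC.
Qed.

Lemma pact1 u : pact 1 u = u.
Proof. by rewrite -[1]/(1%:P) pactC scale1r. Qed.

Lemma pact_sum (I : Type) (r : seq I) (R : pred I) (G : I -> {poly F}) u :
  pact (\sum_(i <- r | R i) G i) u = \sum_(i <- r | R i) pact (G i) u.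
Proof. by elim/big_rec2: _ => [|i x y _ <-]; rewrite ?pact0 ?pactD. Qed.

Lemma d_pact P u : d (pact P u) = pact P (d u).
Proof.
by rewrite /pact raddf_sum; apply: eq_bigr => k _; rewrite /= linearZ -iterS iterSr.
Qed.

Lemma pactMX P u : pact (P * 'X) u = pact P (d u).
Proof.
rewrite (@pact_widen (size P).+1); last first.
  by have [->|/size_mulX->] := eqVneq P 0; rewrite ?mul0r ?size_poly0.
rewrite big_ord_recl coefMX eqxx scale0r add0r; apply: eq_bigr => k _.
by rewrite coefMX /= -iterSr.
Qed.

Lemma pactX u : pact 'X u = d u.
Proof. by rewrite -['X]mul1r pactMX pact1. Qed.

Lemma pactM P Q u : pact (P * Q) u = pact P (pact Q u).
Proof.
elim/poly_ind: P u => [|P c IH] u; first by rewrite mul0r !pact0.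
by rewrite mulrDl !pactD -mulrA -commr_polyX mulrA !pactMX IH d_pact mul_polyC pactZ pactC.
Qed.

Lemma iter_pact P k u : iter k (pact P) u = pact (P ^+ k) u.
Proof. by elim: k => [|k IH]; rewrite ?pact1 // exprS pactM -IH. Qed.

Lemma pact_commute (h : U -> U) P u : linear h -> (forall v, h (d v) = d (h v)) ->
  h (pact P u) = pact P (h u).
Proof.
move=> hl hd; rewrite /pact (big_morph h (linD hl) (lin0 hl)).
apply: eq_bigr => k _; rewrite (linZ hl); congr (_ *: _).
by elim: (nat_of_ord k) => //= j <-.
Qed.

End PolynomialAction.

Section Evaluation.
Variables (F : fieldType) (U : lmodType F) (d : {linear U -> U}).
Local Notation pact := (pact d).

Definition tmon n (T : 'I_n -> {poly F}) (m : 'X_{1..n}) : {poly F} :=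
  \prod_(i < n) T i ^+ m i.

(* The value of p at lambda_i = T_i(partial). *)
Definition ev n (T : 'I_n -> {poly F}) (p : lpoly U n) : U :=
  lpext (fun m u => pact (tmon T m) u) p.

Fact ev_additive n (T : 'I_n -> {poly F}) : zmod_morphism (ev T).
Proof. exact: (lpext_additive (fun m => pact (tmon T m))). Qed.
HB.instance Definition _ n (T : 'I_n -> {poly F}) :=
  GRing.isZmodMorphism.Build (lpoly U n) U (ev T) (ev_additive T).

Lemma lpoly_sum n (p : lpoly U n) :
  p = \sum_(m <- lpsupp p) lpmono m (lpcoef m p).
Proof.
apply/lpolyP => m; rewrite raddf_sum /=.
have [hm|hm] := boolP (m \in lpsupp p).
  rewrite (big_fsetD1 m) //= lpcoef_mono eqxx big1_fset ?addr0 // => m' + _.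
  by rewrite in_fsetD1 lpcoef_mono => /andP[/negbTE-> _].
rewrite (lpcoef_outdom hm) big1_fset // => m' hm' _.
by rewrite lpcoef_mono; case: eqP hm => // <-; rewrite hm'.
Qed.

Lemma lpoly_ind n (R : lpoly U n -> Prop) : R 0 ->
  (forall p q, R p -> R q -> R (p + q)) -> (forall m u, R (lpmono m u)) ->
  forall p, R p.
Proof.
by move=> R0 RD Rm p; rewrite [p]lpoly_sum; apply: big_ind => // m _; exact: Rm.
Qed.

Lemma lpextU (W : zmodType) n (h : 'X_{1..n} -> {additive U -> W}) m u :
  lpext h (lpmono m u : lpoly U n) = h m u.
Proof.
have sub : lpsupp (lpmono m u : lpoly U n) `<=` [fset m].
  apply/fsubsetP => m1; rewrite -lpcoef_neq0 lpcoef_mono in_fset1.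
  by case: (m =P m1) => [<-|_]; rewrite ?eqxx // mulr0n eqxx.
by rewrite (lpextEw _ sub) big_seq_fset1 lpcoef_mono eqxx.
Qed.

Lemma evU n (T : 'I_n -> {poly F}) m u : ev T (lpmono m u) = pact (tmon T m) u.
Proof. exact: (lpextU (fun m => pact (tmon T m))). Qed.

Lemma evC n (T : 'I_n -> {poly F}) u : ev T (lpC n u) = u.
Proof.
rewrite evU /tmon big1 ?pact1 // => i _; rewrite cm1 expr0 //.
Qed.

Lemma evZ n (T : 'I_n -> {poly F}) c p : ev T (c *: p) = c *: ev T p.
Proof.
have lpmonoZ m u : c *: lpmono m u = lpmono m (c *: u) :> lpoly U n.
  by apply/lpolyP => m'; rewrite lpcoefZ !lpcoef_mono scalerMnr.
elim/lpoly_ind: p => [|p q IHp IHq|m u]; first by rewrite scaler0 raddf0 scaler0.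
  by rewrite scalerDr !raddfD /= IHp IHq.
by rewrite lpmonoZ !evU linearZ.
Qed.

Fact lpvar_zmod n (i : 'I_n) : zmod_morphism (@lpvar F U n i).
Proof. exact: lpvar_additive. Qed.
HB.instance Definition _ n (i : 'I_n) :=
  GRing.isZmodMorphism.Build (lpoly U n) (lpoly U n) (@lpvar F U n i) (lpvar_zmod i).

Lemma lpvarU n (i : 'I_n) m u :
  lpvar i (lpmono m u) = lpmono (mmul (ucm i) m) u :> lpoly U n.
Proof. exact: (lpextU (fun m => @lpmono F U n (mmul (ucm i) m))). Qed.

Lemma tmonM n (T : 'I_n -> {poly F}) i m :
  tmon T (mmul (ucm i) m) = T i * tmon T m.
Proof.
rewrite /tmon (bigD1 i) //= [X in _ = T i * X](bigD1 i) //= mulrA.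
rewrite cmM cmUU add1n exprS; congr (_ * _); apply: eq_bigr => j ji.
by rewrite cmM cmU eq_sym (negPf ji).
Qed.

Lemma ev_var n (T : 'I_n -> {poly F}) i p : ev T (lpvar i p) = pact (T i) (ev T p).
Proof.
elim/lpoly_ind: p => [|p q IHp IHq|m u]; first by rewrite !raddf0.
  by rewrite !raddfD /= IHp IHq.
by rewrite lpvarU !evU tmonM pactM.
Qed.

(** Commutation is asked only with the monomials in T. At scalar points this also covers maps that
    do not commute with [d], such as multiplication by a fixed element in the Leibniz rule. *)
Lemma ev_map n (T : 'I_n -> {poly F}) (h : U -> U) p : linear h ->
  (forall m u, h (pact (tmon T m) u) = pact (tmon T m) (h u)) ->
  ev T (lpmap h p) = h (ev T p).
Proof.
move=> hl hT; rewrite [in RHS]/ev /lpext (big_morph h (linD hl) (lin0 hl)).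
rewrite /lpmap /lpext (raddf_sum (ev T)).
by apply: eq_bigr => m _; rewrite /= evU hT.
Qed.

Lemma ev_map_comm n (T : 'I_n -> {poly F}) (h : U -> U) p : linear h ->
  (forall u, h (d u) = d (h u)) -> ev T (lpmap h p) = h (ev T p).
Proof. by move=> hl hd; apply: ev_map => // m u; apply: pact_commute. Qed.

Lemma ev_d n (T : 'I_n -> {poly F}) p : ev T (lpmap d p) = d (ev T p).
Proof. by apply: ev_map_comm => //; exact: linearP. Qed.

(** The source of the condition on points: evaluation kills the image of [ltot] as soon as the
    coordinates add up to -'X. *)
Lemma ev_ltot n (T : 'I_n -> {poly F}) p :
  ev T (ltot d p) = pact ('X + \sum_i T i) (ev T p).
Proof.
rewrite /ltot raddfD /= ev_d pactD pactX pact_sum; congr (_ + _).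
rewrite (raddf_sum (ev T)) /=.
by apply: eq_bigr => i _; rewrite ev_var.
Qed.

(** Substitution becomes a change of point: the operators S i only have to act as polynomials in [d]
    after evaluation, since the coefficients enter as constants and keep their value. *)
Lemma ev_subst n k (T : 'I_k -> {poly F}) (T' : 'I_n -> {poly F})
    (S : 'I_n -> lpoly U k -> lpoly U k) p :
  (forall i q, ev T (S i q) = pact (T' i) (ev T q)) ->
  ev T (lpsubst S p) = ev T' p.
Proof.
move=> hS; rewrite [RHS]/ev /lpsubst /lpext raddf_sum /=.
apply: eq_bigr => m _; rewrite -[u in pact _ u](evC T); move: (lpC k _) => q.
rewrite /monop /tmon.
move: q; apply: (big_rec2 (fun f P => forall q, ev T (f q) = pact P (ev T q)))
  => [q|i f P _ IH q].
  by rewrite pact1.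
rewrite pactM /= -IH; move: (f q) => {}q.
by rewrite -iter_pact; elim: (m i) => //= j IHj; rewrite hS IHj.
Qed.

Lemma eq_ev n (T T' : 'I_n -> {poly F}) p : T =1 T' -> ev T p = ev T' p.
Proof. by move=> /funext->. Qed.

Definition evq n (T : 'I_n -> {poly F}) (x : lquot d n) : U := ev T (qrepr x).

Section Points.
Variables (n : nat) (T : 'I_n -> {poly F}) (hT : \sum_i T i = - 'X).

(** Two representatives differ by some [ltot d q], whose value vanishes because of [hT]. This frees
    all later computations from the choice made by [qrepr]. *)
Lemma evq_pi p : evq T (qpi d p) = ev T p.
Proof.
have /qpi_eq/asboolP[q Hq] : qpi d (qrepr (qpi d p)) = qpi d p by rewrite qreprK.
rewrite /evq; apply/eqP; rewrite -subr_eq0 -raddfB Hq /=.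
by rewrite ev_ltot hT subrr pact0.
Qed.

Fact evq_additive : zmod_morphism (evq T).
Proof.
move=> x y.
rewrite -{1}[x]qreprK -{1}[y]qreprK.
have -> : qpi d (qrepr x) - qpi d (qrepr y) = qpi d (qrepr x - qrepr y).
  by apply/eqP; rewrite subr_eq -qpiD subrK.
by rewrite evq_pi raddfB.
Qed.

Lemma evq0 : evq T 0 = 0.
Proof. by rewrite -(subrr (0 : lquot d n)) evq_additive subrr. Qed.

Lemma evqN x : evq T (- x) = - evq T x.
Proof. by rewrite -sub0r evq_additive evq0 sub0r. Qed.

Lemma evqD x y : evq T (x + y) = evq T x + evq T y.
Proof. by rewrite -[y]opprK evq_additive evqN !opprK. Qed.

Lemma evqZ c x : evq T (c *: x) = c *: evq T x.
Proof. by rewrite -[x]qreprK -[c *: _]qpiZ !evq_pi evZ. Qed.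

Lemma evq_sum (I : Type) (r : seq I) (R : pred I) (G : I -> lquot d n) :
  evq T (\sum_(i <- r | R i) G i) = \sum_(i <- r | R i) evq T (G i).
Proof. exact: (big_morph _ evqD evq0). Qed.

Lemma evq_map k (f : lpoly U k -> lpoly U n) x :
  evq T (qmap f x) = ev T (f (qrepr x)).
Proof. exact: evq_pi. Qed.

End Points.

End Evaluation.

(** * Faithfulness of evaluation *)
Section Faithfulness.
Variables (F : fieldType) (charF : [pchar F] =i pred0).
Variables (U : lmodType F) (d : {linear U -> U}).

Definition scal n (x : 'I_n -> F) : 'I_n -> {poly F} := fun i => (x i)%:P.

Definition monev n (x : 'I_n -> F) (m : 'X_{1..n}) : F := \prod_i x i ^+ m i.

Lemma tmon_scal n (x : 'I_n -> F) m : tmon (scal x) m = (monev x m)%:P.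
Proof.
by rewrite /tmon /monev rmorph_prod; apply: eq_bigr => i _; rewrite rmorphXn.
Qed.

Lemma monevM n (x y : 'I_n -> F) m :
  monev (fun i => x i * y i) m = monev x m * monev y m.
Proof. by rewrite -big_split; apply: eq_bigr => i _; rewrite exprMn. Qed.

(** In characteristic 0 the number 2 is not a root of unity. Its powers separate exponents, which
    gives the distinct characters needed below. *)
Lemma natr_exp2_inj (a b : nat) : 2%:R ^+ a = 2%:R ^+ b :> F -> a = b.
Proof.
have /pcharf0P h0 := charF.
wlog le_ab : a b / (a <= b)%N => [hw e|].
  by case/orP: (leq_total a b) => le; [exact: hw|apply/esym/hw].
move=> /esym/eqP; rewrite -subr_eq0 -!natrX -natrB ?leq_exp2l // h0 subn_eq0.
by rewrite leq_exp2l // => le_ba; apply/eqP; rewrite eqn_leq le_ab.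
Qed.

Lemma monev_sep n (m m' : 'X_{1..n}) : m != m' ->
  exists y : 'I_n -> F, monev y m != monev y m'.
Proof.
move=> /eqP ne; have [i hi] : exists i, m i <> m' i.
  apply/not_existsP => h; apply: ne; apply/eqP/cmP => i.
  exact: contrapT (h i).
exists (fun j => if j == i then 2%:R else 1).
have E l : monev (fun j => if j == i then 2%:R else 1) l = 2%:R ^+ l i.
  rewrite /monev (bigD1 i) //= eqxx big1 ?mulr1 // => j /negPf->.
  by rewrite expr1n.
by rewrite !E; apply/eqP => /natr_exp2_inj.
Qed.

(* Dedekind: distinct multiplicative characters are independent. *)
Lemma monev_indep n (E : seq 'X_{1..n}) (u : 'X_{1..n} -> U) : uniq E ->
  (forall x : 'I_n -> F, \sum_(m <- E) monev x m *: u m = 0) ->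
  forall m, m \in E -> u m = 0.
Proof.
elim: E u => [//|m0 E IH] u /= /andP[m0E uE] h.
have hE m1 : m1 \in E -> u m1 = 0.
  move=> m1E; have /monev_sep[y hy] : m1 != m0 by apply: contraNneq m0E => <-.
  (* The relation at the product of x and y, minus [monev y m0] times the relation at x, is a
     relation without the term [m0]. *)
  have := IH (fun m => (monev y m - monev y m0) *: u m) uE.
  move=> /(_ _ m1 m1E) H.
  suff /eqP : (monev y m1 - monev y m0) *: u m1 = 0.
    by rewrite scaler_eq0 subr_eq0 (negPf hy) => /eqP.
  apply: H => x.
  have := h (fun i => x i * y i); rewrite big_cons monevM => h1.
  have /(congr1 ( *:%R (monev y m0))) := h x.
  rewrite big_cons scalerDr scaler0 scalerA scaler_sumr [_ * monev x _]mulrC => h2.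
  have := h1; rewrite -[0 in RHS]h2 => /addrI /eqP; rewrite -subr_eq0 => /eqP h3.
  rewrite -[RHS]h3 -sumrB; apply: eq_bigr => m _.
  by rewrite monevM !scalerA -scalerBl; congr (_ *: _); ring.
move=> m; rewrite inE => /orP[/eqP->|/hE//].
have := h (fun=> 1); rewrite big_cons big1_seq ?addr0 => [|l /andP[_ /hE->]]; last first.
  by rewrite scaler0.
by rewrite /monev big1 ?scale1r // => i _; rewrite expr1n.
Qed.

Lemma ev_scalE n (x : 'I_n -> F) (p : lpoly U n) :
  ev d (scal x) p = \sum_(m <- lpsupp p) monev x m *: lpcoef m p.
Proof. by apply: eq_bigr => m _; rewrite tmon_scal pactC. Qed.

Lemma ev_scal_eq0 n (p : lpoly U n) :
  (forall x : 'I_n -> F, ev d (scal x) p = 0) -> p = 0.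
Proof.
move=> h; apply/lpolyP => m; rewrite raddf0.
have [hm|/lpcoef_outdom//] := boolP (m \in lpsupp p).
apply: (@monev_indep _ (lpsupp p) (fun m => lpcoef m p)); rewrite ?fset_uniq // => x.
by rewrite -ev_scalE.
Qed.

Lemma ev_scal_inj n (p q : lpoly U n) :
  (forall x : 'I_n -> F, ev d (scal x) p = ev d (scal x) q) -> p = q.
Proof.
move=> h; apply/eqP; rewrite -subr_eq0; apply/eqP/ev_scal_eq0 => x.
by rewrite raddfB /= h subrr.
Qed.

(* The point lambda_i = x_i for i <> i0 of the hyperplane
   lambda_1 + ... + lambda_n = - partial. *)
Definition qpoint n (i0 : 'I_n) (x : 'I_n -> F) : 'I_n -> {poly F} :=
  fun i => if i == i0 then - 'X - \sum_(j | j != i0) (x j)%:P else (x i)%:P.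

Lemma sum_qpoint n (i0 : 'I_n) (x : 'I_n -> F) : \sum_i qpoint i0 x i = - 'X.
Proof.
rewrite (bigD1 i0) //= {1}/qpoint eqxx; set s := (X in _ - X + _).
suff -> : \sum_(i < n | i != i0) qpoint i0 x i = s by rewrite subrK.
by apply: eq_bigr => i /negPf; rewrite /qpoint => ->.
Qed.

Definition free_of n (i0 : 'I_n) (p : lpoly U n) : Prop :=
  forall m : 'X_{1..n}, m i0 != 0%N -> lpcoef m p = 0.

Lemma free_ofD n (i0 : 'I_n) (p q : lpoly U n) :
  free_of i0 p -> free_of i0 q -> free_of i0 (p + q).
Proof. by move=> hp hq m hm; rewrite raddfD /= hp // hq // addr0. Qed.

Lemma qpi0 n : qpi d 0 = 0 :> lquot d n.
Proof. by apply/eqP; rewrite -(inj_eq (addrI (qpi d 0))) -qpiD !addr0. Qed.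

Lemma qpiN n (p : lpoly U n) : qpi d (- p) = - qpi d p.
Proof. by apply/eqP; rewrite -addr_eq0 -qpiD addNr qpi0. Qed.

Lemma qpi_sum n (I : Type) (r : seq I) (R : pred I) (G : I -> lpoly U n) :
  qpi d (\sum_(i <- r | R i) G i) = \sum_(i <- r | R i) qpi d (G i).
Proof. exact: (big_morph _ (@qpiD _ _ d n) (qpi0 n)). Qed.

Lemma qpi_ltot n (p : lpoly U n) : qpi d (ltot d p) = 0.
Proof. by rewrite -qpi0; apply/qpi_eq/asboolP; exists p; rewrite subr0. Qed.

Lemma lpmapU n (m : 'X_{1..n}) u : lpmap d (lpmono m u) = lpmono m (d u) :> lpoly U n.
Proof. by apply/lpolyP => l; rewrite lpmapE !lpcoef_mono raddfMn. Qed.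

Lemma ucm_mulK n (i : 'I_n) (m : 'X_{1..n}) : m i != 0%N ->
  m = mmul (ucm i) (divcm m (ucm i)).
Proof.
move=> mi; apply/eqP/cmP => j; rewrite cmM divcmE cmU.
by case: eqVneq => [<-|_] /=; rewrite ?add0n ?subn0 // subnKC ?lt0n.
Qed.

(* A monomial is reduced by lambda_{i0} = - partial - sum_{i <> i0} lambda_i. *)
Lemma qpi_free n (i0 : 'I_n) (p : lpoly U n) :
  exists2 p', qpi d p = qpi d p' & free_of i0 p'.
Proof.
elim/lpoly_ind: p => [|p q [p' ep hp] [q' eq hq]|m u].
- by exists 0 => // m _; rewrite raddf0.
- by exists (p' + q'); [rewrite !qpiD ep eq|exact: free_ofD].
(* Induction on the exponent of lambda_{i0}. Both [m] and [u] must vary: one reduction step yields a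
   term with [d u] and terms with another variable in place of lambda_{i0}. *)
have [k] := ubnP (m i0); elim: k m u => // k IH m u.
have [m0 _|m0] := eqVneq (m i0) 0%N.
  by exists (lpmono m u) => // l; rewrite lpcoef_mono; case: (m =P l) => [<-|_]; rewrite ?m0.
set m' := divcm m (ucm i0); have mE : m = mmul (ucm i0) m' := ucm_mulK m0.
rewrite ltnS => lemk; have m'k : (m' i0 < k)%N.
  by rewrite (leq_trans _ lemk) // mE cmM cmUU add1n.
have [p0 e0 f0] := IH m' (d u) m'k.
have hi (i : 'I_n) : exists p1, i != i0 ->
    qpi d (lpmono (mmul (ucm i) m') u) = qpi d p1 /\ free_of i0 p1.
  have [ii0|ii0] := eqVneq i i0; first by exists 0.
  have [|p1 e1 f1] := IH (mmul (ucm i) m') u; last by exists p1.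
  by rewrite cmM cmU (negPf ii0).
have [P hP] := choice hi.
exists (- p0 - \sum_(i < n | i != i0) P i); last first.
  move=> l hl; rewrite raddfB raddfN raddf_sum /= f0 // oppr0 big1 ?subr0 //.
  by move=> i /hP[_ ->].
have := qpi_ltot (lpmono m' u).
rewrite /ltot lpmapU (bigD1 i0) //= lpvarU -mE !(@qpiD F U d n) => /eqP.
rewrite addrCA addr_eq0 => /eqP h.
rewrite h opprD e0 !qpiN !qpi_sum; congr (_ - _).
by apply: eq_bigr => i /hP[<- _]; rewrite lpvarU.
Qed.

Lemma ev_free n (i0 : 'I_n) (T T' : 'I_n -> {poly F}) (p : lpoly U n) :
  free_of i0 p -> (forall i, i != i0 -> T i = T' i) -> ev d T p = ev d T' p.
Proof.
move=> hp hT; apply: eq_big_seq => m hm; congr (pact d _ _).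
apply: eq_bigr => i _; have [->|/hT-> //] := eqVneq i i0.
suff -> : m i0 = 0%N by [].
by apply/eqP; apply: contraTT hm => /hp h; rewrite -lpcoef_neq0 h eqxx.
Qed.

(** A representative free of lambda_{i0} does not see the only nonscalar coordinate of [qpoint], so
    its values are those at all scalar points, where independence of characters applies. *)
Lemma evq_eq0 n (i0 : 'I_n) (q : lquot d n) :
  (forall x, evq (qpoint i0 x) q = 0) -> q = 0.
Proof.
have [p e f] := qpi_free i0 (qrepr q); rewrite qreprK in e; rewrite e => h.
suff -> : p = 0 by rewrite qpi0.
apply: ev_scal_eq0 => x; rewrite -(h x) evq_pi ?sum_qpoint //.
by apply: ev_free f _ => i; rewrite /qpoint => /negPf->.
Qed.

Lemma evq_inj n (i0 : 'I_n) (q r : lquot d n) :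
  (forall x, evq (qpoint i0 x) q = evq (qpoint i0 x) r) -> q = r.
Proof.
move=> h; apply/eqP; rewrite -subr_eq0; apply/eqP/(@evq_eq0 _ i0) => x.
by rewrite evq_additive ?sum_qpoint // h subrr.
Qed.

End Faithfulness.

(** * Constant classes and graphs on two vertices *)
Lemma ord2P (i : 'I_2) : i = ord0 \/ i = ord_max.
Proof. by case: i => -[|[|//]] h; [left|right]; apply: val_inj. Qed.

Section Derivative.
Variables (F : fieldType) (charF : [pchar F] =i pred0).
Variables (U : lmodType F) (d : {linear U -> U}).

Lemma mulrn_eq0_char0 (u : U) k : u *+ k.+1 = 0 -> u = 0.
Proof.
have /pcharf0P h0 := charF.
by rewrite -scaler_nat => /eqP; rewrite scaler_eq0 h0 => /eqP.
Qed.

Lemma lpcoef_diff n (i : 'I_n) (p : lpoly U n) l :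
  lpcoef l (lpdiff i p) = lpcoef (mmul (ucm i) l) p *+ (l i).+1.
Proof.
have E m : (lpcoef m p *+ m i) *+ (divcm m (ucm i) == l)
    = (lpcoef m p *+ (l i).+1) *+ (m == mmul (ucm i) l).
  have [mi0|mi0] := eqVneq (m i) 0%N.
    rewrite mi0 mulr0n mul0rn; case: eqP => [mE|]; last by rewrite mulr0n.
    by move: mi0; rewrite mE cmM cmUU.
  have -> : (divcm m (ucm i) == l) = (m == mmul (ucm i) l).
    apply/eqP/eqP => [<-|->]; first exact: ucm_mulK.
    apply/eqP/cmP => j; rewrite divcmE cmM ucmE; lia.
  by case: eqP => [->|_]; rewrite ?mulr0n // cmM cmUU add1n.
rewrite /lpdiff /lpext raddf_sum /=.
under eq_bigr do rewrite lpcoef_mono E.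
have [hm|hm] := boolP (mmul (ucm i) l \in lpsupp p).
  rewrite (big_fsetD1 (mmul (ucm i) l)) //= eqxx big1_fset ?addr0 // => m' + _.
  by rewrite in_fsetD1 => /andP[/negbTE-> _]; rewrite mulr0n.
rewrite (lpcoef_outdom hm) mul0rn big1_fset // => m' hm' _.
by case: eqP hm => // <-; rewrite hm'.
Qed.

Fact lpdiff_additive n (i : 'I_n) : zmod_morphism (@lpdiff F U n i).
Proof.
by move=> p q; apply/lpolyP => l; rewrite raddfB /= !lpcoef_diff raddfB mulrnBl.
Qed.
HB.instance Definition _ n (i : 'I_n) :=
  GRing.isZmodMorphism.Build (lpoly U n) (lpoly U n) (@lpdiff F U n i)
    (lpdiff_additive i).

Lemma lpdiffU n (i : 'I_n) m u :
  lpdiff i (lpmono m u) = lpmono (divcm m (ucm i)) (u *+ m i) :> lpoly U n.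
Proof.
apply/lpolyP => l; rewrite lpcoef_diff !lpcoef_mono.
have [mi0|mi0] := eqVneq (m i) 0%N.
  rewrite mi0 mulr0n mul0rn; case: eqP => [mE|]; last by rewrite mulr0n mul0rn.
  by move: mi0; rewrite mE cmM cmUU.
have -> : (m == mmul (ucm i) l) = (divcm m (ucm i) == l).
  apply/eqP/eqP => [->|<-]; last exact: ucm_mulK.
  apply/eqP/cmP => j; rewrite divcmE cmM ucmE; lia.
case: eqP => [<-|_]; rewrite ?mulr0n ?mul0rn // divcmE ucmE eqxx.
by rewrite subn1 prednK // lt0n.
Qed.

Lemma lpdiff_var n (i j : 'I_n) (p : lpoly U n) :
  lpdiff i (lpvar j p) = lpvar j (lpdiff i p) + p *+ (i == j).
Proof.
elim/lpoly_ind: p => [|p q IHp IHq|m u]; first by rewrite !raddf0 mul0rn addr0.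
  by rewrite !raddfD /= IHp IHq mulrnDl addrACA.
rewrite lpvarU !lpdiffU lpvarU cmM cmU.
have [->|ij] := eqVneq j i.
  rewrite ?eqxx mulr1n add1n mulrS raddfD /= addrC.
  have -> : divcm (mmul (ucm i) m) (ucm i) = m.
    apply/eqP/cmP => l; rewrite divcmE cmM ucmE; lia.
  have [->|/ucm_mulK<- //] := eqVneq (m i) 0%N; by rewrite mulr0n !raddf0.
rewrite mulr0n addr0 add0n; congr (lpmono _ _).
apply/eqP/cmP => l; rewrite !(divcmE, cmM, ucmE).
by case: (j =P l) => [<-|]; rewrite ?[i == j]eq_sym ?(negPf ij) ?subn0.
Qed.

(** The commutator of [lpdiff i] and [ltot] is the identity for every [i], so a difference of two
    derivatives commutes with [ltot]. This is why it descends to the quotient. *)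
Lemma lpdiff_ltot n (i : 'I_n) (p : lpoly U n) :
  lpdiff i (ltot d p) = ltot d (lpdiff i p) + p.
Proof.
rewrite /ltot raddfD -addrA; congr (_ + _).
  apply/lpolyP => l; rewrite !(lpcoef_diff, lpmapE) raddfMn //.
rewrite (raddf_sum (lpdiff i)) /=.
under eq_bigr do rewrite lpdiff_var.
rewrite big_split /=; congr (_ + _).
rewrite (bigD1 i) //= eqxx big1 ?addr0 // => j /negPf.
by rewrite eq_sym => ->.
Qed.

Lemma qmap_diffE n (i j : 'I_n) (p : lpoly U n) :
  qmap (fun p => lpdiff i p - lpdiff j p) (qpi d p)
  = qpi d (lpdiff i p - lpdiff j p).
Proof.
rewrite /qmap; have : qpi d (qrepr (qpi d p)) = qpi d p by rewrite qreprK.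
move: (qrepr _) => p' /qpi_eq/asboolP[r Hr].
apply/qpi_eq/asboolP; exists (lpdiff i r - lpdiff j r).
have -> : lpdiff i p' - lpdiff j p' - (lpdiff i p - lpdiff j p)
    = lpdiff i (p' - p) - lpdiff j (p' - p).
  rewrite (raddfB (lpdiff i)) (raddfB (lpdiff j)) /=.
  rewrite !opprB [LHS]addrACA [RHS]addrACA.
  by congr (_ + _); rewrite addrC.
rewrite ltot_additive.
by rewrite Hr !lpdiff_ltot opprD addrACA subrr addr0.
Qed.

Lemma qmap_diff_eq0 n (i j : 'I_n) (p : lpoly U n) : lpdiff i p = lpdiff j p ->
  qmap (fun p => lpdiff i p - lpdiff j p) (qpi d p) = 0.
Proof. by rewrite qmap_diffE => ->; rewrite subrr qpi0. Qed.

Lemma qpi_free_eq0 n (i0 : 'I_n) (p : lpoly U n) : free_of i0 p ->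
  qpi d p = 0 -> p = 0.
Proof.
move=> hp e; apply: (@ev_scal_eq0 _ charF _ d _ p) => x.
rewrite -(@ev_free _ _ d _ i0 (qpoint i0 x)) //; last first.
  by move=> i /negPf ii; rewrite /qpoint ii.
by rewrite -evq_pi ?sum_qpoint // e evq0 // sum_qpoint.
Qed.

(** Eliminate the second variable first. Its derivative is then 0, so the derivative in the first
    variable is a reduced polynomial of class 0, hence 0, and in characteristic 0 only the constant
    term is left. *)
Lemma const_of_diff (q : lquot d 2) :
  qmap (fun p => lpdiff ord0 p - lpdiff ord_max p) q = 0 ->
  exists u, q = qpi d (lpC 2 u).
Proof.
have [p + fp] := qpi_free d ord_max (qrepr q); rewrite qreprK => ->.
rewrite qmap_diffE.
have -> : lpdiff ord_max p = 0.
  apply/lpolyP => l; rewrite lpcoef_diff raddf0 fp ?mul0rn //.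
  by rewrite cmM cmUU.
rewrite subr0 => /(@qpi_free_eq0 _ ord_max) h.
have {}h : lpdiff ord0 p = 0.
  apply: h => l hl; rewrite lpcoef_diff fp ?mul0rn // cmM; lia.
exists (lpcoef mone p); congr qpi; apply/lpolyP => m; rewrite lpcoef_mono.
have [<-|m1] := eqVneq; first by rewrite mulr1n.
rewrite mulr0n; have [m1_0|] := eqVneq (m ord_max) 0%N; last exact: fp.
have m0 : m ord0 != 0%N.
  apply/negP => /eqP m0; move/eqP: m1; apply; apply/eqP/cmP => i; rewrite cm1.
  by case: (ord2P i) => ->.
move/(congr1 (lpcoef (divcm m (ucm ord0)))): h.
by rewrite lpcoef_diff -ucm_mulK // raddf0 => /mulrn_eq0_char0.
Qed.

End Derivative.

Section TwoGraphs.
Local Notation o0 := (ord0 : 'I_2).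
Local Notation o1 := (ord_max : 'I_2).
Implicit Types G : graph 2.

Lemma graph_ext n (G H : graph n) : (forall e, mult G e = mult H e) -> G = H.
Proof.
case: G H => [f hf] [g hg] /= h; have e : f = g by apply/ffunP.
by case: _ / e hg => hg; rewrite (Prop_irrelevance hf hg).
Qed.

Lemma graph2_ext G H : mult G (o0, o1) = mult H (o0, o1) ->
  mult G (o1, o0) = mult H (o1, o0) -> G = H.
Proof.
move=> h01 h10; apply: graph_ext => -[i j].
by case: (ord2P i) => ->; case: (ord2P j) => ->; rewrite ?mult_diag.
Qed.

Lemma mult_mkgraph n c (i j : 'I_n) :
  mult (mkgraph c) (i, j) = if i == j then 0%N else c i j.
Proof. by rewrite ffunE. Qed.

Definition nedges G : nat := mult G (o0, o1) + mult G (o1, o0).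

Lemma trail_mult n (G : graph n) i s j a : trail G i s j -> a \in s ->
  (0 < mult G a.1)%N.
Proof.
move=> /andP[_ /forallP/(_ a.1) h] ha; apply: leq_trans h.
by rewrite -has_count has_pred1 map_f.
Qed.

Lemma trail_mult2 n (G : graph n) i s j a b : trail G i (a :: b :: s) j ->
  a.1 = b.1 -> (1 < mult G a.1)%N.
Proof.
move=> /andP[_ /forallP/(_ a.1) h] e; apply: leq_trans h.
by rewrite /= e eqxx.
Qed.

Lemma trail1 n (G : graph n) a : (0 < mult G a.1)%N ->
  trail G (step_src a) [:: a] (step_tgt a).
Proof.
move=> h; rewrite /trail /= !eqxx /=; apply/forallP => e.
by case: eqP => [<-|].
Qed.

Lemma trail2 n (G : graph n) a b : step_tgt a = step_src b ->
  (if a.1 == b.1 then 1 < mult G a.1 else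
    (0 < mult G a.1) && (0 < mult G b.1))%N ->
  trail G (step_src a) [:: a; b] (step_tgt b).
Proof.
move=> e h; rewrite /trail /= e !eqxx /=; apply/forallP => x.
rewrite addn0; case: (a.1 =P x) h => [<-|_].
  by rewrite eq_sym; case: eqP => // _ /andP[].
by case: (b.1 =P x) => //= <-; case: eqP => [->/ltnW//|_ /andP[]].
Qed.

Lemma mult2_cases G e : (0 < mult G e)%N ->
  e = (o0, o1) \/ e = (o1, o0).
Proof.
case: e => i j; case: (ord2P i) => ->; case: (ord2P j) => ->;
  rewrite ?mult_diag //; by [left|right].
Qed.

Lemma trail2_nedges G i s j a b : trail G i (a :: b :: s) j -> (1 < nedges G)%N.
Proof.
move=> h; have ha : (0 < mult G a.1)%N by apply: trail_mult h _; rewrite mem_head.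
have hb : (0 < mult G b.1)%N by apply: trail_mult h _; rewrite !inE eqxx orbT.
have hab := trail_mult2 h; rewrite /nedges.
case: (mult2_cases ha) => ea; case: (mult2_cases hb) => eb;
  move: hab ha hb; rewrite ea eb => hab ha hb.
- exact/ltn_addr/hab.
- exact: (leq_add ha hb).
- exact: (leq_add hb ha).
- exact/ltn_addl/hab.
Qed.

(** Without tadpoles, any two edges on two vertices, parallel or opposite, close a trail, while a
    single edge has distinct ends. Acyclicity is thus a bound on the number of edges. *)
Lemma acyclic2P G : acyclic G <-> (nedges G <= 1)%N.
Proof.
split=> [ac|le1 i [//|a [|b s]] h].
- rewrite leqNgt; apply/negP => gt1.
  have [h|h] := leqP 2 (mult G (o0, o1)).
    by have /ac := @trail2 2 G ((o0, o1), false) ((o0, o1), true) erefl h.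
  have [h'|h'] := leqP 2 (mult G (o1, o0)).
    by have /ac := @trail2 2 G ((o1, o0), false) ((o1, o0), true) erefl h'.
  have /ac : trail G o0 [:: ((o0, o1), false); ((o1, o0), false)] o0.
    apply: (@trail2 2 G ((o0, o1), false) ((o1, o0), false)) => //=.
    move: gt1 h h'; rewrite /nedges; move: (mult G (o0, o1)) (mult G (o1, o0)) => A B. lia.
  by [].
- have := trail_mult h (mem_head _ _).
  move: h => /andP[/= /andP[/eqP ei /eqP]].
  rewrite /step_src /step_tgt in ei *; case: a ei => [[x y] []] /= -> ->;
  by rewrite mult_diag.
- by have := trail2_nedges h; rewrite ltnNge le1.
Qed.

Lemma component_empty G i : nedges G = 0%N -> component G i = [set i].
Proof.
move=> h0; apply/setP => j; rewrite !inE.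
have e x : adjacent G x =1 pred0.
  move=> y /=; move/eqP: h0; rewrite addn_eq0 => /andP[/eqP h01 /eqP h10].
  by case: (ord2P x) => ->; case: (ord2P y) => ->; rewrite /adjacent /= ?mult_diag ?h01 ?h10.
rewrite eq_sym; apply/idP/eqP => [/connectP[[|x s] /=]|->]; last exact: connect0.
  by move=> _ ->.
by have /= -> := e i x.
Qed.

Lemma component_edge G i : (0 < nedges G)%N -> component G i = setT.
Proof.
rewrite /nedges addn_gt0 => h0; apply/setP => j; rewrite !inE.
have [->|ij] := eqVneq i j; first exact: connect0.
apply: connect1 => /=.
by case: (ord2P i) ij => ->; case: (ord2P j) => ->; rewrite ?eqxx /adjacent //= orbC.
Qed.

End TwoGraphs.

(** * Evaluation of operadic compositions *)
Section DependentPairs.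
Variable J : 'I_2 -> finType.

(** A version of [ord2P] in [Type], so that dependent families over 'I_2 can be built by transport
    along either equation. *)
Definition ord2_sum (i : 'I_2) : (i = ord0) + (i = ord_max) :=
  match i == ord0 as b return (i == ord0) = b -> (i = ord0) + (i = ord_max) with
  | true => fun e => inl (eqP e)
  | false => fun e => inr (match ord2P i with
      | or_introl h => False_ind _ (elimF eqP e h) | or_intror h => h end)
  end erefl.

Definition dfpair (x0 : J ord0) (x1 : J ord_max) (i : 'I_2) : J i :=
  match ord2_sum i with
  | inl e => ecast j (J j) (esym e) x0
  | inr e => ecast j (J j) (esym e) x1
  end.

Lemma dfpair0 x0 x1 : dfpair x0 x1 ord0 = x0.
Proof. by rewrite /dfpair; case: ord2_sum => // e; rewrite (eq_irrelevance e erefl). Qed.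

Lemma dfpair1 x0 x1 : dfpair x0 x1 ord_max = x1.
Proof. by rewrite /dfpair; case: ord2_sum => // e; rewrite (eq_irrelevance e erefl). Qed.

Lemma sum_dffun2 (W : zmodType) (H : J ord0 -> J ord_max -> W) :
  \sum_(e : {dffun forall i, J i}) H (e ord0) (e ord_max) = \sum_x \sum_y H x y.
Proof.
rewrite pair_big /= (reindex (fun e : {dffun forall i, J i} => (e ord0, e ord_max))) //.
apply: onW_bij; exists (fun p => [ffun i => dfpair p.1 p.2 i] : {dffun forall i, J i}).
  move=> e; apply/ffunP => i; rewrite ffunE.
  by case: (ord2P i) => ->; rewrite ?dfpair0 ?dfpair1.
by case=> x y /=; rewrite !ffunE dfpair0 dfpair1.
Qed.

End DependentPairs.

Section Blocks.
Variables (n : nat) (m : 'I_n -> nat) (N : nat) (eN : N = (\sum_(i < n) m i)%N).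

(** The type of [blkpos] depends on [blk], so the two can only be rewritten simultaneously; [Phi]
    abstracts over both. *)
Lemma blk_vtx_dep (R : Type) (Phi : forall i, 'I_(m i) -> R) i (a : 'I_(m i)) :
  Phi (blk eN (vtx eN a)) (blkpos eN (vtx eN a)) = Phi i a.
Proof.
rewrite /blk /blkpos /vtx /tagnat.sig1 /tagnat.sig2 cast_ordKV.
by rewrite /tagnat.Rank tagnat.rankK.
Qed.

Lemma blk_vtx i (a : 'I_(m i)) : blk eN (vtx eN a) = i.
Proof. exact: (blk_vtx_dep (fun i _ => i)). Qed.

Lemma vtx_blk k : vtx eN (blkpos eN k) = k.
Proof. by rewrite /vtx /blkpos tagnat.sig2K cast_ordK. Qed.

Lemma big_vtx (R : Type) (idx : R) (op : Monoid.com_law idx) (G : 'I_N -> R) :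
  \big[op/idx]_k G k = \big[op/idx]_i \big[op/idx]_(a < m i) G (vtx eN a).
Proof.
rewrite [RHS](sig_big_dep xpredT (fun i => xpredT) (fun i a => G (vtx eN a))) /=.
rewrite (reindex (fun p : {i : 'I_n & 'I_(m i)} => vtx eN (tagged p))) /=.
  by apply: eq_big => // p; rewrite andbT.
apply: onW_bij; exists (fun k => Tagged (fun i => 'I_(m i)) (blkpos eN k)).
  move=> [i a] /=; exact: (blk_vtx_dep (fun i a => Tagged (fun i => 'I_(m i)) a)).
by move=> k /=; rewrite vtx_blk.
Qed.

Lemma big_block (R : Type) (idx : R) (op : Monoid.com_law idx) (G : 'I_N -> R) i :
  \big[op/idx]_(k | blk eN k == i) G k = \big[op/idx]_(a < m i) G (vtx eN a).
Proof.
rewrite big_mkcond big_vtx (bigD1 i) //= [X in op _ X]big1 ?Monoid.mulm1.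
  by apply: eq_bigr => a _; rewrite blk_vtx eqxx.
by move=> j ji; rewrite big1 // => a _; rewrite blk_vtx (negPf ji).
Qed.

End Blocks.

(** * The operators lambda_k + X(k) after evaluation *)

Section CompositionEvaluation.
Variables (F : fieldType) (U : superspace F) (d : {linear U -> U}).
Variables (n : nat) (m : 'I_n -> nat) (N : nat) (eN : N = (\sum_(i < n) m i)%N).
Variables (T : 'I_N -> {poly F}) (hT : \sum_k T k = - 'X).
Variables (G : graph N) (Y : ('I_n -> U) -> U) (S : 'I_N -> {poly F}).

(** The value of Lambda_i at the point T. *)
Definition block_point (i : 'I_n) : {poly F} := \sum_(a < m i) T (vtx eN a).

Lemma sum_block_point : \sum_i block_point i = - 'X.
Proof. by rewrite -hT (big_vtx eN). Qed.

Lemma ev_lpLambda i (p : lpoly U N) :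
  ev d T (lpLambda eN i p) = pact d (block_point i) (ev d T p).
Proof.
rewrite /lpLambda /block_point pact_sum (raddf_sum (ev d T)) /=.
by apply: eq_bigr => a _; rewrite ev_var.
Qed.

Definition upd (u : 'I_n -> U) (j : 'I_n) (w : U) : 'I_n -> U :=
  [eta u with j |-> w].

(* S k describes the operator lambda_k + X(k) after evaluation at T: it acts on
   the argument of f that contains k. *)
Hypothesis shiftP : forall k u,
  pact d (T k) (Y u) + \sum_(j in ext_set eN G k)
     (pact d (block_point j) (Y u) + Y (upd u j (d (u j))))
  = Y (upd u (blk eN k) (pact d (S k) (u (blk eN k)))).

(** The invariant kept by the shift operators: after evaluation only a polynomial in [d] in front of
    each argument of Y has changed. A product of shift operators then amounts to a product of
    polynomials. *)
Definition represents (h : ('I_n -> U) -> lquot d N) (R : 'I_n -> {poly F}) :=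
  forall u, evq T (h u) = Y (fun i => pact d (R i) (u i)).

Lemma op_shift_represents k h R : represents h R ->
  represents (op_shift eN G k h) (fun i => if blk eN k == i then S k * R i else R i).
Proof.
move=> hR u; rewrite /op_shift evqD // evq_map // ev_var -/(evq T _) hR evq_sum //.
under eq_bigr => j _.
  rewrite /op_x evqD // evq_map // ev_lpLambda -/(evq T _) !hR.
  have -> : (fun i => pact d (R i) ([eta u with j |-> d (u j)] i))
     = upd (fun i => pact d (R i) (u i)) j (d (pact d (R j) (u j))).
    apply/funext => i; rewrite /upd /=; case: eqP => [->|//].
    by rewrite d_pact.
  over.
rewrite shiftP; congr Y; apply/funext => i; rewrite /upd /= eq_sym.
by case: eqP => [->|//]; rewrite pactM.
Qed.

Lemma iter_op_shift_represents k e h R : represents h R ->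
  represents (iter e (op_shift eN G k) h)
    (fun i => if blk eN k == i then S k ^+ e * R i else R i).
Proof.
move=> hR; elim: e => [|e IH] /=.
  by move=> u; rewrite hR; congr Y; apply/funext => i; rewrite expr0 mul1r if_same.
move=> u; rewrite (op_shift_represents k IH); congr Y; apply/funext => i.
by case: eqP => // _; rewrite exprS mulrA.
Qed.

Lemma prod_op_shift_represents (e : 'I_N -> nat) (r : seq 'I_N) h R :
  represents h R ->
  represents ((\big[comp/id]_(k <- r) iter (e k) (op_shift eN G k)) h)
    (fun i => (\prod_(k <- r | blk eN k == i) S k ^+ e k) * R i).
Proof.
move=> hR; elim: r => [|k r IH].
  by move=> u; rewrite big_nil hR; congr Y; apply/funext => i; rewrite big_nil mul1r.
move=> u; rewrite big_cons /= (iter_op_shift_represents _ _ IH); congr Y.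
by apply/funext => i; rewrite big_cons; case: eqP => // _; rewrite mulrA.
Qed.

End CompositionEvaluation.

Section Composition2.
Variables (F : fieldType) (U : superspace F) (d : {linear U -> U}).
Variables (m : 'I_2 -> nat) (N : nat) (eN : N = (\sum_(i < 2) m i)%N).
Variables (T : 'I_N -> {poly F}) (hT : \sum_k T k = - 'X).
Variables (f : cochain d 2) (g : forall i, cochain d (m i)).
Variables (G : graph N) (v : 'I_N -> U) (S : 'I_N -> {poly F}).
Hypothesis f_lin : multilinear f.

Let T2 := block_point eN T.
Let Y (u : 'I_2 -> U) := evq T2 (f (outer_graph eN G) u).

Hypothesis shiftP : forall k u,
  pact d (T k) (Y u) + \sum_(j in ext_set eN G k)
     (pact d (T2 j) (Y u) + Y (upd u j (d (u j))))
  = Y (upd u (blk eN k) (pact d (S k) (u (blk eN k)))).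

Lemma pair_funE (u : 'I_2 -> U) : u = pair_fun (u ord0) (u ord_max).
Proof. by apply/funext => i; case: (ord2P i) => ->. Qed.

Lemma upd0 (a b c : U) : [eta pair_fun a b with ord0 |-> c] = pair_fun c b :> (_ -> U).
Proof. by apply/funext => i; case: (ord2P i) => ->. Qed.

Lemma upd1 (a b c : U) : [eta pair_fun a b with ord_max |-> c] = pair_fun a c :> (_ -> U).
Proof. by apply/funext => i; case: (ord2P i) => ->. Qed.

(** The sum over choices of one monomial in each g_i is the bilinear expansion of Y at two evaluated
    polynomials. The composition thus becomes plain substitution, the inner operations being
    evaluated at S. *)
Lemma comp_ev : acyclic (outer_graph eN G) ->
  evq T (comp_nosign eN f g G v)
  = evq T2 (f (outer_graph eN G) (fun i =>
      ev d (fun a => S (vtx eN a))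
        (qrepr (g (inner_graph eN G i) (fun a => v (vtx eN a)))))).
Proof.
move=> ac; rewrite /comp_nosign asboolT // evq_sum //.
pose gp i : lpoly U (m i) :=
  qrepr (g (inner_graph eN G i) (fun a => v (vtx eN a))).
have h0 : represents T Y (fun u => qmap (lpsubst (lpLambda eN))
    (f (outer_graph eN G) u)) (fun=> 1).
  move=> u; rewrite evq_map // (ev_subst (T' := T2)); last exact: ev_lpLambda.
  by congr (evq _ (f _ _)); apply/funext => i; rewrite pact1.
have Ylin (a b : U) c x y :
    (Y (pair_fun (c *: x + y) b) = c *: Y (pair_fun x b) + Y (pair_fun y b)) *
    (Y (pair_fun a (c *: x + y)) = c *: Y (pair_fun a x) + Y (pair_fun a y)).
  have := f_lin (outer_graph eN G) (pair_fun x b) ord0 c x y.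
  have := f_lin (outer_graph eN G) (pair_fun a x) ord_max c x y.
  rewrite !upd0 !upd1 /Y => -> ->.
  by rewrite !evqD ?evqZ //; exact: sum_block_point.
pose y0 i mm := pact d (\prod_(a < m i) S (vtx eN a) ^+ (mm : 'X_{1..m i}) a)
  (lpcoef mm (gp i)).
(* For a fixed choice of monomials, the shift operators of block i multiply to the value at S of the
   i-th monomial, acting on its coefficient. *)
transitivity (\sum_(e : {dffun forall i, lpsupp (gp i)})
  Y (pair_fun (y0 ord0 (val (e ord0))) (y0 ord_max (val (e ord_max))))).
  apply: eq_bigr => e _.
  rewrite (prod_op_shift_represents hT shiftP _ _ h0); congr Y.
  rewrite [LHS]pair_funE; congr pair_fun; rewrite mulr1 big_block;
    congr pact; apply: eq_bigr => a _; congr (_ ^+ _);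
    exact: (blk_vtx_dep eN (fun i a => val (e i) a)).
rewrite (sum_dffun2 (fun x y => Y (pair_fun (y0 ord0 (val x)) (y0 ord_max (val y))))).
have Y0l b : Y (pair_fun 0 b) = 0.
  by have [/= h _] := Ylin 0 b (-1) 0 0; rewrite scaler0 addr0 scaleN1r addNr in h.
have Y0r a : Y (pair_fun a 0) = 0.
  by have [/= _ h] := Ylin a 0 (-1) 0 0; rewrite scaler0 addr0 scaleN1r addNr in h.
have YDl b x y : Y (pair_fun (x + y) b) = Y (pair_fun x b) + Y (pair_fun y b).
  by have [h _] := Ylin 0 b 1 x y; rewrite !scale1r in h.
have YDr a x y : Y (pair_fun a (x + y)) = Y (pair_fun a x) + Y (pair_fun a y).
  by have [_ h] := Ylin a 0 1 x y; rewrite !scale1r in h.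
rewrite -/(Y _) [X in _ = Y X]pair_funE /ev /lpext !big_seq_fsetE /=.
rewrite (big_morph (fun x => Y (pair_fun x _)) (YDl _) (Y0l _)).
apply: eq_bigr => x _.
by rewrite (big_morph (fun y => Y (pair_fun _ y)) (YDr _) (Y0r _)).
Qed.

End Composition2.

Definition pt2 (R : Type) (P Q : R) : 'I_2 -> R := fun i => if i == ord0 then P else Q.

Lemma sum_pt2 (R : zmodType) (P Q : R) : \sum_i pt2 P Q i = P + Q.
Proof. by rewrite !big_ord_recl big_ord0 addr0. Qed.

Lemma sum_ord2 (W : zmodType) (H : 'I_2 -> W) : \sum_i H i = H ord0 + H ord_max.
Proof.
rewrite !big_ord_recl big_ord0 addr0; congr (_ + H _); exact: val_inj.
Qed.

Lemma sum_setT2 (W : zmodType) (H : 'I_2 -> W) :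
  \sum_(i in [set: 'I_2]) H i = H ord0 + H ord_max.
Proof. by rewrite -sum_ord2; apply: eq_bigl => i; rewrite inE. Qed.

Section Arity2.
Variables (F : fieldType) (U : superspace F) (d : {linear U -> U}).
Variable f : cochain d 2.

Definition val2 (G : graph 2) (T : 'I_2 -> {poly F}) (a b : U) : U :=
  evq T (f G (pair_fun a b)).

Variables (G : graph 2) (T : 'I_2 -> {poly F}) (hT : \sum_i T i = - 'X).
Hypothesis fP : in_Pcl f.

Lemma val2_linl b : linear ((val2 G T)^~ b).
Proof.
move=> c x y; rewrite /val2; have := Pcl_lin fP G (pair_fun x b) ord0 c x y.
by rewrite !upd0 => ->; rewrite evqD // evqZ.
Qed.

Lemma val2_linr a : linear (val2 G T a).
Proof.
move=> c x y; rewrite /val2; have := Pcl_lin fP G (pair_fun a x) ord_max c x y.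
by rewrite !upd1 => ->; rewrite evqD // evqZ.
Qed.

Lemma val2_sesqui_empty a b : nedges G = 0%N ->
  val2 G T (d a) b = - pact d (T ord0) (val2 G T a b) /\
  val2 G T a (d b) = - pact d (T ord_max) (val2 G T a b).
Proof.
move=> h0; have key i := Pcl_sesqui fP G (pair_fun a b) i.
split; [have := key ord0|have := key ord_max];
  rewrite component_empty // big_set1 ?upd0 ?upd1 /val2 => ->;
  by rewrite evqN // evq_map // (raddf_sum (ev d T)) /= big_set1 ev_var.
Qed.

Lemma val2_sesqui_edge a b : (0 < nedges G)%N ->
  val2 G T (d a) b + val2 G T a (d b) = d (val2 G T a b).
Proof.
move=> h0; have := Pcl_sesqui fP G (pair_fun a b) ord0.
rewrite component_edge // sum_setT2 upd0 upd1 => /(congr1 (evq T)).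
rewrite evqD // evqN // evq_map // sum_setT2 raddfD /= !ev_var -!/(evq T _).
by rewrite -pactD -sum_ord2 hT pactN opprK pactX.
Qed.

End Arity2.

(** * Graphs on three vertices: a block of two vertices and a single vertex *)

Section TwoBlocks.
Variables (m : 'I_2 -> nat) (N : nat) (eN : N = (\sum_(i < 2) m i)%N).
Variable G : graph N.

Lemma outer_mult_gt0 k k' : blk eN k != blk eN k' -> (0 < mult G (k, k'))%N ->
  (0 < mult (outer_graph eN G) (blk eN k, blk eN k'))%N.
Proof.
move=> /negPf kk' h; rewrite mult_mkgraph kk'.
rewrite (bigD1 (blkpos eN k)) //= (bigD1 (blkpos eN k')) //= !vtx_blk.
by rewrite -addnA ltn_addr.
Qed.

(** With two blocks, a trail ending in the block of k would be closed, against acyclicity. So j is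
    the other block, and one edge from k to that block is already a suitable trail. *)
Lemma mem_ext_set k j : acyclic (outer_graph eN G) ->
  (j \in ext_set eN G k) = (j != blk eN k) &&
    [exists k', (blk eN k' != blk eN k) &&
      ((0 < mult G (k, k'))%N || (0 < mult G (k', k))%N)].
Proof.
move=> ac; rewrite inE; apply/asboolP/andP.
- move=> [a [s [k' [tr e ea]]]]; split.
    by apply/eqP => ej; rewrite ej in tr; have := ac _ _ tr.
  apply/existsP; exists k'; apply/andP; split; last first.
    by case: (a.2) e => ->; rewrite ?orbT.
  apply/eqP => eb; have := trail_mult tr (mem_head _ _).
  by rewrite ea eb if_same mult_diag.
- move=> [jk /existsP[k' /andP[bk h]]].
  have ej : j = blk eN k'.
    case: (ord2P (blk eN k)) jk bk => ->; case: (ord2P j) => ->;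
    by case: (ord2P (blk eN k')) => ->.
  case/orP: h => h.
    exists ((blk eN k, blk eN k'), false), [::], k'; split=> //.
    rewrite ej; apply: (@trail1 _ _ ((blk eN k, blk eN k'), false)).
    by apply: outer_mult_gt0; rewrite // eq_sym.
  exists ((blk eN k', blk eN k), true), [::], k'; split=> //.
  rewrite ej; apply: (@trail1 _ _ ((blk eN k', blk eN k), true)).
  by apply: outer_mult_gt0.
Qed.

End TwoBlocks.

Definition k0 : 'I_3 := ord0.
Definition k1 : 'I_3 := Ordinal (isT : (1 < 3)%N).
Definition k2 : 'I_3 := ord_max.

Lemma ord3P (i : 'I_3) : [\/ i = k0, i = k1 | i = k2].
Proof.
by case: i => -[|[|[|//]]] h; [apply: Or31|apply: Or32|apply: Or33]; apply: val_inj.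
Qed.

Lemma sum_ord3 (W : nmodType) (H : 'I_3 -> W) : \sum_i H i = H k0 + H k1 + H k2.
Proof.
rewrite !big_ord_recl big_ord0 addr0 -addrA; congr (H _ + (H _ + H _)); exact: val_inj.
Qed.

Notation e21 := (circ1_arityE 2 1).

Lemma vtx21_0 : vtx e21 (i := ord0) (ord0 : 'I_2) = k0.
Proof. by apply: val_inj; apply: etrans (tagnat.RankEsum _) _; rewrite big_pred0. Qed.

Lemma vtx21_1 : vtx e21 (i := ord0) (ord_max : 'I_2) = k1.
Proof. by apply: val_inj; apply: etrans (tagnat.RankEsum _) _; rewrite big_pred0. Qed.

Lemma vtx21_2 : vtx e21 (i := ord_max) (ord0 : 'I_1) = k2.
Proof.
apply: val_inj; apply: etrans (tagnat.RankEsum _) _.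
by rewrite (big_pred1 ord0) // => -[[|[]]].
Qed.

Lemma blk21_0 : blk e21 k0 = ord0. Proof. by rewrite -vtx21_0 blk_vtx. Qed.
Lemma blk21_1 : blk e21 k1 = ord0. Proof. by rewrite -vtx21_1 blk_vtx. Qed.
Lemma blk21_2 : blk e21 k2 = ord_max. Proof. by rewrite -vtx21_2 blk_vtx. Qed.

Definition emult n (G : graph n) (i j : 'I_n) : nat := mult G (i, j) + mult G (j, i).

Section ThreeGraphs.
Variable G : graph 3.

Lemma inner21_01 : mult (inner_graph e21 G ord0) (ord0 : 'I_2, ord_max : 'I_2) = mult G (k0, k1).
Proof. by rewrite mult_mkgraph vtx21_0 vtx21_1. Qed.

Lemma inner21_10 : mult (inner_graph e21 G ord0) (ord_max : 'I_2, ord0 : 'I_2) = mult G (k1, k0).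
Proof. by rewrite mult_mkgraph vtx21_0 vtx21_1. Qed.

Lemma outer21_01 : mult (outer_graph e21 G) (ord0, ord_max)
  = (mult G (k0, k2) + mult G (k1, k2))%N.
Proof.
rewrite mult_mkgraph /=.
have E (a : 'I_2) : (\sum_(b < circ1_arity 2 (ord_max : 'I_2))
    mult G (vtx e21 (i := ord0) a, vtx e21 b))%N = mult G (vtx e21 (i := ord0) a, k2).
  by rewrite /circ1_arity /= big_ord1 vtx21_2.
rewrite (eq_bigr (fun a : 'I_2 => mult G (vtx e21 (i := ord0) a, k2))) //.
rewrite /circ1_arity /= !big_ord_recl big_ord0 addn0 vtx21_0.
by congr (_ + mult G (_, _))%N; rewrite -vtx21_1; congr vtx; apply: val_inj.
Qed.

Lemma outer21_10 : mult (outer_graph e21 G) (ord_max, ord0)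
  = (mult G (k2, k0) + mult G (k2, k1))%N.
Proof.
rewrite mult_mkgraph /=.
rewrite /circ1_arity /= big_ord1 vtx21_2.
rewrite /circ1_arity /= !big_ord_recl big_ord0 addn0 vtx21_0.
by congr (_ + mult G (_, _))%N; rewrite -vtx21_1; congr vtx; apply: val_inj.
Qed.

Lemma nedges_outer21 : nedges (outer_graph e21 G) = (emult G k0 k2 + emult G k1 k2)%N.
Proof. by rewrite /nedges outer21_01 outer21_10 addnACA. Qed.

Lemma exists_ord3 (P : pred 'I_3) : [exists i, P i] = [|| P k0, P k1 | P k2].
Proof.
apply/existsP/or3P => [[i]|[] h]; last 3 first.
- by exists k0.
- by exists k1.
- by exists k2.
by case: (ord3P i) => ->; [apply: Or31|apply: Or32|apply: Or33].
Qed.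

Lemma ext_set21_block k j : k \in [:: k0; k1] -> acyclic (outer_graph e21 G) ->
  (j \in ext_set e21 G k) = (j == ord_max) && (0 < emult G k k2)%N.
Proof.
move=> hk ac; have bk : blk e21 k = ord0.
  by move: hk; rewrite !inE => /orP[] /eqP->; rewrite ?blk21_0 ?blk21_1.
rewrite mem_ext_set // bk exists_ord3 blk21_0 blk21_1 blk21_2 /= /emult addn_gt0.
by case: (ord2P j) => ->.
Qed.

Lemma ext_set21_last j : acyclic (outer_graph e21 G) ->
  (j \in ext_set e21 G k2) = (j == ord0) && (0 < nedges (outer_graph e21 G))%N.
Proof.
move=> ac; rewrite mem_ext_set // exists_ord3 blk21_0 blk21_1 blk21_2 /= orbF.
rewrite nedges_outer21 /emult !addn_gt0 ![_ || (0 < mult G (k2, _))%N]orbC.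
by case: (ord2P j) => ->.
Qed.

End ThreeGraphs.

Lemma sum_nat_ord2 (H : 'I_2 -> nat) : (\sum_i H i = H ord0 + H ord_max)%N.
Proof.
by rewrite !big_ord_recl big_ord0 addn0; congr (_ + H _)%N; exact: val_inj.
Qed.

(** * Decomposition into homogeneous components *)

Section SumsOverParities.
Variables (F : fieldType) (U : superspace F).

Lemma sum_ffun_ordS (W : zmodType) (T : finType) n (H : {ffun 'I_n.+1 -> T} -> W) :
  \sum_b H b = \sum_t \sum_(b : {ffun 'I_n -> T})
    H [ffun i => oapp b t (unlift ord0 i)].
Proof.
rewrite pair_big /= (reindex (fun p : T * {ffun 'I_n -> T} =>
  [ffun i => oapp p.2 p.1 (unlift ord0 i)])) //.
apply: onW_bij; exists (fun b : {ffun 'I_n.+1 -> T} => (b ord0, [ffun j => b (lift ord0 j)])).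
  case=> t b /=; rewrite ffunE unlift_none /=; congr pair.
  by apply/ffunP => j; rewrite !ffunE liftK.
move=> b; apply/ffunP => i; rewrite ffunE /=.
by case: unliftP => [j|] -> //=; rewrite ffunE.
Qed.

(** Undoes the sums over parities by which the action and the composition are extended from
    homogeneous to arbitrary arguments. *)
Lemma sum_scomp (W : zmodType) n (M : ('I_n -> U) -> W) v :
  (forall u i x y, M [eta u with i |-> x + y]
     = M [eta u with i |-> x] + M [eta u with i |-> y]) ->
  \sum_(b : {ffun 'I_n -> bool}) M (fun i => scomp U (b i) (v i)) = M v.
Proof.
elim: n M v => [|n IH] M v MD.
  rewrite (big_pred1 [ffun=> false]) => [|b].
    by congr M; apply/funext => -[].
  by apply/esym/eqP/ffunP => -[].
pose vcons (x : U) (w : 'I_n -> U) (i : 'I_n.+1) := oapp w x (unlift ord0 i).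
have vcons_eta x (w : 'I_n -> U) j y :
    vcons x [eta w with j |-> y] = [eta vcons x w with lift ord0 j |-> y].
  apply/funext => i /=; rewrite /vcons; case: unliftP => [l|] -> /=.
    by rewrite (inj_eq lift_inj).
  by [].
have vcons_eta0 x y (w : 'I_n -> U) :
    vcons y w = [eta vcons x w with ord0 |-> y].
  apply/funext => i /=; rewrite /vcons; case: unliftP => [l|] -> /=.
    by [].
  by [].
pose w j := v (lift ord0 j).
rewrite sum_ffun_ordS.
transitivity (\sum_t M (vcons (scomp U t (v ord0)) w)).
  apply: eq_bigr => t _.
  rewrite -(IH (fun w => M (vcons (scomp U t (v ord0)) w)) w) => [|u i x y]; last first.
    by rewrite !vcons_eta MD.
  apply: eq_bigr => b _; congr M; apply/funext => i.
  by rewrite ffunE /vcons; case: unliftP => [j|] ->.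
have -> : M v = M (vcons (scomp U false (v ord0) + scomp U true (v ord0)) w).
  congr M; apply/funext => i; rewrite /vcons scompD.
  by case: unliftP => [j|] ->.
rewrite (vcons_eta0 0 (_ + _) w) MD -!vcons_eta0 big_bool.
exact: addrC.
Qed.

End SumsOverParities.

Section Parity.
Variables (F : fieldType) (U : superspace F) (d : {linear U -> U}).
Hypothesis d_even : even_map d.

Lemma homog_scomp b (v : U) : homog b (scomp U b v).
Proof. by rewrite /homog scompK eqxx. Qed.

Lemma scomp_homog b c (v : U) : homog b v -> scomp U c v = if c == b then v else 0.
Proof. by move=> <-; rewrite scompK; case: eqP => // ->. Qed.

Lemma scomp_d b (v : U) : scomp U b (d v) = d (scomp U b v).
Proof.
rewrite -[v in LHS]scompD !raddfD /=.
rewrite !(scomp_homog _ (d_even (homog_scomp _ v))).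
by case: b; rewrite /= ?addr0 ?add0r.
Qed.

Lemma scomp_pact b P (v : U) : scomp U b (pact d P v) = pact d P (scomp U b v).
Proof. by apply: pact_commute; [exact: linearP|exact: scomp_d]. Qed.

Lemma homog_ev n (T : 'I_n -> {poly F}) b (p : lpoly U n) :
  (forall m, homog b (lpcoef m p)) -> homog b (ev d T p).
Proof.
move=> hp; rewrite /homog /ev /lpext raddf_sum /=.
by apply: eq_bigr => m _; rewrite scomp_pact hp.
Qed.

Variables (n : nat) (T : 'I_n -> {poly F}) (hT : \sum_i T i = - 'X).

Lemma homog_evq b (x : lquot d n) : qhomog b x -> homog b (evq T x).
Proof. by case=> p -> hp; rewrite evq_pi //; exact: homog_ev. Qed.

Lemma evq_qcomp b (x : lquot d n) : evq T (qcomp b x) = scomp U b (evq T x).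
Proof.
rewrite /qcomp evq_map //; apply: ev_map_comm; first exact: linearP.
exact: scomp_d.
Qed.

(** For a map of parity [q0] the sum over parities of the operations in [Pcl_comp] reduces to one
    term. Homogeneity is required only of the evaluated values. *)
Lemma evq_parity_comp q0 q (f : cochain d n) G v : multilinear f ->
  (forall (b : {ffun 'I_n -> bool}), homog (q0 (+) \big[addb/false]_(i < n) b i)
    (evq T (f G (fun i => scomp U (b i) (v i))))) ->
  evq T (parity_comp q f G v) = if q == q0 then evq T (f G v) else 0.
Proof.
move=> fl fo; rewrite /parity_comp evq_sum //.
under eq_bigr => b _ do rewrite evq_qcomp (scomp_homog _ (fo b)) (inj_eq (@addIb _)).
case: eqP => _; last exact: big1_eq.
rewrite (sum_scomp (M := fun w => evq T (f G w))) // => u i x y.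
have := fl G u i 1 x y; rewrite !scale1r => ->.
by rewrite evqD.
Qed.

End Parity.

Section Circ1.
Variables (F : fieldType) (U : superspace F) (d : {linear U -> U}).
Variables (f : cochain d 2) (fP : in_Pcl f).
Variables (T : 'I_3 -> {poly F}) (hT : \sum_k T k = - 'X).
Variable G : graph 3.

Definition outer3 : graph 2 := outer_graph e21 G.
Definition inner3 : graph 2 := inner_graph e21 G ord0.

Lemma block_point21 : block_point e21 T = pt2 (T k0 + T k1) (T k2).
Proof.
apply/funext => i; rewrite /block_point /pt2; case: (ord2P i) => -> /=.
  by rewrite /circ1_arity /= (sum_ord2 (fun a : 'I_2 => T (vtx e21 (i := ord0) a))) vtx21_0 vtx21_1.
by rewrite /circ1_arity /= big_ord1 vtx21_2.
Qed.

Section Shift.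
Variables (s : bool) (x : F).
Hypotheses (Ts : T (if s then k1 else k0) = x%:P)
  (es : emult G (if s then k1 else k0) k2 = 0%N) (le1 : (nedges outer3 <= 1)%N).

(** The boolean [s] selects the free vertex of the block, where x is the scalar coordinate. The
    other vertex of the block gets - 'X - x, and [k2], alone in its block, gets - 'X; on each block
    the sum is - 'X. *)
Definition shift21 (k : 'I_3) : {poly F} :=
  if k == k2 then - 'X else if k == (if s then k1 else k0) then x%:P else - 'X - x%:P.

Let Y (u : 'I_2 -> U) := evq (block_point e21 T) (f outer3 u).

(** At the free vertex both sides are multiplication by x. At the others, if the outer graph has no
    edge, the sum is empty and sesquilinearity on a one-vertex component turns T k into the action
    of [d] on one argument. If it has an edge, the sum adds Lambda_j + partial_j for the other block
    j; the coordinates then combine to a term - 'X, and the rule that [d] of the value is the sum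
    over both arguments leaves [d] on the argument containing k. *)
Lemma shift21P k u :
  pact d (T k) (Y u) + \sum_(j in ext_set e21 G k)
     (pact d (block_point e21 T j) (Y u) + Y (upd u j (d (u j))))
  = Y (upd u (blk e21 k) (pact d (shift21 k) (u (blk e21 k)))).
Proof.
have ac : acyclic outer3 by apply/acyclic2P.
have hT2 : \sum_i block_point e21 T i = - 'X by rewrite sum_block_point.
have Yl := val2_linl outer3 hT2 fP; have Yr := val2_linr outer3 hT2 fP.
have Tblk : T k0 + T k1 = - 'X - T k2.
  by apply/eqP; rewrite eq_sym subr_eq -hT sum_ord3.
have Tother : T (if s then k0 else k1) + T k2 = - 'X - x%:P.
  apply/eqP; rewrite eq_sym subr_eq -hT sum_ord3 -Ts; apply/eqP.
  by case: (s); ring.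
have bT0 : block_point e21 T ord0 = - 'X - T k2 by rewrite block_point21 Tblk.
have bT1 : block_point e21 T ord_max = T k2 by rewrite block_point21.
have ne : nedges outer3 = emult G (if s then k0 else k1) k2.
  by rewrite nedges_outer21; move: es; case: (s) => ->; rewrite ?addn0.
have sesE a b : nedges outer3 = 0%N ->
    Y (pair_fun (d a) b) = d (Y (pair_fun a b)) + pact d (T k2) (Y (pair_fun a b)) /\
    Y (pair_fun a (d b)) = - pact d (T k2) (Y (pair_fun a b)).
  move=> h0; have [] := val2_sesqui_empty hT2 fP a b h0; rewrite bT0 bT1 /val2 -/(Y _).
  by rewrite pactD !pactN pactX opprD !opprK.
have sesA a b : (0 < nedges outer3)%N ->
    Y (pair_fun (d a) b) + Y (pair_fun a (d b)) = d (Y (pair_fun a b)).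
  by move=> h0; have := val2_sesqui_edge hT2 fP a b h0.
have YZl c a b : Y (pair_fun (c *: a) b) = c *: Y (pair_fun a b) by exact: (linZ (Yl b)).
have YNl a b : Y (pair_fun (- a) b) = - Y (pair_fun a b) by exact: (linN (Yl b)).
have YBl a a' b : Y (pair_fun (a - a') b) = Y (pair_fun a b) - Y (pair_fun a' b).
  by exact: (linB (Yl b)).
have YNr a b : Y (pair_fun a (- b)) = - Y (pair_fun a b) by exact: (linN (Yr a)).
rewrite [u]pair_funE; move: (u ord0) (u ord_max) => {u} a b.
have [Hk|Hk|Hk] : [\/ k = (if s then k1 else k0), k = (if s then k0 else k1) | k = k2].
- by case: (ord3P k) => ->; case: (s);
    [apply: Or32|apply: Or31|apply: Or31|apply: Or32|apply: Or33|apply: Or33].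
- have kb : k \in [:: k0; k1] by rewrite Hk !inE; case: (s).
  rewrite big_pred0 => [|j]; last by rewrite ext_set21_block // Hk es andbF.
  have -> : shift21 k = x%:P by rewrite /shift21 Hk eqxx; case: (s).
  have -> : blk e21 k = ord0 by rewrite Hk; case: (s); rewrite ?blk21_0 ?blk21_1.
  by rewrite Hk Ts !pactC addr0 /upd upd0 YZl.
- have kb : k \in [:: k0; k1] by rewrite Hk !inE; case: (s).
  have -> : shift21 k = - 'X - x%:P by rewrite /shift21 Hk; case: (s).
  have -> : blk e21 k = ord0 by rewrite Hk; case: (s); rewrite ?blk21_0 ?blk21_1.
  rewrite /upd upd0 pactD !pactN pactX pactC YBl YNl YZl.
  have Tk : T k = - 'X - x%:P - T k2 by rewrite Hk -Tother addrK.
  have [h0|h0] := posnP (nedges outer3).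
    rewrite big_pred0 => [|j]; last by rewrite ext_set21_block // Hk -ne h0 andbF.
    rewrite (sesE _ _ h0).1 Tk !pactD !pactN pactX pactC addr0 opprD.
    by rewrite addrAC.
  rewrite (big_pred1 ord_max) => [|j]; last first.
    by rewrite ext_set21_block // Hk -ne h0 andbT.
  rewrite upd1 bT1 addrA -pactD Tk subrK pactD !pactN pactX pactC -(sesA _ _ h0).
  by rewrite opprD addrAC subrK.
- rewrite Hk blk21_2 /upd upd1 /shift21 eqxx pactN pactX YNr.
  have [h0|h0] := posnP (nedges outer3).
    rewrite big_pred0 => [|j]; last by rewrite ext_set21_last // h0 andbF.
    by rewrite (sesE _ _ h0).2 opprK addr0.
  rewrite (big_pred1 ord0) => [|j]; last by rewrite ext_set21_last // h0 andbT.
  rewrite upd0 bT0 addrA -pactD [T k2 + _]addrC subrK pactN pactX -(sesA _ _ h0).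
  by rewrite opprD addrAC addNr add0r.
Qed.

End Shift.

Definition inner_point (s : bool) (x : F) : 'I_2 -> {poly F} :=
  if s then pt2 (- 'X - x%:P) x%:P else pt2 x%:P (- 'X - x%:P).

Lemma sum_inner_point s x : \sum_i inner_point s x i = - 'X.
Proof. by rewrite /inner_point; case: s; rewrite sum_pt2; ring. Qed.

Lemma comp21_ev s x (g : forall i : 'I_2, cochain d (circ1_arity 2 i)) v :
  ((nedges outer3 <= 1)%N -> T (if s then k1 else k0) = x%:P /\
    emult G (if s then k1 else k0) k2 = 0%N) ->
  evq T (comp_nosign e21 f g G v) =
  if (nedges outer3 <= 1)%N then
    val2 f outer3 (pt2 (T k0 + T k1) (T k2))
      (evq (inner_point s x) ((g ord0 : cochain d 2) inner3 (pair_fun (v k0) (v k1))))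
      (evq (fun=> - 'X) ((g ord_max : cochain d 1) (inner_graph e21 G ord_max) (fun=> v k2)))
  else 0.
Proof.
move=> Tes; case: ifPn => [le1|gt1]; last first.
  rewrite /comp_nosign asboolF ?evq0 // => /acyclic2P.
  by apply/negP.
have ac : acyclic outer3 by apply/acyclic2P.
have [Ts es] := Tes le1.
rewrite (comp_ev hT g v (Pcl_lin fP) (shift21P Ts es le1) ac).
rewrite block_point21 /val2; congr (evq _ (f _ _)).
rewrite [LHS]pair_funE; congr pair_fun; rewrite /evq.
- have -> : (fun a : 'I_2 => v (vtx e21 (i := ord0) a)) = pair_fun (v k0) (v k1).
    by apply/funext => a; case: (ord2P a) => ->; rewrite ?vtx21_0 ?vtx21_1.
  apply: eq_ev => a; rewrite /shift21 /inner_point /pt2.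
  by case: (ord2P a) => ->; rewrite ?vtx21_0 ?vtx21_1; case: (s).
- have -> : (fun a : 'I_1 => v (vtx e21 (i := ord_max) a)) = (fun=> v k2).
    by apply/funext => a; rewrite (ord1 a) vtx21_2.
  by apply: eq_ev => a; rewrite (ord1 a) vtx21_2.
Qed.

Hypothesis d_even : even_map d.
Hypothesis f_odd : has_parity true f.

Lemma unit_lin : multilinear (@Pcl_unit F U d).
Proof.
move=> H v i c a b; rewrite /Pcl_unit (ord1 i) /=.
have h : lpC 1 (c *: a + b) = c *: lpC 1 a + lpC 1 b :> lpoly U 1.
  by apply/lpolyP => l; rewrite raddfD /= lpcoefZ !lpcoef_mono mulrnDl scalerMnr.
by rewrite h qpiD qpiZ.
Qed.

(** Since [f] is odd and [Pcl_unit] even, a single choice of parities of the operations contributes;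
    the sum over parities of the arguments is recombined by multilinearity. *)
Lemma circ1_ev s x v :
  ((nedges outer3 <= 1)%N -> T (if s then k1 else k0) = x%:P /\
    emult G (if s then k1 else k0) k2 = 0%N) ->
  evq T (circ1 (n := 1) f f G v) =
  if (nedges outer3 <= 1)%N then
    val2 f outer3 (pt2 (T k0 + T k1) (T k2))
      (val2 f inner3 (inner_point s x) (v k0) (v k1)) (v k2)
  else 0.
Proof.
move=> Tes; rewrite /circ1 /Pcl_comp evq_sum //.
have hi := sum_inner_point s x.
have h1 : \sum_(i < 1) (- 'X : {poly F}) = - 'X by rewrite big_ord1.
pose M (u : 'I_3 -> U) := if (nedges outer3 <= 1)%N then
    val2 f outer3 (pt2 (T k0 + T k1) (T k2))
      (val2 f inner3 (inner_point s x) (u k0) (u k1)) (u k2)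
  else 0.
transitivity (\sum_(q : {ffun 'I_2 -> bool}) \sum_(b : {ffun 'I_3 -> bool})
   if (q ord0 == true) && (q ord_max == false) then M (fun k => scomp U (b k) (v k)) else 0).
  apply: eq_bigr => q _; rewrite evq_sum //; apply: eq_bigr => b _.
  rewrite evqZ // (comp21_ev _ _ Tes) /circ1_family /=.
  (* The only pair i < j has j = [ord_max], so the sign involves the parity of the unit alone and is
     trivial in the surviving term. *)
  have -> : comp_sign e21 q b = if q ord_max then comp_sign e21 q b else 0%N.
    case qm: (q ord_max) => //; rewrite /comp_sign sum_nat_ord2.
    rewrite [X in (_ + X)%N]big1 ?addn0.
      by rewrite big_pred0.
    by move=> i _; rewrite qm big1.
  rewrite (evq_parity_comp d_even hi (q0 := true) (q ord0) (Pcl_lin fP)) => [|b']; last first.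
    by apply: (homog_evq d_even hi); apply: f_odd => i; exact: homog_scomp.
  rewrite (evq_parity_comp d_even h1 (q0 := false) (q ord_max) unit_lin) => [|b']; last first.
    rewrite big_ord1 /= /Pcl_unit evq_pi // evC; exact: homog_scomp.
  have hT' : \sum_i pt2 (T k0 + T k1) (T k2) i = - 'X by rewrite sum_pt2 -sum_ord3.
  rewrite {1}/Pcl_unit evq_pi // evC /M; case: (nedges outer3 <= 1)%N; last by rewrite scaler0 if_same.
  case: (q ord0); case: (q ord_max); rewrite /= ?expr0 ?scale1r //.
  - by rewrite (lin0 (val2_linr _ hT' fP _)) scaler0.
  - by rewrite (lin0 (val2_linl _ hT' fP _)) scaler0.
  - by rewrite (lin0 (val2_linl _ hT' fP _)).
rewrite (bigD1 [ffun i => i == ord0]) //= [X in _ + X]big1 ?addr0 => [|q hq]; last first.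
  rewrite big1 // => b _; case: ifP => // /andP[/eqP q0 /eqP q1]; case/eqP: hq.
  by apply/ffunP => i; rewrite ffunE; case: (ord2P i) => ->.
rewrite !ffunE /= (sum_scomp (M := M)) // => u i a b.
rewrite /M; case: ifP => _; last by rewrite addr0.
have hT' : \sum_i pt2 (T k0 + T k1) (T k2) i = - 'X by rewrite sum_pt2 -sum_ord3.
by case: (ord3P i) => -> /=;
  rewrite ?(linD (val2_linl _ hi fP _)) ?(linD (val2_linr _ hi fP _))
    ?(linD (val2_linl _ hT' fP _)) ?(linD (val2_linr _ hT' fP _)).
Qed.

End Circ1.

(** * The box product in arity three *)
Section Shuffles.

(** A (2,1)-shuffle is determined by the image c of the last index: lifting the identity sends the
    first two indices increasingly to the other two values. *)
Definition sh (c : 'I_3) : 'S_3 := lift_perm ord_max c 1%g.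

Lemma sh_last c : sh c k2 = c.
Proof. exact: lift_perm_id. Qed.

Lemma sh_lift c (i : 'I_2) : sh c (lift ord_max i) = lift c i.
Proof. by rewrite /sh lift_perm_lift perm1. Qed.

Lemma sh_val0 c : sh c k0 = lift c (ord0 : 'I_2).
Proof. by rewrite -sh_lift; congr (sh c _); apply: val_inj. Qed.

Lemma sh_val1 c : sh c k1 = lift c (ord_max : 'I_2).
Proof. by rewrite -sh_lift; congr (sh c _); apply: val_inj. Qed.

Lemma sh0 : (sh k0 k0 = k1) * (sh k0 k1 = k2) * (sh k0 k2 = k0).
Proof. rewrite sh_last sh_val0 sh_val1; (split; first split); exact: val_inj. Qed.

Lemma sh1 : (sh k1 k0 = k0) * (sh k1 k1 = k2) * (sh k1 k2 = k1).
Proof. rewrite sh_last sh_val0 sh_val1; (split; first split); exact: val_inj. Qed.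

Lemma sh2 : (sh k2 k0 = k0) * (sh k2 k1 = k1) * (sh k2 k2 = k2).
Proof. rewrite sh_last sh_val0 sh_val1; (split; first split); exact: val_inj. Qed.

Lemma shuffle21 (s : 'S_(2 + 1)) : shuffle (m := 2) (n := 1) s = (s k0 < s k1)%N.
Proof.
apply/forallP/idP => [/(_ k0)/forallP/(_ k1)/implyP|h i].
  exact.
apply/forallP => j; apply/implyP.
by case: (ord3P i) => ->; case: (ord3P j) => ->.
Qed.

Lemma sum_shuffle21 (W : zmodType) (H : 'S_3 -> W) :
  \sum_(s : 'S_(2 + 1) | shuffle (m := 2) (n := 1) s) H s
  = H (sh k0) + H (sh k1) + H (sh k2).
Proof.
rewrite (reindex_onto sh (fun s : 'S_3 => s k2)) /=; last first.
  move=> s; rewrite shuffle21 => h; apply/permP => i.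
  have i01 : s k0 != s k1 by rewrite (inj_eq perm_inj).
  have i02 : s k0 != s k2 by rewrite (inj_eq perm_inj).
  have i12 : s k1 != s k2 by rewrite (inj_eq perm_inj).
  case: (ord3P (s k0)) h i01 i02 => e0; rewrite e0;
  case: (ord3P (s k1)) i12 => e1; rewrite e1;
  case: (ord3P (s k2)) => e2; rewrite e2 // => _ _ _ _;
  by case: (ord3P i) => ->; rewrite ?sh0 ?sh1 ?sh2 ?e0 ?e1 ?e2.
rewrite -(sum_ord3 (fun c => H (sh c))); apply: eq_bigl => c.
rewrite shuffle21 sh_last eqxx andbT.
by case: (ord3P c) => ->; rewrite ?sh0 ?sh1 ?sh2.
Qed.

End Shuffles.

(** As [mkgraph] discards loops, the source already determines the edge. *)
Definition g2 (p q : nat) : graph 2 := mkgraph (fun i _ => if i == ord0 then p else q).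

Lemma g2_01 p q : mult (g2 p q) (ord0, ord_max) = p.
Proof. by rewrite mult_mkgraph. Qed.
Lemma g2_10 p q : mult (g2 p q) (ord_max, ord0) = q.
Proof. by rewrite mult_mkgraph. Qed.

Lemma nedges_g2 p q : nedges (g2 p q) = (p + q)%N.
Proof. by rewrite /nedges g2_01 g2_10. Qed.

Lemma graph2E (G : graph 2) : G = g2 (mult G (ord0, ord_max)) (mult G (ord_max, ord0)).
Proof. by apply: graph2_ext; rewrite ?g2_01 ?g2_10. Qed.

Section Box.
Variables (F : fieldType) (U : superspace F) (d : {linear U -> U}).

(** Stated for the inverse of [s], as in [box]: the point, the graph and the arguments are then all
    composed with [s] itself. *)
Lemma evq_act n (T : 'I_n -> {poly F}) (hT : \sum_i T i = - 'X) (f : cochain d n)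
    (s : 'S_n) G v :
  evq T (Pcl_act f s^-1 G v) = \sum_(b : {ffun 'I_n -> bool})
    (-1) ^+ perm_sign s^-1 b *: evq (T \o s) (f (relabel s^-1 G)
       (fun i => scomp U (b (s i)) (v (s i)))).
Proof.
rewrite /Pcl_act evq_sum //; apply: eq_bigr => b _; rewrite evqZ // evq_map //.
congr (_ *: _); rewrite invgK; apply: ev_subst => i q.
by rewrite ev_var.
Qed.

Lemma mult_relabelV n (s : 'S_n) (G : graph n) i j :
  mult (relabel s^-1 G) (i, j) = mult G (s i, s j).
Proof.
rewrite mult_mkgraph invgK; case: eqP => // ->; by rewrite mult_diag.
Qed.

Variables (f : cochain d 2) (fP : in_Pcl f) (d_even : even_map d) (f_odd : has_parity true f).

Lemma val2_big (G : graph 2) T a b : \sum_i T i = - 'X -> (1 < nedges G)%N ->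
  val2 f G T a b = 0.
Proof.
move=> hT h; rewrite /val2 (Pcl_acyclic fP) ?evq0 // => /acyclic2P.
by rewrite leqNgt h.
Qed.

(* The contribution to f Box f of the block {a1, a2} and the vertex c. *)
Definition box_term (T : 'I_3 -> {poly F}) (G : graph 3) (a1 a2 c : 'I_3)
    (s : bool) (x : F) (w : 'I_3 -> U) : U :=
  val2 f (g2 (mult G (a1, c) + mult G (a2, c)) (mult G (c, a1) + mult G (c, a2)))
    (pt2 (T a1 + T a2) (T c))
    (val2 f (g2 (mult G (a1, a2)) (mult G (a2, a1))) (inner_point s x) (w a1) (w a2))
    (w c).

(** The requirement of [circ1_ev] transported to an arbitrary block. It is conditional because for a
    cyclic outer graph the term vanishes and no free vertex need exist. *)
Definition box_point (T : 'I_3 -> {poly F}) (G : graph 3) (a1 a2 c : 'I_3)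
    (s : bool) (x : F) : Prop :=
  (emult G a1 c + emult G a2 c <= 1)%N ->
  T (if s then a2 else a1) = x%:P /\ emult G (if s then a2 else a1) c = 0%N.

(** Relabeling by the shuffle moves the block to the first two vertices, the only position treated
    by [circ1_ev]. *)
Lemma circ1_sh_ev (T : 'I_3 -> {poly F}) (hT : \sum_i T i = - 'X) G c s x w :
  box_point T G (sh c k0) (sh c k1) c s x ->
  evq (T \o sh c) (circ1 (n := 1) f f (relabel (sh c)^-1 G) (w \o sh c))
  = box_term T G (sh c k0) (sh c k1) c s x w.
Proof.
move=> h; have hT' : \sum_i (T \o sh c) i = - 'X.
  by rewrite -hT [RHS](reindex_inj (@perm_inj _ (sh c))).
have em i j : emult (relabel (sh c)^-1 G) i j = emult G (sh c i) (sh c j).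
  by rewrite /emult !mult_relabelV.
have ne : nedges (outer3 (relabel (sh c)^-1 G))
    = (emult G (sh c k0) c + emult G (sh c k1) c)%N.
  by rewrite nedges_outer21 !em sh_last.
have eo : outer3 (relabel (sh c)^-1 G) = g2 (mult G (sh c k0, c) + mult G (sh c k1, c))
    (mult G (c, sh c k0) + mult G (c, sh c k1)).
  by rewrite [LHS]graph2E outer21_01 outer21_10 !mult_relabelV sh_last.
have ei : inner3 (relabel (sh c)^-1 G) = g2 (mult G (sh c k0, sh c k1)) (mult G (sh c k1, sh c k0)).
  by rewrite [LHS]graph2E inner21_01 inner21_10 !mult_relabelV.
rewrite (circ1_ev fP hT' d_even f_odd (s := s) (x := x)) => [|le1]; last first.
  move: h; rewrite /box_point -ne => /(_ le1); rewrite em sh_last.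
  by case: (s).
rewrite eo ei /= sh_last; case: ifPn => // gt1.
rewrite /box_term val2_big //.
  by rewrite sum_pt2 -hT' sum_ord3 /= sh_last.
by rewrite ltnNge.
Qed.

Lemma sum_nat_ord3 (H : 'I_3 -> nat) : (\sum_i H i = H k0 + H k1 + H k2)%N.
Proof. exact: (sum_ord3 H). Qed.

Lemma perm_sign3 (s : 'S_3) (b : 'I_3 -> bool) : perm_sign s b =
  ((s k1 < s k0)%N * (b k0 && b k1) + (s k2 < s k0)%N * (b k0 && b k2)
   + (s k2 < s k1)%N * (b k1 && b k2))%N.
Proof.
rewrite /perm_sign; under eq_bigr do rewrite big_mkcond.
rewrite !sum_nat_ord3 /= !addn0 !add0n.
by case: (s k1 < s k0)%N; case: (s k2 < s k0)%N; case: (s k2 < s k1)%N;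
  rewrite /= ?mul1n ?mul0n ?addn0.
Qed.

Lemma perm_sign_sh (b : 'I_3 -> bool) :
  (perm_sign (sh k0)^-1 b = (b k0 && b k1) + (b k0 && b k2))%N *
  (perm_sign (sh k1)^-1 b = b k1 && b k2) * (perm_sign (sh k2)^-1 b = 0%N).
Proof.
have shV (c i j : 'I_3) : sh c i = j -> ((sh c)^-1 j = i)%g.
  by move=> <-; rewrite permK.
rewrite !perm_sign3 (shV k0 k2 k0 sh0.2) (shV k0 k0 k1 sh0.1.1) (shV k0 k1 k2 sh0.1.2).
rewrite (shV k1 k2 k1 sh1.2) (shV k1 k0 k0 sh1.1.1) (shV k1 k1 k2 sh1.1.2).
rewrite (shV k2 k2 k2 sh2.2) (shV k2 k0 k0 sh2.1.1) (shV k2 k1 k1 sh2.1.2).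
by rewrite /= !mul1n !mul0n !addn0 !add0n.
Qed.

(** Each block has its own [s] and x, because the free vertex depends on the block. The signs come
    from moving the argument of the outer vertex to the last place. *)
Lemma box_ev (T : 'I_3 -> {poly F}) (hT : \sum_i T i = - 'X) G s0 s1 s2 x0 x1 x2 v :
  box_point T G k1 k2 k0 s0 x0 -> box_point T G k0 k2 k1 s1 x1 ->
  box_point T G k0 k1 k2 s2 x2 ->
  evq T (box (n := 1) f f G v) = \sum_(b : {ffun 'I_3 -> bool})
    let w i := scomp U (b i) (v i) in
    ((-1) ^+ (b k0 && (b k1 (+) b k2)) *: box_term T G k1 k2 k0 s0 x0 w
    + (-1) ^+ (b k1 && b k2) *: box_term T G k0 k2 k1 s1 x1 w
    + box_term T G k0 k1 k2 s2 x2 w).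
Proof.
move=> h0 h1 h2; rewrite /box evq_sum //.
rewrite (sum_shuffle21 (fun s => evq T (Pcl_act (circ1 (n := 1) f f) s^-1 G v))).
rewrite !evq_act // -!big_split /=; apply: eq_bigr => b _.
pose w i := scomp U (b i) (v i).
have e0 := @circ1_sh_ev T hT G k0 s0 x0 w; rewrite !sh0 in e0.
have e1 := @circ1_sh_ev T hT G k1 s1 x1 w; rewrite !sh1 in e1.
have e2 := @circ1_sh_ev T hT G k2 s2 x2 w; rewrite !sh2 in e2.
rewrite -(e0 h0) -(e1 h1) -(e2 h2) !perm_sign_sh expr0 scale1r.
congr (_ *: _ + _ *: _ + _); rewrite -[LHS]signr_odd oddD !oddb.
by case: (b k0); case: (b k1); case: (b k2).
Qed.

End Box.

Lemma arrow_g2 : arrow_graph = g2 1 0.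
Proof. by apply: graph2_ext; rewrite ?g2_01 ?g2_10 mult_mkgraph. Qed.

Lemma empty_g2 : empty_graph 2 = g2 0 0.
Proof. by apply: graph2_ext; rewrite ?g2_01 ?g2_10 mult_mkgraph. Qed.

Section Evaluation2.
Variables (F : fieldType) (charF : [pchar F] =i pred0).
Variables (U : superspace F) (d : {linear U -> U}).

Lemma ev_q2 (P : {poly F}) (q : lquot d 2) :
  ev d (fun=> P) (q2_eval q) = evq (pt2 P (- 'X - P)) q.
Proof.
apply: ev_subst => i p; rewrite /pt2; case: eqP => _; first by rewrite ev_var.
rewrite raddfB raddfN /= ev_var ev_d pactD !pactN pactX addrC //.
Qed.

Lemma scal1 (x : 'I_1 -> F) : scal x = (fun=> (x ord0)%:P).
Proof. by apply/funext => i; rewrite /scal (ord1 i). Qed.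

Definition br_at (B : U -> U -> lpoly U 1) (P : {poly F}) (a b : U) : U :=
  ev d (fun=> P) (B a b).

Lemma lpoly1_inj (p q : lpoly U 1) :
  (forall x : F, ev d (fun=> x%:P) p = ev d (fun=> x%:P) q) -> p = q.
Proof. by move=> h; apply: (ev_scal_inj charF (d := d)) => x; rewrite scal1. Qed.

(** Projection to a parity commutes with [d], hence with evaluation, so homogeneity of all
    coefficients can be tested on values at scalar points. *)
Lemma homog_lpcoef (d_even : even_map d) n c (p : lpoly U n) :
  (forall x, homog c (ev d (scal x) p)) -> forall m, homog c (lpcoef m p).
Proof.
move=> h m; have e : lpmap (scomp U c) p = p.
  apply: (ev_scal_inj charF (d := d)) => x; rewrite ev_map_comm; first exact: (h x).
    by move=> k u v; rewrite linearP.
  exact: (scomp_d d_even).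
by rewrite /homog -lpmapE e.
Qed.

Variables (f : cochain d 2) (fP : in_Pcl f).

(** The cycle relation on [g2 1 1]: deleting either of its two edges leaves the two graphs with one
    edge. *)
Lemma val2_rev T a b : \sum_i T i = - 'X ->
  val2 f (g2 0 1) T a b = - val2 f (g2 1 0) T a b.
Proof.
move=> hT; pose s : seq (step 2) := [:: ((ord0, ord_max), false); ((ord_max, ord0), false)].
have cyc : oriented_cycle (g2 1 1) s.
  split=> //; exists ord0.
  apply: (@trail2 2 _ ((ord0, ord_max), false) ((ord_max, ord0), false)) => //=.
  by rewrite g2_01 g2_10.
have := Pcl_cycle fP (pair_fun a b) cyc; rewrite !big_cons big_nil addr0 /=.
have -> : del_edge (g2 1 1) (ord0, ord_max) = g2 0 1.
  by apply: graph2_ext; rewrite mult_mkgraph ?g2_01 ?g2_10 /= ?g2_01 ?g2_10.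
have -> : del_edge (g2 1 1) (ord_max, ord0) = g2 1 0.
  by apply: graph2_ext; rewrite mult_mkgraph ?g2_01 ?g2_10 /= ?g2_01 ?g2_10.
move=> /(congr1 (evq T)); rewrite evqD // evq0 // => /eqP; rewrite addr_eq0 => /eqP.
exact.
Qed.

Lemma val2_const a b : exists2 u, f (g2 1 0) (pair_fun a b) = qpi d (lpC 2 u) &
  forall T, \sum_i T i = - 'X -> val2 f (g2 1 0) T a b = u.
Proof.
have [|u e] := @const_of_diff _ charF _ d (f (g2 1 0) (pair_fun a b)).
  apply: (Pcl_diff fP); rewrite component_edge ?inE //.
  by rewrite nedges_g2.
by exists u => // T hT; rewrite /val2 e evq_pi // evC.
Qed.

Hypothesis f_sym : forall s G v, Pcl_act f s G v = f G v.

Lemma val2_swap p q m n T a b : \sum_i T i = - 'X -> homog p a -> homog q b ->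
  val2 f (g2 m n) T a b
  = (-1) ^+ (p && q) *: val2 f (g2 n m) (pt2 (T ord_max) (T ord0)) b a.
Proof.
move=> hT ha hb; pose s : 'S_2 := tperm ord0 ord_max.
rewrite {1}/val2 -(f_sym s^-1) evq_act //.
have s0 : s ord0 = ord_max by rewrite tpermL.
have s1 : s ord_max = ord0 by rewrite tpermR.
have eT : T \o s = pt2 (T ord_max) (T ord0).
  by apply/funext => i; case: (ord2P i) => ->; rewrite /= ?s0 ?s1.
have eG : relabel s^-1 (g2 m n) = g2 n m.
  by apply: graph2_ext; rewrite mult_relabelV ?s0 ?s1 ?g2_01 ?g2_10.
have hT' : \sum_i pt2 (T ord_max) (T ord0) i = - 'X by rewrite sum_pt2 -hT sum_ord2 addrC.
have fl := val2_linl (g2 n m) hT' fP; have fr := val2_linr (g2 n m) hT' fP.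
pose c : {ffun 'I_2 -> bool} := [ffun i => if i == ord0 then p else q].
have ev2 (b' : {ffun 'I_2 -> bool}) : evq (T \o s) (f (relabel s^-1 (g2 m n))
    (fun i => scomp U (b' (s i)) (pair_fun a b (s i)))) =
    if b' == c then val2 f (g2 n m) (pt2 (T ord_max) (T ord0)) b a else 0.
  rewrite eT eG [X in f _ X]pair_funE s0 s1 /= (scomp_homog _ ha) (scomp_homog _ hb).
  rewrite -/(val2 f (g2 n m) _ _ _).
  case: (b' =P c) => [->|ne]; first by rewrite !ffunE /= !eqxx.
  case: (b' ord_max =P q) => [e1|_]; last by rewrite (lin0 (fl _)).
  case: (b' ord0 =P p) => [e0|_]; last by rewrite (lin0 (fr _)).
  by case: ne; apply/ffunP => i; rewrite ffunE; case: (ord2P i) => ->.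
rewrite (bigD1 c) //= ev2 eqxx big1 ?addr0; last first.
  by move=> b' /negPf h; rewrite ev2 h scaler0.
congr (_ ^+ _ *: _); rewrite /perm_sign.
under eq_bigr do rewrite big_mkcond sum_nat_ord2.
rewrite sum_nat_ord2 /= tpermV -/s s0 s1 !ffunE /= !addn0 //.
Qed.

End Evaluation2.

(** * From Maurer-Cartan elements to Poisson vertex structures *)
Section ShiftedStructure.
Variables (F : fieldType) (U : superspace F) (d : {linear U -> U}).
Local Notation br := (br_at d).

(* The Poisson vertex axioms transported to the reversed parity, with the
   lambda-bracket evaluated at scalars. *)
Record is_shifted_PVA (A : U -> U -> U) (B : U -> U -> lpoly U 1) : Prop := IsShiftedPVA {
  sA_linl : forall b, linear (A^~ b);
  sA_linr : forall a, linear (A a);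
  sB_linl : forall b, linear (B^~ b);
  sB_linr : forall a, linear (B a);
  sA_par : forall p q a b, homog p a -> homog q b -> homog (~~ (p (+) q)) (A a b);
  sB_par : forall p q a b, homog p a -> homog q b ->
    forall m, homog (~~ (p (+) q)) (lpcoef m (B a b));
  sA_der : forall a b, d (A a b) = A (d a) b + A a (d b);
  sB_sesl : forall x a b, br B x%:P (d a) b = - x *: br B x%:P a b;
  sB_sesr : forall x a b, br B x%:P a (d b) = x *: br B x%:P a b + d (br B x%:P a b);
  sA_comm : forall p q a b, homog p a -> homog q b ->
    A a b = - ((-1) ^+ (p && q) *: A b a);
  sB_skew : forall p q a b x, homog p a -> homog q b ->
    br B x%:P a b = (-1) ^+ (p && q) *: br B (- 'X - x%:P) b a;
  s_assoc : forall p q r a b c, homog p a -> homog q b -> homog r c ->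
    A (A a b) c + (-1) ^+ p *: A a (A b c) = 0;
  s_leibniz : forall p q r x a b c, homog p a -> homog q b -> homog r c ->
    (-1) ^+ p *: br B x%:P a (A b c) - (-1) ^+ (q && r) *: A (br B x%:P a c) b
      + A (br B x%:P a b) c = 0;
  s_jacobi : forall p q r x y a b c, homog p a -> homog q b -> homog r c ->
    (-1) ^+ p *: br B x%:P a (br B y%:P b c)
      + (-1) ^+ (q (+) (p && q)) *: br B y%:P b (br B x%:P a c)
      + br B (x + y)%:P (br B x%:P a b) c = 0 }.

End ShiftedStructure.

Section FromMC.
Variables (F : fieldType) (charF : [pchar F] =i pred0).
Variables (U : superspace F) (d : {linear U -> U}) (d_even : even_map d).
Variables (f : cochain d 2) (fP : in_Pcl f) (f_odd : has_parity true f).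
Hypothesis f_sym : forall s G v, Pcl_act f s G v = f G v.
Hypothesis f_box : forall G v, box (n := 1) f f G v = 0.
Local Notation br := (br_at d).

(** On the graph with one edge the polynomial is constant ([q2_arrow]), so its constant coefficient
    keeps all the information. *)
Definition MC_mul (a b : U) : U := lpcoef mone (q2_eval (f arrow_graph (pair_fun a b))).
Definition MC_br (a b : U) : lpoly U 1 := q2_eval (f (empty_graph 2) (pair_fun a b)).

Lemma q2_arrow a b :
  q2_eval (f arrow_graph (pair_fun a b)) = lpC 1 (MC_mul a b) /\
  forall T, \sum_i T i = - 'X -> val2 f (g2 1 0) T a b = MC_mul a b.
Proof.
have [u e hu] := val2_const charF fP a b.
have E : q2_eval (f arrow_graph (pair_fun a b)) = lpC 1 u.
  apply: (lpoly1_inj charF (d := d)) => x.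
  rewrite arrow_g2 e ev_q2 evq_pi ?evC // sum_pt2.
  by rewrite addrC subrK.
have Eu : MC_mul a b = u by rewrite /MC_mul E lpcoef_mono eqxx.
by rewrite Eu.
Qed.

Lemma val2_arrow T a b : \sum_i T i = - 'X -> val2 f (g2 1 0) T a b = MC_mul a b.
Proof. exact: (q2_arrow a b).2. Qed.

Lemma val2_rev_arrow T a b : \sum_i T i = - 'X ->
  val2 f (g2 0 1) T a b = - MC_mul a b.
Proof. by move=> hT; rewrite val2_rev // val2_arrow. Qed.

Lemma br_MC P a b : br MC_br P a b = val2 f (g2 0 0) (pt2 P (- 'X - P)) a b.
Proof. by rewrite /br_at /MC_br ev_q2 empty_g2. Qed.

Lemma sum_pt2X (P : {poly F}) : \sum_i pt2 P (- 'X - P) i = - 'X.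
Proof. by rewrite sum_pt2 addrC subrK. Qed.

Lemma MC_mul_par p q a b : homog p a -> homog q b -> homog (~~ (p (+) q)) (MC_mul a b).
Proof.
move=> ha hb; rewrite -(@val2_arrow (pt2 0 (- 'X - 0))) ?sum_pt2X //.
have -> : ~~ (p (+) q) = true (+) \big[addb/false]_(i < 2) (pt2 p q i).
  by rewrite !big_ord_recl big_ord0 /= addbF.
apply: homog_evq; rewrite ?sum_pt2X //; apply: f_odd => i.
by case: (ord2P i) => ->.
Qed.

Lemma br_MC_par p q x a b : homog p a -> homog q b ->
  homog (~~ (p (+) q)) (br MC_br x%:P a b).
Proof.
move=> ha hb; rewrite br_MC.
have -> : ~~ (p (+) q) = true (+) \big[addb/false]_(i < 2) (pt2 p q i).
  by rewrite !big_ord_recl big_ord0 /= addbF.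
apply: homog_evq; rewrite ?sum_pt2X //; apply: f_odd => i.
by case: (ord2P i) => ->.
Qed.

Lemma br_MC_linl P b : linear ((br MC_br P)^~ b).
Proof. by move=> c x y; rewrite !br_MC (val2_linl _ (sum_pt2X P) fP). Qed.

Lemma br_MC_linr P a : linear (br MC_br P a).
Proof. by move=> c x y; rewrite !br_MC (val2_linr _ (sum_pt2X P) fP). Qed.

Lemma MC_mul_linl b : linear (MC_mul^~ b).
Proof.
have h := sum_pt2X 0.
by move=> c x y; rewrite -!(val2_arrow _ _ h) (val2_linl _ h fP).
Qed.

Lemma MC_mul_linr a : linear (MC_mul a).
Proof.
have h := sum_pt2X 0.
by move=> c x y; rewrite -!(val2_arrow _ _ h) (val2_linr _ h fP).
Qed.

Lemma br_MC_skew p q P a b : homog p a -> homog q b ->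
  br MC_br P a b = (-1) ^+ (p && q) *: br MC_br (- 'X - P) b a.
Proof.
move=> ha hb; rewrite !br_MC (val2_swap fP f_sym _ _ (sum_pt2X P) ha hb) /=.
by rewrite (_ : - 'X - (- 'X - P) = P) //; ring.
Qed.

Lemma MC_mul_comm p q a b : homog p a -> homog q b ->
  MC_mul a b = - ((-1) ^+ (p && q) *: MC_mul b a).
Proof.
move=> ha hb; have h := sum_pt2X 0; have h' : \sum_i pt2 (- 'X - 0) 0 i = - ('X : {poly F}).
  by rewrite sum_pt2 subrK.
rewrite -(val2_arrow a b h) (val2_swap fP f_sym _ _ h ha hb).
by rewrite val2_rev_arrow ?scalerN.
Qed.

Section BoxTerms.
Variables (T : 'I_3 -> {poly F}) (hT : \sum_i T i = - 'X).
Variables (G : graph 3) (a1 a2 c : 'I_3) (s : bool) (x : F).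
Hypothesis sumT : T a1 + T a2 + T c = - 'X.

Lemma box_term0 (w : 'I_3 -> U) i : i \in [:: a1; a2; c] -> w i = 0 ->
  box_term f T G a1 a2 c s x w = 0.
Proof.
have h2 : \sum_i pt2 (T a1 + T a2) (T c) i = - 'X by rewrite sum_pt2.
have hi := sum_inner_point s x.
have l0 := lin0 (val2_linl _ h2 fP _); have r0 := lin0 (val2_linr _ h2 fP _).
have il0 := lin0 (val2_linl _ hi fP _); have ir0 := lin0 (val2_linr _ hi fP _).
rewrite !inE /box_term => /or3P[] /eqP-> ->; rewrite ?il0 ?ir0 ?l0 ?r0 //.
Qed.

End BoxTerms.

Definition tri (R : Type) (x y z : R) : 'I_3 -> R := tnth [tuple x; y; z].

Lemma triE (R : Type) (x y z : R) :
  (tri x y z k0 = x) * (tri x y z k1 = y) * (tri x y z k2 = z).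
Proof. by []. Qed.

(** For homogeneous arguments every choice of parities other than (p, q, r) puts a zero into some
    argument of each term. *)
Lemma box_homog (T : 'I_3 -> {poly F}) (hT : \sum_i T i = - 'X) G s0 s1 s2 x0 x1 x2
    p q r a b c :
  homog p a -> homog q b -> homog r c ->
  box_point T G k1 k2 k0 s0 x0 -> box_point T G k0 k2 k1 s1 x1 ->
  box_point T G k0 k1 k2 s2 x2 ->
  (-1) ^+ (p && (q (+) r)) *: box_term f T G k1 k2 k0 s0 x0 (tri a b c)
    + (-1) ^+ (q && r) *: box_term f T G k0 k2 k1 s1 x1 (tri a b c)
    + box_term f T G k0 k1 k2 s2 x2 (tri a b c) = 0.
Proof.
move=> ha hb hc h0 h1 h2.
have h012 := hT; rewrite sum_ord3 in h012.
have h120 : T k1 + T k2 + T k0 = - 'X by rewrite -h012; ring.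
have h021 : T k0 + T k2 + T k1 = - 'X by rewrite -h012; ring.
have := box_ev fP d_even f_odd hT (tri a b c) h0 h1 h2.
rewrite f_box evq0 // (bigD1 [ffun i => tri p q r i]) //= big1 ?addr0.
  rewrite !ffunE !triE.
  have -> : (fun i => scomp U ([ffun i => tri p q r i] i) (tri a b c i)) = tri a b c.
    by apply/funext => i; rewrite ffunE; case: (ord3P i) => ->; rewrite !triE.
  by move=> <-.
move=> B nB; have [i hi] : exists i, B i != tri p q r i.
  apply/existsP; apply: contraNT nB; rewrite negb_exists => /forallP h.
  by apply/eqP/ffunP => i; rewrite ffunE; apply/eqP; have := h i; rewrite negbK.
have w0 : scomp U (B i) (tri a b c i) = 0.
  have hh : homog (tri p q r i) (tri a b c i) by case: (ord3P i) => ->; rewrite !triE.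
  by rewrite (scomp_homog _ hh) (negPf hi).
rewrite !(box_term0 _ _ _ _ (i := i)) ?scaler0 ?addr0 //;
  by case: (ord3P i) => ->.
Qed.

End FromMC.

Section FromMC.
Variables (F : fieldType) (charF : [pchar F] =i pred0).
Variables (U : superspace F) (d : {linear U -> U}) (d_even : even_map d).
Variables (f : cochain d 2) (fP : in_Pcl f) (f_odd : has_parity true f).
Hypothesis f_sym : forall s G v, Pcl_act f s G v = f G v.
Local Notation br := (br_at d).
Local Notation A := (MC_mul f).
Local Notation B := (MC_br f).

Lemma val2_empty T a b : \sum_i T i = - 'X -> val2 f (g2 0 0) T a b = br B (T ord0) a b.
Proof.
rewrite sum_ord2 br_MC => hT; congr val2; apply/funext => i.
case: (ord2P i) => -> //=; rewrite /pt2 /= -hT; ring.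
Qed.

(** Serves when the second coordinate is the scalar one: skewsymmetry makes it the parameter of the
    bracket. *)
Lemma val2_empty_swap p q T a b : \sum_i T i = - 'X -> homog p a -> homog q b ->
  val2 f (g2 0 0) T a b = (-1) ^+ (p && q) *: br B (T ord_max) b a.
Proof.
move=> hT ha hb; rewrite (val2_swap fP f_sym _ _ hT ha hb) val2_empty //.
by rewrite sum_pt2 -hT sum_ord2 addrC.
Qed.

Hypothesis f_box : forall G v, box (n := 1) f f G v = 0.

Lemma MC_shifted : is_shifted_PVA d A B.
Proof.
have hX := sum_pt2X.
have bpar p q x a b : homog p a -> homog q b -> homog (~~ (p (+) q)) (br B x%:P a b).
  exact: br_MC_par.
have apar p q a b : homog p a -> homog q b -> homog (~~ (p (+) q)) (A a b).
  exact: MC_mul_par.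
have arr := val2_arrow charF fP.
have rarr := val2_rev_arrow charF fP.
split.
- exact: (MC_mul_linl charF fP).
- exact: (MC_mul_linr charF fP).
- move=> b k x y; apply: (lpoly1_inj charF (d := d)) => z.
  by rewrite raddfD /= evZ; apply: (br_MC_linl fP).
- move=> a k x y; apply: (lpoly1_inj charF (d := d)) => z.
  by rewrite raddfD /= evZ; apply: (br_MC_linr fP).
- exact: apar.
- by move=> p q a b ha hb; apply: (homog_lpcoef charF d_even) => x; rewrite scal1; apply: bpar.
- move=> a b; rewrite -!(val2_arrow charF fP _ _ (hX _ 0)).
  by rewrite val2_sesqui_edge ?nedges_g2.
- move=> x a b; rewrite !br_MC.
  have [-> _] := val2_sesqui_empty (hX _ x%:P) fP a b (nedges_g2 0 0).
  by rewrite /pt2 /= pactC scaleNr.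
- move=> x a b; rewrite !br_MC.
  have [_ ->] := val2_sesqui_empty (hX _ x%:P) fP a b (nedges_g2 0 0).
  by rewrite /pt2 /= pactD !pactN pactC pactX opprD !opprK addrC.
- exact: (MC_mul_comm charF fP f_sym).
- by move=> p q a b x; exact: (br_MC_skew fP f_sym).
- move=> p q r a b c ha hb hc.
  (* For the path k0 -> k1 -> k2 the ends are the free vertices of the two blocks that contain the
     centre, so the nonscalar coordinate sits at the centre. The block of the two ends contributes
     0, its outer graph having two edges. Products do not depend on the point, whence the scalars
     0. *)
  pose G : graph 3 := mkgraph (fun i j =>
    (((i == k0) && (j == k1)) || ((i == k1) && (j == k2))) : nat).
  pose T := tri (0%:P) (- 'X) (0%:P) : 'I_3 -> {poly F}.
  have hT : \sum_i T i = - 'X by rewrite sum_ord3 /T !triE; ring.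
  have h0 : box_point T G k1 k2 k0 true 0.
    by rewrite /box_point /emult !mult_mkgraph /T /= ?triE.
  have h1 : box_point T G k0 k2 k1 true 0 by rewrite /box_point /emult !mult_mkgraph.
  have h2 : box_point T G k0 k1 k2 false 0.
    by rewrite /box_point /emult !mult_mkgraph /T /= ?triE.
  have := box_homog d_even fP f_odd f_box hT ha hb hc h0 h1 h2.
  rewrite /box_term !mult_mkgraph /T !triE /= ?add0n ?addn0.
  rewrite [X in _ + _ *: X + _](val2_big fP) ?nedges_g2 ?sum_pt2 //; last by ring.
  rewrite !arr ?rarr ?sum_inner_point // ?sum_pt2 //; try ring.
  (* The edge k0 -> k1 leaves the outer vertex, which gives a reversed edge and a minus sign; it
     cancels the one of commutativity in the reversed parity. *)
  rewrite (MC_mul_comm charF fP f_sym (apar _ _ _ _ hb hc) ha) opprK scalerA -signr_addb.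
  rewrite scaler0 addr0 addrC => <-; congr (_ + _ ^+ _ *: _).
  by case: (p); case: (q); case: (r).
- move=> p q r x a b c ha hb hc.
  (* With the single edge k1 -> k2 the free vertices can be taken to be k1 for its own edge and k0
     for the other two blocks, so k2 carries the nonscalar coordinate. The scalar 0 at k1 affects
     only products; x at k0 becomes the parameter of all brackets. *)
  pose G : graph 3 := mkgraph (fun i j => ((i == k1) && (j == k2)) : nat).
  pose T := tri (x%:P) (0%:P) (- 'X - x%:P) : 'I_3 -> {poly F}.
  have hT : \sum_i T i = - 'X by rewrite sum_ord3 /T !triE; ring.
  have h0 : box_point T G k1 k2 k0 false 0.
    by rewrite /box_point /emult !mult_mkgraph /T /= ?triE.
  have h1 : box_point T G k0 k2 k1 false x.
    by rewrite /box_point /emult !mult_mkgraph /T /= ?triE.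
  have h2 : box_point T G k0 k1 k2 false x.
    by rewrite /box_point /emult !mult_mkgraph /T /= ?triE.
  have := box_homog d_even fP f_odd f_box hT ha hb hc h0 h1 h2.
  rewrite /box_term !mult_mkgraph /T !triE /= ?add0n ?addn0.
  rewrite !arr ?rarr ?sum_inner_point // ?sum_pt2 //; try ring.
  rewrite (val2_empty_swap _ (apar _ _ _ _ hb hc) ha) ?sum_pt2; last by ring.
  rewrite !val2_empty ?sum_pt2; try ring.
  rewrite scalerA -signr_addb scalerN /pt2 /= => <-.
  congr (_ ^+ _ *: _ - _ + _).
  by case: (p); case: (q); case: (r).
- move=> p q r x y a b c ha hb hc.
  (* Without edges every vertex is free; x and y become lambda and mu, and k2 takes the remaining
     coordinate. *)
  pose G : graph 3 := empty_graph 3.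
  pose T := tri (x%:P) (y%:P) (- 'X - x%:P - y%:P) : 'I_3 -> {poly F}.
  have hT : \sum_i T i = - 'X by rewrite sum_ord3 /T !triE; ring.
  have h0 : box_point T G k1 k2 k0 false y.
    by rewrite /box_point /emult !mult_mkgraph /T /= ?triE.
  have h1 : box_point T G k0 k2 k1 false x.
    by rewrite /box_point /emult !mult_mkgraph /T /= ?triE.
  have h2 : box_point T G k0 k1 k2 false x.
    by rewrite /box_point /emult !mult_mkgraph /T /= ?triE.
  have := box_homog d_even fP f_odd f_box hT ha hb hc h0 h1 h2.
  rewrite /box_term !mult_mkgraph /T !triE /= ?add0n ?addn0.
  rewrite (@val2_empty _ b c) ?(@val2_empty _ a c) ?(@val2_empty _ a b) ?sum_pt2; try ring.
  rewrite (val2_empty_swap _ (bpar _ _ y _ _ hb hc) ha) ?sum_pt2; last by ring.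
  rewrite (val2_empty_swap _ (bpar _ _ x _ _ ha hc) hb) ?sum_pt2; last by ring.
  rewrite val2_empty ?sum_pt2; last by ring.
  rewrite !scalerA -!signr_addb /pt2 /= polyCD => <-.
  congr (_ ^+ _ *: _ + _ ^+ _ *: _ + _).
    by case: (p); case: (q); case: (r).
  by case: (p); case: (q); case: (r).
Qed.

End FromMC.

(** * From Poisson vertex structures to Maurer-Cartan elements *)
Section ToMC.
Variables (F : fieldType) (charF : [pchar F] =i pred0).
Variables (U : superspace F) (d : {linear U -> U}) (d_even : even_map d).
Variables (A : U -> U -> U) (B : U -> U -> lpoly U 1).
Hypothesis AB : is_shifted_PVA d A B.
Local Notation br := (br_at d).

Definition lpembed (p : lpoly U 1) : lpoly U 2 := lpsubst (fun=> lpvar ord0) p.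

Lemma ev_embed (T : 'I_2 -> {poly F}) p : ev d T (lpembed p) = ev d (fun=> T ord0) p.
Proof. by apply: ev_subst => i q; rewrite ev_var. Qed.

(** All values are forced: acyclicity gives 0 on two or more edges, the cycle relation gives the
    sign of a reversed edge, and without edges the class has a representative in the first variable
    alone. *)
Definition MC_of : cochain d 2 := fun G v =>
  match nedges G with
  | 0 => qpi d (lpembed (B (v ord0) (v ord_max)))
  | 1 => qpi d (lpC 2 ((-1) ^+ mult G (ord_max, ord0) *: A (v ord0) (v ord_max)))
  | _ => 0
  end.

Definition MC_val2 (G : graph 2) (T : 'I_2 -> {poly F}) (a b : U) : U :=
  match nedges G with
  | 0 => br B (T ord0) a b
  | 1 => (-1) ^+ mult G (ord_max, ord0) *: A a b
  | _ => 0
  end.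

Lemma evq_MC_of T G v : \sum_i T i = - 'X ->
  evq T (MC_of G v) = MC_val2 G T (v ord0) (v ord_max).
Proof.
move=> hT; rewrite /MC_of /MC_val2; case: (nedges G) => [|[|n]].
- by rewrite evq_pi // ev_embed.
- by rewrite evq_pi // evC.
- by rewrite evq0.
Qed.

Lemma br_at_linl P b : linear ((br B P)^~ b).
Proof. by move=> c x y; rewrite /br_at (sB_linl AB) raddfD /= evZ. Qed.

Lemma br_at_linr P a : linear (br B P a).
Proof. by move=> c x y; rewrite /br_at (sB_linr AB) raddfD /= evZ. Qed.

Lemma MC_val2_linl G T b : linear ((MC_val2 G T)^~ b).
Proof.
move=> c x y; rewrite /MC_val2; case: (nedges G) => [|[|n]].
- exact: br_at_linl.
- by rewrite (sA_linl AB) scalerDr !scalerA mulrC.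
- by rewrite scaler0 addr0.
Qed.

Lemma MC_val2_linr G T a : linear (MC_val2 G T a).
Proof.
move=> c x y; rewrite /MC_val2; case: (nedges G) => [|[|n]].
- exact: br_at_linr.
- by rewrite (sA_linr AB) scalerDr !scalerA mulrC.
- by rewrite scaler0 addr0.
Qed.

Lemma br_par p q x a b : homog p a -> homog q b -> homog (~~ (p (+) q)) (br B x%:P a b).
Proof. by move=> ha hb; apply: homog_ev => // m; exact: (sB_par AB). Qed.

Lemma MC_of_odd : has_parity true MC_of.
Proof.
move=> G b v hv; rewrite !big_ord_recl big_ord0 /= addbF.
rewrite (_ : lift ord0 ord0 = ord_max); last exact: val_inj.
have h0 := hv ord0; have h1 := hv ord_max.
rewrite /MC_of; case: (nedges G) => [|[|n]].
- exists (lpembed (B (v ord0) (v ord_max))) => //.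
  apply: (homog_lpcoef charF d_even) => x; rewrite ev_embed /=; exact: br_par.
- eexists; first by [].
  move=> m; rewrite lpcoef_mono /homog raddfMn /= linearZ /=; congr (_ *: _ *+ _).
  exact: (sA_par AB).
- by exists 0 => [|m]; rewrite ?qpi0 // /homog !raddf0.
Qed.

(** One step cannot be closed without a tadpole, three steps would need three edges, and two
    oriented steps must use the two opposite edges; only the starting point remains free. *)
Lemma oriented_cycle2 (G : graph 2) s : oriented_cycle G s -> nedges G = 2 ->
  [/\ mult G (ord0, ord_max) = 1%N, mult G (ord_max, ord0) = 1%N &
    s = [:: ((ord0, ord_max), false); ((ord_max, ord0), false)] \/
    s = [:: ((ord_max, ord0), false); ((ord0, ord_max), false)] ].
Proof.
case=> s0 ors [i tr] n2.
have st (a : step 2) : a \in s -> a = ((ord0, ord_max), false) \/ a = ((ord_max, ord0), false).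
  move=> ha; have ha2 := allP ors _ ha; have := mult2_cases (trail_mult tr ha).
  by case: a ha2 {ha} => e [] //= _ [] ->; [left|right].
have cnt e : (count_mem e (map fst s) <= mult G e)%N.
  by case/andP: tr => _ /forallP.
case/andP: (tr) => wk _.
case: s s0 st cnt wk {ors tr} => [//|a [|b [|c s]]] _ st cnt wk.
- by case: (st a (mem_head _ _)) wk => -> /=; rewrite /step_src /step_tgt /=; case: (ord2P i) => ->.
- have ha := st a (mem_head _ _).
  have hb := st b; rewrite !inE eqxx orbT in hb; have {}hb := hb isT.
  have c1 := cnt (ord0, ord_max); have c2 := cnt (ord_max, ord0).
  move: n2; rewrite /nedges => n2.
  case: ha hb wk c1 c2 => -> [] -> /=; rewrite /step_src /step_tgt /= ?andbF //= => _.
    by move: (mult G _) (mult G _) n2 => [|[|[|?]]] [|[|[|?]]] //= _ _ _; split=> //; left.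
  by move: (mult G _) (mult G _) n2 => [|[|[|?]]] [|[|[|?]]] //= _ _ _; split=> //; right.
- exfalso.
  have h1 : (3 <= count_mem (ord0, ord_max) (map fst [:: a, b, c & s])
     + count_mem (ord_max, ord0) (map fst [:: a, b, c & s]))%N.
    have one x : x \in [:: a, b, c & s] -> ((x.1 == (ord0, ord_max)) + (x.1 == (ord_max, ord0)) = 1)%N.
      by case/st => ->.
    have oa : ((a.1 == (ord0, ord_max)) + (a.1 == (ord_max, ord0)) = 1)%N.
      by apply: one; rewrite !inE eqxx.
    have ob : ((b.1 == (ord0, ord_max)) + (b.1 == (ord_max, ord0)) = 1)%N.
      by apply: one; rewrite !inE eqxx orbT.
    have oc : ((c.1 == (ord0, ord_max)) + (c.1 == (ord_max, ord0)) = 1)%N.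
      by apply: one; rewrite !inE eqxx !orbT.
    rewrite /=; move: (nat_of_bool (a.1 == _)) (nat_of_bool (a.1 == _)) oa.
    move: (nat_of_bool (b.1 == _)) (nat_of_bool (b.1 == _)) ob.
    move: (nat_of_bool (c.1 == _)) (nat_of_bool (c.1 == _)) oc.
    move: (count_mem _ _) (count_mem _ _); lia.
  have := leq_add (cnt (ord0, ord_max)) (cnt (ord_max, ord0)).
  rewrite -/(nedges G) n2 => /(leq_trans h1). by [].
Qed.

End ToMC.

Section ToMC.
Variables (F : fieldType) (charF : [pchar F] =i pred0).
Variables (U : superspace F) (d : {linear U -> U}) (d_even : even_map d).
Variables (A : U -> U -> U) (B : U -> U -> lpoly U 1).
Hypothesis AB : is_shifted_PVA d A B.
Local Notation br := (br_at d).
Local Notation X := (MC_of d A B).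
Local Notation pt x := (qpoint (ord_max : 'I_2) x).

Let ptS (x : 'I_2 -> F) : \sum_i pt x i = - 'X := sum_qpoint _ x.

Lemma qpoint2 (x : 'I_2 -> F) : pt x = pt2 (x ord0)%:P (- 'X - (x ord0)%:P).
Proof.
apply/funext => i; rewrite /qpoint /pt2; case: (ord2P i) => -> //=.
by rewrite (big_pred1 ord0) // => j; case: (ord2P j) => ->.
Qed.

Lemma MC_of_lin : multilinear X.
Proof.
move=> G v i c x y; apply: (evq_inj charF (i0 := ord_max)) => z.
rewrite evqD // evqZ // !evq_MC_of //; case: (ord2P i) => -> /=.
  by rewrite (MC_val2_linl AB).
by rewrite (MC_val2_linr AB).
Qed.

Lemma MC_of_in_Pcl : in_Pcl X.
Proof.
split.
- exact: MC_of_lin.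
- move=> G v nac; rewrite /MC_of.
  have : ~~ (nedges G <= 1)%N by apply/negP => /acyclic2P.
  by case: (nedges G) => [|[|n]].
- move=> G v s cyc; apply: (evq_inj charF (i0 := ord_max)) => z.
  rewrite evq0 // evq_sum //.
  (* With two edges the relation is A - A = 0. With more, deleting one leaves at least two and every
     term is 0; with fewer, there is no cycle. *)
  have [n2|n2] := eqVneq (nedges G) 2.
    have [m01 m10] := oriented_cycle2 cyc n2.
    have e01 : del_edge G (ord0, ord_max) = g2 0 1.
      by apply: graph2_ext; rewrite mult_mkgraph /= ?m01 ?m10 ?g2_01 ?g2_10.
    have e10 : del_edge G (ord_max, ord0) = g2 1 0.
      by apply: graph2_ext; rewrite mult_mkgraph /= ?m01 ?m10 ?g2_01 ?g2_10.
    have v01 : MC_val2 d A B (g2 0 1) (pt z) (v ord0) (v ord_max) = - A (v ord0) (v ord_max).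
      by rewrite /MC_val2 nedges_g2 g2_10 /= expr1 scaleN1r.
    have v10 : MC_val2 d A B (g2 1 0) (pt z) (v ord0) (v ord_max) = A (v ord0) (v ord_max).
      by rewrite /MC_val2 nedges_g2 g2_10 /= expr0 scale1r.
    case=> ->; rewrite !big_cons big_nil /= e01 e10 !evq_MC_of // v01 v10 addr0.
      exact: addNr.
    exact: addrN.
  apply: big1_seq => a /andP[_ ha]; rewrite evq_MC_of //.
  have nG : (nedges G = nedges (del_edge G a.1) + 1)%N.
    have [_ _ [i tr]] := cyc; have h := trail_mult tr ha.
    have := h; case: (mult2_cases h) => -> h';
      rewrite /nedges !mult_mkgraph /= subn0.
      by rewrite addnAC subnK.
    by rewrite -addnA subnK.
  have n1 : nedges G <> 1%N.
    have [s0 _ [i tr]] := cyc => n1.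
    have /acyclic2P ac : (nedges G <= 1)%N by rewrite n1.
    by rewrite (ac _ _ tr) in s0.
  move: n1 n2; rewrite /MC_val2 nG.
  by case: (nedges (del_edge G a.1)) => [|[|n]].
- move=> G v i j; have [h0|h0] := posnP (nedges G).
    rewrite component_empty // inE => /eqP->.
    by rewrite -[X G v]qreprK qmap_diff_eq0.
  move=> _; move: h0; rewrite /MC_of; case: (nedges G) => [//|[|n]] _.
    by apply: qmap_diff_eq0; rewrite !lpdiffU !cm1 !mulr0n !raddf0.
  by rewrite -[in LHS](qpi0 d 2) qmap_diff_eq0 // !raddf0.
- move=> G v i0; apply: (evq_inj charF (i0 := ord_max)) => z.
  rewrite evqN // evq_map // evq_sum // (raddf_sum (ev d (pt z))) /=.
  under [in RHS]eq_bigr do rewrite ev_var -/(evq _ _) evq_MC_of //.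
  under eq_bigr do rewrite evq_MC_of //.
  rewrite qpoint2; set x := z ord0; set a := v ord0; set b := v ord_max.
  have [h0|h0] := posnP (nedges G).
    rewrite component_empty // !big_set1 /MC_val2 h0.
    case: (ord2P i0) => -> /=; rewrite -/a -/b /pt2 /=.
      by rewrite (sB_sesl AB) pactC scaleNr.
    by rewrite (sB_sesr AB) pactD !pactN pactC pactX opprD !opprK addrC.
  rewrite component_edge // !sum_setT2 -/a -/b -pactD -sum_ord2 sum_pt2X pactN pactX opprK.
  rewrite /MC_val2; move: h0; case: (nedges G) => [//|[|n]] _ /=.
    by rewrite linearZ /= (sA_der AB) scalerDr.
  by rewrite linear0 addr0.
Qed.

Lemma MC_of_sym s G v : Pcl_act X s G v = X G v.
Proof.
apply: (evq_inj charF (i0 := ord_max)) => z.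
rewrite -[s]invgK evq_act //.
have XD u i x y : evq (pt z) (X G [eta u with i |-> x + y])
    = evq (pt z) (X G [eta u with i |-> x]) + evq (pt z) (X G [eta u with i |-> y]).
  by have := MC_of_lin G u i 1 x y; rewrite !scale1r => ->; rewrite evqD.
(* The right side is expanded over parities as well, so that the two sums can be compared term by
   term. *)
rewrite -(sum_scomp (M := fun v => evq (pt z) (X G v)) v XD).
apply: eq_bigr => b _; set t := s^-1%g.
have tS : \sum_i (pt z \o t) i = - 'X.
  by rewrite -(ptS z) [RHS](reindex_inj (@perm_inj _ t)).
rewrite evq_MC_of; last exact: tS.
rewrite evq_MC_of // /= /perm_sign.
have h01 : t ord0 = ord0 /\ t ord_max = ord_max \/ t ord0 = ord_max /\ t ord_max = ord0.
  have : t ord0 != t ord_max by rewrite (inj_eq perm_inj).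
  by case: (ord2P (t ord0)) => ->; case: (ord2P (t ord_max)) => ->; [|left|right|].
rewrite sum_nat_ord2 !(big_mkcond (fun _ => _ && _)) !sum_nat_ord2 /=.
have hw c : homog (b c) (scomp U (b c) (v c)) := homog_scomp _ _.
case: h01 => -[t0 t1].
  have tV0 : (t^-1)%g ord0 = ord0 by rewrite -{1}t0 permK.
  have tV1 : (t^-1)%g ord_max = ord_max by rewrite -{1}t1 permK.
  rewrite t0 t1 tV0 tV1 /= ?addn0 expr0 scale1r /MC_val2.
  have -> : nedges (relabel t^-1 G) = nedges G.
    by rewrite /nedges !mult_relabelV t0 t1.
  by rewrite !mult_relabelV t0 t1 /= t0.
have tV0 : (t^-1)%g ord0 = ord_max by rewrite -{1}t1 permK.
have tV1 : (t^-1)%g ord_max = ord0 by rewrite -{1}t0 permK.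
rewrite t0 t1 tV0 tV1 /= ?addn0 ?add0n /MC_val2.
have -> : nedges (relabel t^-1 G) = nedges G.
  by rewrite /nedges !mult_relabelV t0 t1 addnC.
rewrite !mult_relabelV t0 t1 /= t0.
case nG : (nedges G) => [|[|n]].
- rewrite qpoint2 /pt2 /= (sB_skew AB _ (hw ord0) (hw ord_max)).
  by rewrite ?addn0 andbC.
(* The transposition reverses the edge; the resulting change of sign is the minus sign in
   [sA_comm]. *)
- rewrite (sA_comm AB (hw ord0) (hw ord_max)) scalerN !scalerA mulrC.
  move: nG; rewrite /nedges.
  case: (mult G (ord0, ord_max)) => [|[|?]]; case: (mult G (ord_max, ord0)) => [|[|?]] //= _;
    by rewrite ?expr0 ?expr1 ?mul1r ?mulN1r ?scaleNr ?opprK.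
- by rewrite scaler0.
Qed.

End ToMC.

Arguments qpoint : simpl never.

Lemma emult0 n (G : graph n) i j : emult G i j = 0%N ->
  mult G (i, j) = 0%N /\ mult G (j, i) = 0%N.
Proof. by move/eqP; rewrite addn_eq0 => /andP[/eqP-> /eqP->]. Qed.

Lemma emult1 n (G : graph n) i j : emult G i j = 1%N ->
  exists o : bool, mult G (i, j) = ~~ o /\ mult G (j, i) = o.
Proof.
rewrite /emult; case: (mult G (i, j)) => [|[|?]]; case: (mult G (j, i)) => [|[|?]] // _;
  by [exists true|exists false].
Qed.

Lemma emultC n (G : graph n) i j : emult G i j = emult G j i.
Proof. exact: addnC. Qed.

(** * Vanishing of the box square, graph by graph *)

Section ToMC.
Variables (F : fieldType) (charF : [pchar F] =i pred0).
Variables (U : superspace F) (d : {linear U -> U}) (d_even : even_map d).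
Variables (A : U -> U -> U) (B : U -> U -> lpoly U 1).
Hypothesis AB : is_shifted_PVA d A B.
Local Notation br := (br_at d).
Local Notation X := (MC_of d A B).

Let XP : in_Pcl X := MC_of_in_Pcl charF AB.
Let X_odd : has_parity true X := MC_of_odd charF d_even AB.

Lemma val2_MC_of00 T a b : \sum_i T i = - 'X -> val2 X (g2 0 0) T a b = br B (T ord0) a b.
Proof. by move=> hT; rewrite /val2 evq_MC_of // /MC_val2 nedges_g2. Qed.

Lemma val2_MC_of_edge (o : bool) T a b : \sum_i T i = - 'X ->
  val2 X (g2 (~~ o) o) T a b = (-1) ^+ o *: A a b.
Proof.
move=> hT; rewrite /val2 evq_MC_of // /MC_val2 nedges_g2 g2_10.
by case: o.
Qed.

Lemma val2_MC_of_edgeN (o : bool) T a b : \sum_i T i = - 'X ->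
  val2 X (g2 o (~~ o)) T a b = (-1) ^+ (~~ o) *: A a b.
Proof. by move=> hT; have := val2_MC_of_edge (~~ o) a b hT; rewrite negbK. Qed.

Definition box_sum (T : 'I_3 -> {poly F}) G s0 s1 s2 x0 x1 x2 p q r a b c : U :=
  (-1) ^+ (p && (q (+) r)) *: box_term X T G k1 k2 k0 s0 x0 (tri a b c)
    + (-1) ^+ (q && r) *: box_term X T G k0 k2 k1 s1 x1 (tri a b c)
    + box_term X T G k0 k1 k2 s2 x2 (tri a b c).

(** For each graph one fixes the nonscalar vertex [z] and, for every block, its free vertex. The
    indices i0, i1, i2 name the coordinates used there, uniformly in the point x. *)
Lemma box_eq0 z (s0 s1 s2 : bool) (i0 i1 i2 : 'I_3) (G : graph 3) v :
  (forall x : 'I_3 -> F, let T := qpoint z x in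
     [/\ box_point T G k1 k2 k0 s0 (x i0), box_point T G k0 k2 k1 s1 (x i1) &
         box_point T G k0 k1 k2 s2 (x i2)]) ->
  (forall (x : 'I_3 -> F) p q r a b c, homog p a -> homog q b -> homog r c ->
     box_sum (qpoint z x) G s0 s1 s2 (x i0) (x i1) (x i2) p q r a b c = 0) ->
  box (n := 1) X X G v = 0.
Proof.
move=> hp hs; apply: (evq_eq0 charF (i0 := z)) => x.
have hT := sum_qpoint z x; have [h0 h1 h2] := hp x.
rewrite (box_ev XP d_even X_odd hT v h0 h1 h2) big1 // => b _.
exact: (hs x _ _ _ _ _ _ (homog_scomp (b k0) (v k0)) (homog_scomp (b k1) (v k1))
  (homog_scomp (b k2) (v k2))).
Qed.

Lemma qpointE (z i : 'I_3) (x : 'I_3 -> F) : i != z -> qpoint z x i = (x i)%:P.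
Proof. by rewrite /qpoint => /negPf->. Qed.

(** The shifted axioms speak of scalar parameters, while a block containing [z] produces a bracket
    at - 'X - x. Skewsymmetry brings it back to x. *)
Lemma br_swap p q x P a b : P = - 'X - x%:P -> homog p a -> homog q b ->
  br B P a b = (-1) ^+ (p && q) *: br B x%:P b a.
Proof.
move=> -> ha hb; rewrite (sB_skew AB x hb ha) scalerA -signr_addb.
by rewrite andbC addbb expr0 scale1r.
Qed.

Section OnePoint.
Variables (z : 'I_3) (x : 'I_3 -> F) (G : graph 3).
Local Notation T := (qpoint z x).

Lemma sumT012 : T k0 + T k1 + T k2 = - 'X.
Proof. by rewrite -sum_ord3 sum_qpoint. Qed.
Lemma sumT021 : T k0 + T k2 + T k1 = - 'X.
Proof. by rewrite -sumT012; ring. Qed.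
Lemma sumT120 : T k1 + T k2 + T k0 = - 'X.
Proof. by rewrite -sumT012; ring. Qed.

Lemma box_term_outer a1 a2 c s y w : T a1 + T a2 + T c = - 'X ->
  (1 < emult G a1 c + emult G a2 c)%N -> box_term X T G a1 a2 c s y w = 0.
Proof.
by move=> hT h; rewrite /box_term (val2_big XP) ?sum_pt2 // nedges_g2 addnACA.
Qed.

Lemma box_term_inner a1 a2 c s y w : T a1 + T a2 + T c = - 'X ->
  (1 < emult G a1 a2)%N -> box_term X T G a1 a2 c s y w = 0.
Proof.
move=> hT h; rewrite /box_term (val2_big XP (G := g2 _ (mult G (a2, a1)))) ?sum_inner_point //.
  by rewrite (lin0 (val2_linl _ _ XP _)) // sum_pt2.
by rewrite nedges_g2.
Qed.

End OnePoint.

Section Lines.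
Variables (p q r : bool) (a b c : U).
Hypotheses (ha : homog p a) (hb : homog q b) (hc : homog r c).

(** With [s_assoc_last] and [s_assoc_mid], this writes the iterated products that occur as signs
    times [A a (A b c)], so that the path graphs reduce to identities between signs. *)
Lemma s_assoc_left : A (A a b) c = - ((-1) ^+ p *: A a (A b c)).
Proof. by apply/eqP; rewrite -addr_eq0; apply/eqP/(s_assoc AB ha hb hc). Qed.

Lemma s_assoc_last : A (A b c) a = - ((-1) ^+ (p && ~~ (q (+) r)) *: A a (A b c)).
Proof. by rewrite (sA_comm AB (sA_par AB hb hc) ha) andbC. Qed.
End Lines.

Lemma s_assoc_mid p q r a b c : homog p a -> homog q b -> homog r c ->
  A (A a c) b = (-1) ^+ (p (+) (q && r)) *: A a (A b c).
Proof.
move=> ha hb hc; rewrite (s_assoc_left ha hc hb) (sA_comm AB hc hb).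
by rewrite (linN (sA_linr AB a)) (linZ (sA_linr AB a)) scalerN opprK scalerA -signr_addb andbC.
Qed.

(* The vertex z of box_eq0, whose coordinate is not scalar, is chosen so that in
   each nonzero term the vertex of the block that is not joined to the third
   vertex has a scalar coordinate. *)
Lemma MC_of_box (G : graph 3) v : box (n := 1) X X G v = 0.
Proof.
have lZ e u w : A (e *: u) w = e *: A u w by exact: (linZ (sA_linl AB w)).
have bZ P e u w : br B P (e *: u) w = e *: br B P u w by exact: (linZ (br_at_linl AB P w)).
have hi := sum_inner_point.
(* A multiple edge makes the inner graph cyclic when its ends form the block, and the outer graph
   cyclic otherwise. A free vertex is still needed for the block of its ends, hence the test on
   [emult G k0 k2]. The next two cases are analogous. *)
have [h01|h01] := ltnP 1 (emult G k0 k1).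
  apply: (@box_eq0 k2 false false (emult G k0 k2 != 0%N) k0 k0
    (if emult G k0 k2 != 0%N then k1 else k0)) => [x T|x *].
    split; rewrite /box_point => le1.
    - by exfalso; move: le1 h01; rewrite (emultC G k1 k0); lia.
    - by exfalso; move: le1 h01; lia.
    case: eqP le1 => [e02|/eqP] /=; first by rewrite /T qpointE.
    by rewrite /T qpointE // => e02 le1; split=> //; move: e02 le1; lia.
  rewrite /box_sum (box_term_outer _ _ _ (sumT120 _ _)); last first.
    by rewrite (emultC G k1 k0); apply: ltn_addr.
  rewrite (box_term_outer _ _ _ (sumT021 _ _)); last exact: ltn_addr.
  by rewrite (box_term_inner _ _ _ (sumT012 _ _)) // !scaler0 !addr0.
have [h02|h02] := ltnP 1 (emult G k0 k2).
  apply: (@box_eq0 k1 false (emult G k0 k1 != 0%N) false k0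
    (if emult G k0 k1 != 0%N then k2 else k0) k0) => [x T|x *].
    split; rewrite /box_point => le1.
    - by exfalso; move: le1 h02; rewrite (emultC G k2 k0); lia.
    - case: eqP le1 => [e01|/eqP] /=; first by rewrite /T qpointE.
      by rewrite /T qpointE // => e01 le1; split=> //; move: e01 le1; lia.
    - by exfalso; move: le1 h02; lia.
  rewrite /box_sum (box_term_outer _ _ _ (sumT120 _ _)); last first.
    by rewrite (emultC G k2 k0); apply: ltn_addl.
  rewrite (box_term_inner _ _ _ (sumT021 _ _)) // (box_term_outer _ _ _ (sumT012 _ _)).
    by rewrite !scaler0 !addr0.
  exact: ltn_addr.
have [h12|h12] := ltnP 1 (emult G k1 k2).
  apply: (@box_eq0 k0 (emult G k1 k0 != 0%N) false false
    (if emult G k1 k0 != 0%N then k2 else k1) k0 k0) => [x T|x *].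
    split; rewrite /box_point => le1.
    - case: eqP le1 => [e01|/eqP] /=; first by rewrite /T qpointE.
      by rewrite /T qpointE // => e01 le1; split=> //; move: e01 le1; lia.
    - by exfalso; move: le1 h12; rewrite (emultC G k2 k1); lia.
    - by exfalso; move: le1 h12; lia.
  rewrite /box_sum (box_term_inner _ _ _ (sumT120 _ _)) // (box_term_outer _ _ _ (sumT021 _ _)).
    rewrite (box_term_outer _ _ _ (sumT012 _ _)); first by rewrite !scaler0 !addr0.
    exact: ltn_addl.
  by rewrite (emultC G k2 k1); apply: ltn_addl.
have C10 := emultC G k1 k0; have C20 := emultC G k2 k0; have C21 := emultC G k2 k1.
(* Each pair of vertices now has at most one edge. The eight cases are the empty graph, three single
   edges, three paths and the triangle; o and u record orientations. *)
move: h01 h02 h12; case e01: (emult G k0 k1) => [|[|//]] _;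
  case e02: (emult G k0 k2) => [|[|//]] _; case e12: (emult G k1 k2) => [|[|//]] _;
  rewrite ?e01 ?e02 ?e12 in C10 C20 C21.
- have [m01 m10] := emult0 e01.
  have [m02 m20] := emult0 e02.
  have [m12 m21] := emult0 e12.
  apply: (@box_eq0 k2 false false false k1 k0 k0) => [x T|x p q r a b c ha hb hc].
    by split=> le1; rewrite ?C10 ?C20 ?C21 ?e01 ?e02 ?e12 // in le1 *; rewrite /T qpointE.
  have hT := (sumT012 k2 x, sumT021 k2 x, sumT120 k2 x).
  rewrite /box_sum /box_term m01 m10 m02 m20 m12 m21 !triE ?(addn0, add0n).
  rewrite !val2_MC_of00 ?hi ?sum_pt2 ?hT // /inner_point /pt2 /=.
  rewrite (br_swap (x := x k0) _ (br_par d_even AB _ hb hc) ha); last first.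
    by rewrite -(qpointE (z := k2) x (i := k0)) // -(sumT120 k2 x) addrK.
  rewrite (br_swap (x := x k1) _ (br_par d_even AB _ ha hc) hb); last first.
    by rewrite -(qpointE (z := k2) x (i := k1)) // -(sumT021 k2 x) addrK.
  rewrite !qpointE // -polyCD.
  rewrite -[RHS](s_jacobi AB (x k0) (x k1) ha hb hc) !scalerA -!signr_addb.
  congr (_ ^+ _ *: _ + _ ^+ _ *: _ + _); first by case: (p); case: (q); case: (r).
  by case: (p); case: (q); case: (r).
(* Single edge between k1 and k2: the Leibniz rule for the bracket with [a]. The orientation is a
   common factor (-1)^o. *)
- have [m01 m10] := emult0 e01.
  have [m02 m20] := emult0 e02.
  have [o [m12 m21]] := emult1 e12.
  apply: (@box_eq0 k2 false false false k1 k0 k0) => [x T|x p q r a b c ha hb hc].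
    by split=> le1; rewrite ?C10 ?C20 ?C21 ?e01 ?e02 ?e12 // in le1 *; rewrite /T qpointE.
  have hT := (sumT012 k2 x, sumT021 k2 x, sumT120 k2 x).
  rewrite /box_sum /box_term m01 m10 m02 m20 m12 m21 !triE ?(addn0, add0n).
  rewrite !val2_MC_of_edge ?val2_MC_of_edgeN ?hi ?sum_pt2 ?hT //.
  rewrite !val2_MC_of00 ?hi ?sum_pt2 ?hT // /inner_point /pt2 /= ?(bZ, lZ).
  rewrite (br_swap (x := x k0) _ (sA_par AB hb hc) ha); last first.
    by rewrite -(qpointE (z := k2) x (i := k0)) // -(sumT120 k2 x) addrK.
  have L := s_leibniz AB (x k0) ha hb hc.
  rewrite -[RHS](scaler0 _ ((-1) ^+ o)) -L.
  rewrite ?lZ ?scalerDr ?scalerN ?scalerA -?scaleNr.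
  by congr (_ *: _ + _ *: _ + _ *: _); case: (o); case: (p); case: (q); case: (r);
    rewrite /= ?expr0 ?expr1; ring.
(* Single edge between k0 and k2: Leibniz for the bracket with [b]. In the block of k0 and k1 the
   free vertex is now the second one, hence [true] for s2. *)
- have [m01 m10] := emult0 e01.
  have [o [m02 m20]] := emult1 e02.
  have [m12 m21] := emult0 e12.
  apply: (@box_eq0 k2 false false true k1 k0 k1) => [x T|x p q r a b c ha hb hc].
    by split=> le1; rewrite ?C10 ?C20 ?C21 ?e01 ?e02 ?e12 // in le1 *; rewrite /T qpointE.
  have hT := (sumT012 k2 x, sumT021 k2 x, sumT120 k2 x).
  rewrite /box_sum /box_term m01 m10 m02 m20 m12 m21 !triE ?(addn0, add0n).
  rewrite !val2_MC_of_edge ?val2_MC_of_edgeN ?hi ?sum_pt2 ?hT //.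
  rewrite !val2_MC_of00 ?hi ?sum_pt2 ?hT // /inner_point /pt2 /= ?(bZ, lZ).
  rewrite (br_swap (x := x k1) _ (sA_par AB ha hc) hb); last first.
    by rewrite -(qpointE (z := k2) x (i := k1)) // -(sumT021 k2 x) addrK.
  rewrite (br_swap (x := x k1) _ ha hb) //.
  have L := s_leibniz AB (x k1) hb ha hc.
  rewrite -[RHS](scaler0 _ ((-1) ^+ (o (+) (p && q)))) -L [X in X + _ = _]addrC.
  rewrite ?lZ ?scalerDr ?scalerN ?scalerA -?scaleNr.
  by congr (_ *: _ + _ *: _ + _ *: _); case: (o); case: (p); case: (q); case: (r);
    rewrite /= ?expr0 ?expr1; ring.
(* Path with centre k2. The block of its two ends drops out, and the other two terms are opposite
   multiples of [A a (A b c)]. *)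
- have [m01 m10] := emult0 e01.
  have [o [m02 m20]] := emult1 e02.
  have [u [m12 m21]] := emult1 e12.
  apply: (@box_eq0 k2 false false false k1 k0 k0) => [x T|x p q r a b c ha hb hc].
    by split=> le1; rewrite ?C10 ?C20 ?C21 ?e01 ?e02 ?e12 // in le1 *; rewrite /T qpointE.
  have hT := (sumT012 k2 x, sumT021 k2 x, sumT120 k2 x).
  rewrite /box_sum (box_term_outer _ _ _ (sumT012 k2 x)); last by rewrite ?C10 ?C20 ?C21 ?e01 ?e02 ?e12.
  rewrite /box_term m01 m10 m02 m20 m12 m21 !triE ?(addn0, add0n).
  rewrite ?val2_MC_of_edge ?val2_MC_of_edgeN ?hi ?sum_pt2 ?hT // ?lZ.
  rewrite (s_assoc_last ha hb hc) (s_assoc_mid ha hb hc).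
  rewrite ?scaler0 ?addr0 ?add0r ?scalerN ?scalerA -?scaleNr -?scalerDl.
  rewrite [X in X *: _](_ : _ = 0) ?scale0r //.
  by case: (o); case: (u); case: (p); case: (q); case: (r); rewrite /= ?expr0 ?expr1; ring.
(* Single edge between k0 and k1: Leibniz for the bracket with [c]. As k2 is the free vertex of two
   blocks, the nonscalar coordinate is moved to k1. *)
- have [o [m01 m10]] := emult1 e01.
  have [m02 m20] := emult0 e02.
  have [m12 m21] := emult0 e12.
  apply: (@box_eq0 k1 true true false k2 k2 k0) => [x T|x p q r a b c ha hb hc].
    by split=> le1; rewrite ?C10 ?C20 ?C21 ?e01 ?e02 ?e12 // in le1 *; rewrite /T qpointE.
  have hT := (sumT012 k1 x, sumT021 k1 x, sumT120 k1 x).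
  rewrite /box_sum /box_term m01 m10 m02 m20 m12 m21 !triE ?(addn0, add0n).
  rewrite !val2_MC_of_edge ?val2_MC_of_edgeN ?hi ?sum_pt2 ?hT //.
  rewrite !val2_MC_of00 ?hi ?sum_pt2 ?hT // /inner_point /pt2 /= ?(bZ, lZ).
  rewrite (br_swap (x := x k2) _ (sA_par AB ha hb) hc); last first.
    by rewrite -(qpointE (z := k1) x (i := k2)) // -(sumT012 k1 x) addrK.
  rewrite (br_swap (x := x k2) _ hb hc) // (br_swap (x := x k2) _ ha hc) //.
  have L := s_leibniz AB (x k2) hc ha hb.
  rewrite -[RHS](scaler0 _ ((-1) ^+ (o (+) (p && r) (+) (q && r)))) -L addrC addrA.
  rewrite ?lZ ?scalerDr ?scalerN ?scalerA -?scaleNr.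
  by congr (_ *: _ + _ *: _ + _ *: _); case: (o); case: (p); case: (q); case: (r);
    rewrite /= ?expr0 ?expr1; ring.
(* Path with centre k1, where the nonscalar coordinate is placed. *)
- have [o [m01 m10]] := emult1 e01.
  have [m02 m20] := emult0 e02.
  have [u [m12 m21]] := emult1 e12.
  apply: (@box_eq0 k1 true false false k2 k0 k0) => [x T|x p q r a b c ha hb hc].
    by split=> le1; rewrite ?C10 ?C20 ?C21 ?e01 ?e02 ?e12 // in le1 *; rewrite /T qpointE.
  have hT := (sumT012 k1 x, sumT021 k1 x, sumT120 k1 x).
  rewrite /box_sum (box_term_outer _ _ _ (sumT021 k1 x)); last by rewrite ?C10 ?C20 ?C21 ?e01 ?e02 ?e12.
  rewrite /box_term m01 m10 m02 m20 m12 m21 !triE ?(addn0, add0n).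
  rewrite ?val2_MC_of_edge ?val2_MC_of_edgeN ?hi ?sum_pt2 ?hT // ?lZ.
  rewrite (s_assoc_last ha hb hc) (s_assoc_left ha hb hc).
  rewrite ?scaler0 ?addr0 ?add0r ?scalerN ?scalerA -?scaleNr -?scalerDl.
  rewrite [X in X *: _](_ : _ = 0) ?scale0r //.
  by case: (o); case: (u); case: (p); case: (q); case: (r); rewrite /= ?expr0 ?expr1; ring.
(* Path with centre k0, where the nonscalar coordinate is placed. *)
- have [o [m01 m10]] := emult1 e01.
  have [u [m02 m20]] := emult1 e02.
  have [m12 m21] := emult0 e12.
  apply: (@box_eq0 k0 false true true k1 k2 k1) => [x T|x p q r a b c ha hb hc].
    by split=> le1; rewrite ?C10 ?C20 ?C21 ?e01 ?e02 ?e12 // in le1 *; rewrite /T qpointE.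
  have hT := (sumT012 k0 x, sumT021 k0 x, sumT120 k0 x).
  rewrite /box_sum (box_term_outer _ _ _ (sumT120 k0 x)); last by rewrite ?C10 ?C20 ?C21 ?e01 ?e02 ?e12.
  rewrite /box_term m01 m10 m02 m20 m12 m21 !triE ?(addn0, add0n).
  rewrite ?val2_MC_of_edge ?val2_MC_of_edgeN ?hi ?sum_pt2 ?hT // ?lZ.
  rewrite (s_assoc_mid ha hb hc) (s_assoc_left ha hb hc).
  rewrite ?scaler0 ?addr0 ?add0r ?scalerN ?scalerA -?scaleNr -?scalerDl.
  rewrite [X in X *: _](_ : _ = 0) ?scale0r //.
  by case: (o); case: (u); case: (p); case: (q); case: (r); rewrite /= ?expr0 ?expr1; ring.
(* Triangle: each of the three outer graphs has two edges, so all terms vanish and the condition on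
   free vertices is empty. *)
- apply: (@box_eq0 k2 false false false k1 k0 k0) => [x T|x p q r a b c ha hb hc].
    by split=> le1; rewrite ?C10 ?C20 ?C21 ?e01 ?e02 ?e12 // in le1.
  rewrite /box_sum !box_term_outer ?sumT012 ?sumT021 ?sumT120 ?C10 ?C20 ?C21 ?e01 ?e02 ?e12 //.
  by rewrite !scaler0 !addr0.
Qed.

End ToMC.

(** * Reversal of parity *)
Section SignTwist.
Variables (F : fieldType) (charF : [pchar F] =i pred0).
Variables (V : superspace F) (d : {linear V -> V}) (d_even : even_map d).
Local Notation E x := (ev d (fun=> x%:P)).

(** The linear extension of the factor (-1)^p(a) of the correspondence. Being an involution, the
    same twist serves in both directions. *)
Definition psign (v : V) : V := scomp V false v - scomp V true v.

Lemma psign_linear : linear psign.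
Proof.
by move=> c u v; rewrite /psign (linearP (scomp V false)) (linearP (scomp V true)) opprD addrACA scalerBr.
Qed.

Lemma psign_homog p (v : V) : homog p v -> psign v = (-1) ^+ p *: v.
Proof.
move=> hv; rewrite /psign !(scomp_homog _ hv); case: p hv => _ /=.
  by rewrite sub0r expr1 scaleN1r.
by rewrite subr0 expr0 scale1r.
Qed.

Lemma homog_ind (R : V -> Prop) : (forall u v, R u -> R v -> R (u + v)) ->
  (forall b v, homog b v -> R v) -> forall v, R v.
Proof.
by move=> RD Rh v; rewrite -(scompD v); apply: RD; apply: Rh; exact: homog_scomp.
Qed.

Lemma homogZ p c (v : V) : homog p v -> homog p (c *: v).
Proof. by rewrite /homog linearZ /= => ->. Qed.

Lemma psignK v : psign (psign v) = v.
Proof.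
elim/homog_ind: v => [u v hu hv|p v hv].
  by rewrite (linD psign_linear u v) (linD psign_linear (psign u)) hu hv.
by rewrite (psign_homog hv) (psign_homog (homogZ _ hv)) scalerA -signr_addb addbb scale1r.
Qed.

Lemma psign_d v : psign (d v) = d (psign v).
Proof. by rewrite /psign !(scomp_d d_even) raddfB. Qed.

Lemma homog_psign p v : homog p v -> homog p (psign v).
Proof. by move=> hv; rewrite (psign_homog hv); exact: homogZ. Qed.

Lemma ev1_subst_skew x (p : lpoly V 1) :
  E x (lpsubst (fun _ (f : lpoly V 1) => - lpvar ord0 f - lpmap d f) p)
  = ev d (fun=> - 'X - x%:P) p.
Proof.
apply: ev_subst => i q; rewrite raddfB raddfN /= ev_var ev_d pactD !pactN pactX addrC //.
Qed.

(** Once both linear forms act as scalars, the nested bracket is a composite of two evaluated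
    brackets, the shape in which [s_jacobi] is stated. *)
Lemma ev_nest (T : 'I_2 -> {poly F}) (X Y : lpoly V 2 -> lpoly V 2) x y
    (h : V -> lpoly V 1) (p : lpoly V 1) : linear h ->
  (forall q, ev d T (X q) = x *: ev d T q) -> (forall q, ev d T (Y q) = y *: ev d T q) ->
  ev d T (lbr_nest X Y h p) = E y (h (E x p)).
Proof.
move=> hl hX hY.
have gl : linear (fun u => E y (h u)) by move=> c u v; rewrite hl raddfD /= evZ.
rewrite [E x p]/ev /lpext (big_morph (fun u => E y (h u)) (linD gl) (lin0 gl)).
rewrite /lbr_nest /lpext (raddf_sum (ev d T)) /=; apply: eq_bigr => m _.
rewrite /tmon big_ord1 -rmorphXn /= pactC (linZ gl).
elim: (m ord0) => [|k IH] /=.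
  rewrite expr0 scale1r; apply: ev_subst => i q; rewrite hY pactC //.
by rewrite hX IH scalerA exprS.
Qed.

Lemma ev1_map x (h : V -> V) (p : lpoly V 1) : linear h -> E x (lpmap h p) = h (E x p).
Proof.
move=> hl; apply: ev_map => // m u.
by rewrite /tmon big_ord1 -rmorphXn /= !pactC (linZ hl).
Qed.

Lemma ev1_var x (p : lpoly V 1) : E x (lpvar ord0 p) = x *: E x p.
Proof. by rewrite ev_var pactC. Qed.

Section ToPVA.
Variables (A : V -> V -> V) (B : V -> V -> lpoly V 1).
Hypothesis AB : @is_shifted_PVA F (parity_rev V) d A B.
Let mul a b := A (psign a) b.
Let brk a b := B (psign a) b.

Let homogU p (v : V) : homog p v -> homog (V := parity_rev V) (~~ p) v.
Proof. by rewrite /homog /= negbK. Qed.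

Let mulE p a b : homog p a -> mul a b = (-1) ^+ p *: A a b.
Proof. by move=> ha; rewrite /mul (psign_homog ha) (linZ (sA_linl AB b)). Qed.

Let brkE p a b : homog p a -> brk a b = (-1) ^+ p *: B a b.
Proof. by move=> ha; rewrite /brk (psign_homog ha) (linZ (sB_linl AB b)). Qed.

(** An element of parity p in V has parity [~~ p] in the reversed space. After evaluation at scalars
    each axiom is its shifted form multiplied by a sign, and the coefficients agree for every choice
    of parities. *)
Lemma PVA_of_shifted : is_PVA d mul brk.
Proof.
have Apar p q a b : homog p a -> homog q b -> homog (p (+) q) (A a b).
  move=> ha hb; have := sA_par AB (homogU ha) (homogU hb); rewrite /homog /=.
  by case: p ha; case: q hb.
have Bpar p q a b : homog p a -> homog q b -> forall m, homog (p (+) q) (lpcoef m (B a b)).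
  move=> ha hb m; have := sB_par AB (homogU ha) (homogU hb) m; rewrite /homog /=.
  by case: p ha; case: q hb.
have Al := sA_linl AB; have Ar := sA_linr AB.
have Bl := sB_linl AB; have Br := sB_linr AB.
have mull b : linear (mul^~ b) by move=> c u v; rewrite /mul psign_linear Al.
have mulr a : linear (mul a) by move=> c u v; rewrite /mul Ar.
have brl b : linear (brk^~ b) by move=> c u v; rewrite /brk psign_linear Bl.
have brr a : linear (brk a) by move=> c u v; rewrite /brk Br.
have EBpar p q x a b : homog p a -> homog q b -> homog (p (+) q) (E x (B a b)).
  by move=> ha hb; apply: homog_ev => //; exact: Bpar.
split=> //.
- by move=> p q a b ha hb; apply: Apar => //; exact: homog_psign.
- move=> p q a b ha hb; rewrite (mulE _ ha) (mulE _ hb) (sA_comm AB (homogU ha) (homogU hb)).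
  rewrite ?scalerN !scalerA -?scaleNr; congr (_ *: _).
  by case: (p); case: (q); rewrite /= ?expr0 ?expr1; ring.
(* Associativity is stated for all elements but [s_assoc] only for homogeneous ones; additivity in
   each argument bridges the gap. *)
- move=> a b c.
  elim/homog_ind: a => [u v hu hv|p a ha].
    by rewrite !(linD (mull _)) hu hv.
  elim/homog_ind: b => [u v hu hv|q b hb].
    by rewrite (linD (mull _)) !(linD (mulr _)) hu hv (linD (mull _)).
  elim/homog_ind: c => [u v hu hv|r c hc].
    by rewrite !(linD (mulr _)) hu hv.
  rewrite (mulE (a := mul a b) _ (p := p (+) q)); last first.
    by rewrite (mulE _ ha); apply: homogZ; exact: Apar.
  rewrite (mulE b ha) (mulE _ hb) (mulE _ ha) (linZ (Ar _)) (linZ (Al _)).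
  have /eqP := s_assoc AB (homogU ha) (homogU hb) (homogU hc).
  rewrite addr_eq0 => /eqP->; rewrite ?scalerN !scalerA -?scaleNr; congr (_ *: _).
  by case: (p); case: (q); rewrite /= ?expr0 ?expr1; ring.
- by move=> a b; rewrite /mul (sA_der AB) psign_d.
- by move=> p q a b ha hb m; apply: Bpar => //; exact: homog_psign.
- move=> a b; apply: (lpoly1_inj charF (d := d)) => x.
  rewrite raddfN /= ev1_var /brk psign_d.
  by have := sB_sesl AB x (psign a) b; rewrite scaleNr.
- move=> a b; apply: (lpoly1_inj charF (d := d)) => x.
  rewrite raddfD /= ev1_var ev_d; exact: (sB_sesr AB x (psign a) b).
- move=> p q a b ha hb; apply: (lpoly1_inj charF (d := d)) => x.
  rewrite raddfN /= evZ ev1_subst_skew (brkE _ ha) (brkE _ hb) !evZ.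
  have := sB_skew AB x (homogU ha) (homogU hb); rewrite /br_at => ->.
  rewrite ?scalerN !scalerA -?scaleNr; congr (_ *: _).
  by case: (p); case: (q); rewrite /= ?expr0 ?expr1; ring.
- move=> p q a b c ha hb; apply: (ev_scal_inj charF (d := d)) => x.
  have vx q' : ev d (scal x) (lpvar ord0 q') = x ord0 *: ev d (scal x) q'.
    by rewrite ev_var pactC.
  have vy q' : ev d (scal x) (lpvar ord_max q') = x ord_max *: ev d (scal x) q'.
    by rewrite ev_var pactC.
  rewrite raddfB /= evZ.
  rewrite (ev_nest (X := @lpvar F V 2 ord_max) (Y := @lpvar F V 2 ord0)
    (x := x ord_max) (y := x ord0)) //.
  rewrite (ev_nest (X := @lpvar F V 2 ord0) (Y := @lpvar F V 2 ord_max)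
    (x := x ord0) (y := x ord_max)) //.
  rewrite (ev_nest (X := @lpvar F V 2 ord0) (x := x ord0) (y := x ord0 + x ord_max)) //; last first.
    by move=> q'; rewrite raddfD /= vx vy scalerDl.
  move: (x ord0) (x ord_max) => {vx vy x} x y.
  elim/homog_ind: c => [u v hu hv|r c hc].
    have D1 w : brk w (u + v) = brk w u + brk w v := linD (brr w) u v.
    have D2 w s t : brk w (s + t) = brk w s + brk w t := linD (brr w) s t.
    have DE z s t : E z (s + t) = E z s + E z t := raddfD (ev d (fun=> z%:P)) s t.
    by rewrite !D1 !DE !D2 !DE -hu -hv scalerDr opprD addrACA.
  rewrite (brkE (a := E x (brk a b)) _ (p := p (+) q)); last first.
    by rewrite (brkE _ ha) evZ; apply: homogZ; exact: EBpar.
  rewrite (brkE b ha) (brkE _ ha) (brkE c hb) (brkE _ hb) (brkE c ha).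
  rewrite !evZ !(linZ (Br _)) (linZ (Bl _)) !evZ.
  have := s_jacobi AB x y (homogU ha) (homogU hb) (homogU hc); rewrite /br_at.
  move/eqP; rewrite addrC addr_eq0 => /eqP->.
  rewrite !scalerN !scalerDr opprD !scalerA -!scaleNr; congr (_ *: _ + _ *: _);
    by case: (p); case: (q); rewrite /= ?expr0 ?expr1; ring.
- move=> q r a b c hb hc; apply: (lpoly1_inj charF (d := d)) => x.
  rewrite raddfD /= evZ !ev1_map //.
  elim/homog_ind: a => [u v hu hv|p a ha].
    have D1 w : brk (u + v) w = brk u w + brk v w := linD (brl w) u v.
    have D2 w s t : mul (s + t) w = mul s w + mul t w := linD (mull w) s t.
    have DE z s t : E z (s + t) = E z s + E z t := raddfD (ev d (fun=> z%:P)) s t.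
    by rewrite !D1 !DE !D2 hu hv scalerDr addrACA.
  rewrite (brkE _ ha) (brkE b ha) (brkE c ha) (mulE _ hb) (linZ (Br a)) !evZ.
  rewrite (mulE (p := p (+) q)); last by apply: homogZ; exact: EBpar.
  rewrite (mulE (p := p (+) r)); last by apply: homogZ; exact: EBpar.
  rewrite !(linZ (Al _)).
  have := s_leibniz AB x (homogU ha) (homogU hb) (homogU hc); rewrite /br_at.
  move/eqP; rewrite addrC addr_eq0 => /eqP->.
  rewrite !scalerN !scalerBr opprB !scalerA addrAC -scalerDl.
  rewrite [X in _ = X *: _ - _](_ : _ = 0) ?scale0r ?sub0r -?scaleNr; last first.
    by case: (p); case: (q); case: (r); rewrite /= ?expr0 ?expr1; ring.
  by congr (_ *: _); case: (p); case: (q); case: (r); rewrite /= ?expr0 ?expr1; ring.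
Qed.

End ToPVA.

Section FromPVA.
Variables (mul : V -> V -> V) (brk : V -> V -> lpoly V 1).
Hypothesis P : is_PVA d mul brk.
Let A a b := mul (psign a) b.
Let B a b := brk (psign a) b.

Let homogV p (v : V) : homog (V := parity_rev V) p v -> homog (~~ p) v.
Proof. by []. Qed.

Let AE p a b : homog p a -> A a b = (-1) ^+ p *: mul a b.
Proof. by move=> ha; rewrite /A (psign_homog ha) (linZ (mul_linl P b)). Qed.

Let BE p a b : homog p a -> B a b = (-1) ^+ p *: brk a b.
Proof. by move=> ha; rewrite /B (psign_homog ha) (linZ (br_linl P b)). Qed.

Lemma shifted_of_PVA : @is_shifted_PVA F (parity_rev V) d A B.
Proof.
have ml := mul_linl P; have mr := mul_linr P.
have bl := br_linl P; have br := br_linr P.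
have Ebr p q x a b : homog p a -> homog q b -> homog (p (+) q) (E x (brk a b)).
  by move=> ha hb; apply: homog_ev => //; exact: (br_parity P).
split; rewrite /br_at.
- by move=> b c u v; rewrite /A psign_linear ml.
- by move=> a c u v; rewrite /A mr.
- by move=> b c u v; rewrite /B psign_linear bl.
- by move=> a c u v; rewrite /B br.
- move=> p q a b /homogV ha /homogV hb; rewrite /homog /= negbK.
  have := mul_parity P (homog_psign ha) hb; rewrite /homog.
  by case: (p); case: (q).
- move=> p q a b /homogV ha /homogV hb m; rewrite /homog /= negbK.
  have := br_parity P (homog_psign ha) hb m; rewrite /homog.
  by case: (p); case: (q).
- by move=> a b; rewrite /A (mul_der P) psign_d.
- move=> x a b; rewrite /B psign_d (br_sesquil P) raddfN /= ev1_var scaleNr //.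
- move=> x a b; rewrite /B (br_sesquir P) raddfD /= ev1_var ev_d //.
- move=> p q a b /homogV ha /homogV hb; rewrite (AE _ ha) (AE _ hb) (mul_comm P ha hb).
  rewrite !scalerA -scaleNr; congr (_ *: _).
  by case: (p); case: (q); rewrite /= ?expr0 ?expr1; ring.
- move=> p q a b x /homogV ha /homogV hb; rewrite (BE _ ha) (BE _ hb) (br_skew P ha hb).
  rewrite !evZ raddfN /= evZ ev1_subst_skew scalerN !scalerA -scaleNr; congr (_ *: _).
  by case: (p); case: (q); rewrite /= ?expr0 ?expr1; ring.
- move=> p q r a b c /homogV ha /homogV hb /homogV hc.
  rewrite (AE (p := ~~ p (+) ~~ q)); last first.
    by rewrite (AE _ ha); apply: homogZ; exact: (mul_parity P).
  rewrite (AE b ha) (AE _ ha) (AE c hb) (linZ (ml _)) (linZ (mr _)) (mul_assoc P).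
  rewrite !scalerA -scalerDl [X in X *: _](_ : _ = 0) ?scale0r //.
  by case: (p); case: (q); rewrite /= ?expr0 ?expr1; ring.
- move=> p q r x a b c /homogV ha /homogV hb /homogV hc.
  rewrite (AE (a := E x (B a c)) _ (p := ~~ p (+) ~~ r)); last first.
    by rewrite (BE _ ha) evZ; apply: homogZ; exact: Ebr.
  rewrite (AE (a := E x (B a b)) _ (p := ~~ p (+) ~~ q)); last first.
    by rewrite (BE _ ha) evZ; apply: homogZ; exact: Ebr.
  rewrite !(BE _ ha) (AE c hb) (linZ (br a)) !evZ !(linZ (ml _)) (br_leibniz P a hb hc).
  rewrite raddfD /= evZ !ev1_map // !scalerDr !scalerA.
  rewrite -[X in X + _]addrA -scalerBl [X in _ + X *: _ + _](_ : _ = 0); last first.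
    by case: (p); case: (q); case: (r); rewrite /= ?expr0 ?expr1; ring.
  rewrite scale0r addr0 -scalerDl [X in X *: _](_ : _ = 0) ?scale0r //.
  by case: (p); case: (q); case: (r); rewrite /= ?expr0 ?expr1; ring.
- move=> p q r x y a b c /homogV ha /homogV hb /homogV hc.
  rewrite (BE (a := E x (B a b)) _ (p := ~~ p (+) ~~ q)); last first.
    by rewrite (BE _ ha) evZ; apply: homogZ; exact: Ebr.
  rewrite !(BE _ ha) !(BE _ hb) !evZ !(linZ (br _)) !(linZ (bl _)) !evZ.
  pose T : 'I_2 -> F := pt2 x y.
  have vx q' : ev d (scal T) (lpvar ord0 q') = x *: ev d (scal T) q'.
    by rewrite ev_var pactC.
  have vy q' : ev d (scal T) (lpvar ord_max q') = y *: ev d (scal T) q'.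
    by rewrite ev_var pactC.
  have := congr1 (ev d (scal T)) (br_jacobi P c ha hb); rewrite raddfB /= evZ.
  rewrite (ev_nest (X := @lpvar F V 2 ord_max) (Y := @lpvar F V 2 ord0)
    (x := y) (y := x)) //.
  rewrite (ev_nest (X := @lpvar F V 2 ord0) (Y := @lpvar F V 2 ord_max)
    (x := x) (y := y)) //.
  rewrite (ev_nest (X := @lpvar F V 2 ord0) (x := x) (y := x + y)) //; last first.
    by move=> q'; rewrite raddfD /= vx vy scalerDl.
  move=> <-; rewrite !scalerBr !scalerA.
  rewrite addrACA -scalerDl -scalerBl [X in X *: _ + _](_ : _ = 0); last first.
    by case: (p); case: (q); rewrite /= ?expr0 ?expr1; ring.
  rewrite scale0r add0r [X in X *: _](_ : _ = 0) ?scale0r //.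
  by case: (p); case: (q); rewrite /= ?expr0 ?expr1; ring.
Qed.

End FromPVA.
End SignTwist.

(** * The two constructions are mutually inverse *)

Section RoundTrip.
Variables (F : fieldType) (charF : [pchar F] =i pred0).
Variables (U : superspace F) (d : {linear U -> U}) (d_even : even_map d).

(** An element of arity 2 is determined by its values on the arrow and on the empty graph: the cycle
    relation settles the reversed edge and acyclicity everything else. *)
Lemma MC_of_mul_br (f : cochain d 2) : in_Pcl f -> MC_of d (MC_mul f) (MC_br f) = f.
Proof.
move=> fP; apply/funext => G; apply/funext => v.
apply: (evq_inj charF (i0 := ord_max)) => x; have hT := sum_qpoint ord_max x.
rewrite evq_MC_of // [v in RHS]pair_funE -/(val2 f G _ _ _) /MC_val2.
case nG: (nedges G) => [|[|n]].
- have -> : G = g2 0 0.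
    by rewrite [LHS]graph2E; move: nG => /eqP; rewrite addn_eq0 => /andP[/eqP-> /eqP->].
  by rewrite val2_empty.
- have [o [m01 m10]] := @emult1 2 G ord0 ord_max nG.
  rewrite [in RHS](graph2E G) m01 m10; case: (o) => /=.
    by rewrite (val2_rev_arrow charF fP) // scaleN1r.
  by rewrite (val2_arrow charF fP) // scale1r.
- by rewrite (val2_big fP) // nG.
Qed.

Variables (A : U -> U -> U) (B : U -> U -> lpoly U 1).
Hypothesis AB : is_shifted_PVA d A B.

Lemma mul_MC_of : MC_mul (MC_of d A B) = A.
Proof.
apply/funext => a; apply/funext => b; have hT := sum_pt2X (0 : {poly F}).
rewrite -(val2_arrow charF (MC_of_in_Pcl charF AB) a b hT).
exact: etrans (@val2_MC_of_edge F U d A B false _ a b hT) (scale1r _).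
Qed.

Lemma br_MC_of : MC_br (MC_of d A B) = B.
Proof.
apply/funext => a; apply/funext => b; apply: (lpoly1_inj charF (d := d)) => x.
have := br_MC (MC_of d A B) x%:P a b; rewrite /br_at => ->.
by rewrite val2_MC_of00 ?sum_pt2X.
Qed.

Definition odd_MC_of : odd_MC d :=
  OddMC (conj (MC_of_in_Pcl charF AB) (MC_of_sym charF AB))
    (MC_of_odd charF d_even AB) (MC_of_box charF d_even AB).

End RoundTrip.

Lemma odd_MC_inj (F : fieldType) (U : superspace F) (d : {linear U -> U}) (X Y : odd_MC d) :
  MC_val X = MC_val Y -> X = Y.
Proof.
case: X Y => [f W O E] [g W' O' E'] /= e; case: _ / e W' O' E' => W' O' E'.
by rewrite (Prop_irrelevance W W') (Prop_irrelevance O O') (Prop_irrelevance E E').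
Qed.

Lemma PVA_inj (F : fieldType) (V : superspace F) (d : {linear V -> V}) (P Q : PVA d) :
  pva_mul P = pva_mul Q -> pva_br P = pva_br Q -> P = Q.
Proof.
case: P Q => [m b H] [m' b' H'] /= em eb; case: _ / em H' => H'; case: _ / eb H' => H'.
by rewrite (Prop_irrelevance H H').
Qed.

Theorem theorem10p7 (F : fieldType) (charF : [pchar F] =i pred0)
    (V : superspace F) (d : {linear V -> V}) (d_even : even_map d) :
  exists phi : odd_MC (U := parity_rev V) d -> PVA d,
    bijective phi /\
    forall (X : odd_MC (U := parity_rev V) d) (p : bool) (a b : V), homog p a ->
      lpC 1 (pva_mul (phi X) a b)
        = (-1) ^+ p *: q2_eval (MC_val X arrow_graph (pair_fun (U := parity_rev V) a b))
          :> lpoly V 1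
      /\ pva_br (phi X) a b
        = (-1) ^+ p *: q2_eval (MC_val X (empty_graph 2) (pair_fun (U := parity_rev V) a b))
          :> lpoly V 1.
Proof.
have d_even' : even_map (V := parity_rev V) d by move=> p v; exact: d_even.
have sh (X : odd_MC (U := parity_rev V) d) :
    @is_shifted_PVA F (parity_rev V) d (MC_mul (MC_val X)) (MC_br (MC_val X)).
  by case: X => f [fP fs] fo fb; exact: MC_shifted.
pose phi X := MkPVA (PVA_of_shifted charF d_even (sh X)).
pose psi (P : PVA d) : odd_MC (U := parity_rev V) d :=
  odd_MC_of charF d_even' (shifted_of_PVA d_even (pva_ax P)).
exists phi; split.
  (* Either round trip twists the first argument by [psign] twice, so [psignK] leaves the untwisted
     constructions, which are inverse to each other. *)
  exists psi => [X|P].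
    apply: odd_MC_inj; rewrite /psi /=.
    rewrite -[RHS](MC_of_mul_br charF (proj1 (MC_W X))); congr (MC_of d _ _);
      by apply/funext => a; rewrite /= psignK.
  apply: PVA_inj; rewrite /phi /=.
    rewrite (@mul_MC_of F charF (parity_rev V) d _ _ (shifted_of_PVA d_even (pva_ax P))).
    by apply/funext => a; rewrite psignK.
  rewrite (br_MC_of charF).
  by apply/funext => a; rewrite psignK.
move=> X p a b ha; have fP := proj1 (MC_W X).
split; rewrite /= (psign_homog ha).
  rewrite (q2_arrow charF fP a b).1 (linZ (sA_linl (sh X) b)).
  by apply/lpolyP => m; rewrite lpcoefZ !lpcoef_mono scalerMnr.
by rewrite (linZ (sB_linl (sh X) b)).
Qed.
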